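(* There exists an $O(\log n)$-competitive deterministic online algorithm for facility location with deadlines, which runs in polynomial time, where $n$ is the number of vertices of the input graph.
   Context: Facility location with deadlines: given in advance a graph $G=(V,E)$ with $|V|=n$, facility opening costs $f:V\to\mathbb{R}^+$ and edge weights $w:E\to\mathbb{R}^+$; let $\delta$ be the shortest-path metric on $V$ induced by $w$. Requests arrive over time, each request $q$ located at a vertex of $G$ (write $\delta(v,q)$ for the distance from $v$ to that vertex), released at time $r_q$ with a deadline $d_q$ revealed at release. At any time the algorithm may perform the atomic action of choosing a vertex $v$, opening a facility at $v$ and connecting a subset $Q'$ of the pending requests to it; this serves the requests of $Q'$, costs $f(v)+\sum_{q\in Q'}\delta(v,q)$, and the facility disappears immediately afterwards. Each request must be served at some time in $[r_q,d_q]$. The cost is the total cost of all actions. An online algorithm is $\alpha$-competitive if on every input its cost is at most $\alpha$ times the optimal offline cost. *)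

(* Defs.v *)
From mathcomp Require Import all_boot all_order all_algebra finmap.
From mathcomp Require Import all_classical all_reals all_analysis.

Set Implicit Arguments.
Unset Strict Implicit.
Unset Printing Implicit Defensive.

Import Order.TTheory GRing.Theory Num.Theory.
Import numFieldNormedType.Exports.
Local Open Scope classical_set_scope.
Local Open Scope ring_scope.

(* [edge_weight G u v] is meaningful only when [edge G u v]; its other values
   are never used, in particular they are not given to the program. *)
Record network (F : Type) (n : nat) := Network {
  fac_cost : 'I_n -> F;
  edge : rel 'I_n;
  edge_weight : 'I_n -> 'I_n -> F }.

Record request (F : Type) (n : nat) := Request {
  loc : 'I_n;
  release : F;
  deadline : F }.

(* The requests of an instance form a sequence; a request is referred to by its
   position in it. *)
Record action (F : Type) (n : nat) := Action {
  act_time : F;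
  facility : 'I_n;
  served : {fset nat} }.

Definition map_network (F F' : Type) (h : F -> F') n (G : network F n) :=
  Network (h \o fac_cost G) (edge G) (fun u v => h (edge_weight G u v)).

Definition map_request (F F' : Type) (h : F -> F') n (q : request F n) :=
  Request (loc q) (h (release q)) (h (deadline q)).

Section Problem.
Variables (R : realType) (n : nat).
Implicit Types (G : network R n) (s : seq (request R n)).
Implicit Types (a : action R n) (S : seq (action R n)).

Definition wf_network G : Prop :=
  [/\ forall v, 0 < fac_cost G v,
      symmetric (edge G) /\ irreflexive (edge G),
      forall u v, edge G u v ->
        0 < edge_weight G u v /\ edge_weight G u v = edge_weight G v u
    & forall u v, connect (edge G) u v].

Fixpoint walk_weight G (u : 'I_n) (p : seq 'I_n) : R :=
  if p is v :: p' then edge_weight G u v + walk_weight G v p' else 0.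

Definition dist G (u v : 'I_n) : R :=
  inf [set walk_weight G u p | p in [set p | path (edge G) u p /\ last u p = v]].

Definition wf_requests s : Prop :=
  sorted (fun q q' => release q <= release q') s /\
  all (fun q => release q <= deadline q) s.

Definition req s (i : 'I_(size s)) : request R n := tnth (in_tuple s) i.

(* The actions are listed in the order in which they are performed; since each
   request is served exactly once, those served by an action are pending. *)
Definition feasible s S : Prop :=
  [/\ sorted (fun a a' => act_time a <= act_time a') S,
      all (fun a => all (fun i => i < size s)%N (served a)) S,
      forall i : 'I_(size s), count (fun a => val i \in served a) S = 1%N
    & forall i : 'I_(size s),
        all (fun a => (val i \in served a) ==>
               (release (req i) <= act_time a <= deadline (req i))) S].

Definition action_cost G s a : R :=
  fac_cost G (facility a) +
  \sum_(i < size s | val i \in served a) dist G (facility a) (loc (req i)).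

Definition cost G s S : R := \sum_(a <- S) action_cost G s a.

Definition opt G s : R := inf [set cost G s S | S in feasible s].

End Problem.

Definition algorithm (R : realType) :=
  forall n, network R n -> seq (request R n) -> seq (action R n).

(* What is done up to time t depends only on the network and on the requests
   released up to time t. *)
Definition nonanticipating (R : realType) (A : algorithm R) : Prop :=
  forall n (G : network R n) (s s' : seq (request R n)) (t : R),
    wf_network G -> wf_requests s -> wf_requests s' ->
    [seq q <- s | release q <= t] = [seq q <- s' | release q <= t] ->
    [seq a <- A n G s | act_time a <= t] = [seq a <- A n G s' | act_time a <= t].

Definition online_algorithm (R : realType) (A : algorithm R) : Prop :=
  nonanticipating A /\
  forall n (G : network R n) (s : seq (request R n)),
    wf_network G -> wf_requests s -> feasible s (A n G s).

Definition competitive (R : realType) (A : algorithm R) (alpha : nat -> R) :=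
  forall n (G : network R n) (s : seq (request R n)),
    wf_network G -> wf_requests s ->
    cost G s (A n G s) <= alpha n * opt G s.

(* Machine model: a random access machine with a memory of natural numbers and
   a memory of reals, each made of arrays indexed by natural numbers, programmed
   in a while language without real constants other than natural numbers.
   Operations on natural numbers are charged logarithmically.  Operations on
   reals cost one unit, plus the cost of the natural numbers involved; they are
   sums, differences, comparisons, and products and quotients by natural
   numbers.  There is no product of two reals: repeated squaring would produce
   numbers of exponential length.  With these operations, on rational inputs all
   numbers produced have length polynomial in the input length and the cost, so
   that polynomial cost is polynomial time on a Turing machine. *)

Inductive nexp : Type :=
| NLit of nat
| NGet of nat & nexp
| NAdd of nexp & nexp
| NSub of nexp & nexp
| NMul of nexp & nexp.

Inductive rexp : Type :=
| RNat of nexp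
| RGet of nat & nexp
| RAdd of rexp & rexp
| RSub of rexp & rexp
| RMulN of rexp & nexp
| RDivN of rexp & nexp.

Inductive bexp : Type :=
| BLeN of nexp & nexp
| BLeR of rexp & rexp
| BNot of bexp
| BAnd of bexp & bexp.

Inductive cmd : Type :=
| CSkip
| CSetN of nat & nexp & nexp
| CSetR of nat & nexp & rexp
| CSeq of cmd & cmd
| CIf of bexp & cmd & cmd
| CWhile of bexp & cmd.

Definition bitlen (k : nat) : nat := (trunc_log 2 k).+1.

Section Machine.
Variable R : realType.

Record state := State {
  nmem : nat -> nat -> nat;
  rmem : nat -> nat -> R }.

Definition update (T : Type) (m : nat -> nat -> T) (x i : nat) (v : T) :=
  fun y j => if (y == x) && (j == i) then v else m y j.

Fixpoint neval (st : state) (e : nexp) : nat :=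
  match e with
  | NLit k => k
  | NGet x i => nmem st x (neval st i)
  | NAdd e1 e2 => neval st e1 + neval st e2
  | NSub e1 e2 => neval st e1 - neval st e2
  | NMul e1 e2 => neval st e1 * neval st e2
  end%N.

Fixpoint ncost (st : state) (e : nexp) : nat :=
  (bitlen (neval st e) +
   match e with
   | NLit _ => 0
   | NGet _ i => ncost st i
   | NAdd e1 e2 | NSub e1 e2 | NMul e1 e2 => ncost st e1 + ncost st e2
   end)%N.

Fixpoint reval (st : state) (e : rexp) : R :=
  match e with
  | RNat i => (neval st i)%:R
  | RGet x i => rmem st x (neval st i)
  | RAdd e1 e2 => reval st e1 + reval st e2
  | RSub e1 e2 => reval st e1 - reval st e2
  | RMulN e1 i => reval st e1 * (neval st i)%:R
  | RDivN e1 i => reval st e1 / (neval st i)%:R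
  end.

Fixpoint rcost (st : state) (e : rexp) : nat :=
  match e with
  | RNat i | RGet _ i => (ncost st i).+1
  | RAdd e1 e2 | RSub e1 e2 => (rcost st e1 + rcost st e2).+1
  | RMulN e1 i | RDivN e1 i => (rcost st e1 + ncost st i).+1
  end%N.

Fixpoint beval (st : state) (b : bexp) : bool :=
  match b with
  | BLeN e1 e2 => (neval st e1 <= neval st e2)%N
  | BLeR e1 e2 => reval st e1 <= reval st e2
  | BNot b1 => ~~ beval st b1
  | BAnd b1 b2 => beval st b1 && beval st b2
  end.

Fixpoint bcost (st : state) (b : bexp) : nat :=
  match b with
  | BLeN e1 e2 => (ncost st e1 + ncost st e2).+1
  | BLeR e1 e2 => (rcost st e1 + rcost st e2).+1
  | BNot b1 => (bcost st b1).+1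
  | BAnd b1 b2 => (bcost st b1 + bcost st b2).+1
  end%N.

(* [exec c st st' k]: from [st], [c] terminates in [st'] at cost [k]. *)
Inductive exec : cmd -> state -> state -> nat -> Prop :=
| ExecSkip st : exec CSkip st st 1
| ExecSetN st x i e :
    exec (CSetN x i e) st
      (State (update (nmem st) x (neval st i) (neval st e)) (rmem st))
      (ncost st i + ncost st e).+1
| ExecSetR st x i e :
    exec (CSetR x i e) st
      (State (nmem st) (update (rmem st) x (neval st i) (reval st e)))
      (ncost st i + rcost st e).+1
| ExecSeq c1 c2 st st1 st2 k1 k2 :
    exec c1 st st1 k1 -> exec c2 st1 st2 k2 ->
    exec (CSeq c1 c2) st st2 (k1 + k2).+1
| ExecIf b c1 c2 st st1 k :
    exec (if beval st b then c1 else c2) st st1 k ->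
    exec (CIf b c1 c2) st st1 (bcost st b + k).+1
| ExecWhileF b c st :
    ~~ beval st b -> exec (CWhile b c) st st (bcost st b).+1
| ExecWhileT b c st st1 st2 k1 k2 :
    beval st b -> exec c st st1 k1 -> exec (CWhile b c) st1 st2 k2 ->
    exec (CWhile b c) st st2 (bcost st b + k1 + k2).+1.

(* Input natural arrays: 0 holds the numbers of vertices and of requests, 1 the
   adjacency matrix in row-major order, 2 the locations of the requests.
   Input real arrays: 0 holds the facility costs, 1 the matrix of edge weights
   in row-major order, 2 the release times, 3 the deadlines.
   Every other cell is 0. *)
Definition input n (G : network R n) (s : seq (request R n)) : state :=
  State
    (fun x i => nth 0%N (nth [::] [::
       [:: n; size s];
       [seq nat_of_bool (edge G u v) | u <- enum 'I_n, v <- enum 'I_n];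
       [seq nat_of_ord (loc q) | q <- s] ] x) i)
    (fun x i => nth 0 (nth [::] [::
       [seq fac_cost G v | v <- enum 'I_n];
       [seq (if edge G u v then edge_weight G u v else 0)
          | u <- enum 'I_n, v <- enum 'I_n];
       [seq release q | q <- s];
       [seq deadline q | q <- s] ] x) i).

(* Output natural arrays: cell 0 of 3 holds the number of actions, 4 their
   facilities, and 5 gives, for each of the [m] requests, the index of the
   action serving it.  Output real array 4 holds the times of the actions. *)
Definition output (st : state) (m n : nat) (S : seq (action R n)) : Prop :=
  nmem st 3 0 = size S /\
  forall k : 'I_(size S),
    let a := tnth (in_tuple S) k in
    [/\ rmem st 4 k = act_time a,
        nmem st 4 k = facility a
      & forall i, (i \in served a) = (i < m)%N && (nmem st 5 i == k)].

End Machine.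

Definition rat_size (x : rat) : nat := (bitlen `|numq x| + bitlen `|denq x|)%N.

Definition instance_size n (G : network rat n) (s : seq (request rat n)) : nat :=
  (n + \sum_(v < n) rat_size (fac_cost G v)
     + \sum_(u < n) \sum_(v < n | edge G u v) rat_size (edge_weight G u v)
     + \sum_(q <- s) (bitlen (loc q) + rat_size (release q)
                      + rat_size (deadline q)))%N.

(* One program computes the schedule of every instance; its running time is
   measured on instances with rational data, as a function of their length. *)
Definition polynomial_time (R : realType) (A : algorithm R) : Prop :=
  exists (c : cmd) (p : {poly nat}),
    (forall n (G : network R n) (s : seq (request R n)),
       wf_network G -> wf_requests s ->
       exists st k, exec c (input G s) st k /\ output st (size s) (A n G s)) /\
    (forall n (G : network rat n) (s : seq (request rat n)),
       let G' := map_network (ratr : rat -> R) G in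
       let s' := map (map_request (ratr : rat -> R) (n := n)) s in
       wf_network G' -> wf_requests s' ->
       forall st k, exec c (input G' s') st k ->
         (k <= p.[instance_size G s])%N).

(* Main.v *)
(* When the earliest deadline of an unserved request [q] of level [k] is reached,
   a service of budget [B = 2 ^ k] (in units of the least facility cost) serves a
   prefix, in the order of deadlines, of the pending requests of level at most
   [k]: the shortest one for which a dual solution of the facility location
   problem reaches [B], facilities of cost at most [B / n] being free.  The
   remaining ones are deferred, which means raised to level [k + 1].  The prefix
   is served by the solution of Mettu and Plaxton, at cost [O(B)].

   A service is charged to its trigger [q] if [q] has its initial level, at which
   [B] is about the cost of serving [q] alone, and otherwise to the service that
   deferred [q].  The latter exhausted its budget on requests of earlier deadline,
   so the optimum pays the dual value for them.  Connection costs are charged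
   once, as every request is served once.  Since all pending requests not served
   are raised above the level of the service, an optimal action is charged by at
   most two services of each level; as cheap facilities are free, an action of
   facility cost [f] pays [f] only for the levels with [f < B < n f], about
   [log n] of them, and a geometric sum for the lower ones. *)

Require Import Defs.
From mathcomp Require Import all_boot all_order all_algebra finmap.
From mathcomp Require Import all_classical all_reals all_analysis.
From mathcomp Require Import zify ring lra.
Import Order.TTheory GRing.Theory Num.Theory.
Import numFieldNormedType.Exports.
Local Open Scope classical_set_scope.
Local Open Scope ring_scope.

Set Implicit Arguments.
Unset Strict Implicit.
Unset Printing Implicit Defensive.

(** Facility location is hard to solve exactly, so the budget is measured by an explicit feasible
    dual: its radii are least averages of stars, computable with sums and quotients by natural
    numbers. The same dual does two jobs. Weak duality turns an exhausted budget into a lower bound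
    on the offline cost, and rounding turns the dual into a solution within factor three.

    The obstacle is that one offline action can meet many services of a level. Those using an action
    at time [t] are split by whether their trigger is due before [t]. If it is due at [t] or later,
    all requests of the action are released at that service, and those left over leave the level. If
    it is due before [t], the service counts only when it deferred a request that triggers a service
    of the next level, and that request is due at [t] or later. Two such requests would wait
    together, and the service of the first would raise the second. So each class holds at most one
    service of the level.

    The number of levels is not bounded by the numbers of vertices and requests; on rational data
    the bit length of the weights and of the least facility cost bounds the initial ones. *)

Lemma size_filter_lt (T : eqType) (P : pred T) (l : seq T) x :
  x \in l -> ~~ P x -> (size ([seq y <- l | P y]) < size l)%N.
Proof.
move=> xl nP; rewrite size_filter -(count_predC P l) -{1}[count P l]addn0 ltn_add2l.
by rewrite -has_count; apply/hasP; exists x.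
Qed.

(** * Least indices and minima computed by folds *)

Section Argmin.
Variables (R : realType) (key : nat -> R).
Implicit Types l : seq nat.

(* [0] stands for no index and [i.+1] for the index [i]. *)
Definition argmin l : nat :=
  foldl (fun b i => if (b == 0%N) || (key i < key b.-1) then i.+1 else b) 0%N l.

Lemma argmin_rcons l i : argmin (rcons l i) =
  if (argmin l == 0%N) || (key i < key (argmin l).-1) then i.+1 else argmin l.
Proof. by rewrite /argmin foldl_rcons. Qed.

Variant argmin_spec l : nat -> Type :=
| ArgminNone of l = [::] : argmin_spec l 0
| ArgminSome b of b \in l & (forall y, y \in l -> key b < key y \/ key b = key y /\ (b <= y)%N) :
    argmin_spec l b.+1.

Lemma argminP l : sorted ltn l -> argmin_spec l (argmin l).
Proof.
elim/last_ind: l => [|l i IH] sl; first exact: ArgminNone.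
have sl' : sorted ltn l by move: sl; rewrite -cats1 => /cat_sorted2[].
have lti y : y \in l -> (y < i)%N.
  move=> yl; move: sl; rewrite -rev_sorted rev_rcons /= path_sortedE; last first.
    by move=> a b c ba ac; exact: ltn_trans ac ba.
  by move=> /andP[/allP + _]; apply; rewrite mem_rev.
rewrite argmin_rcons; case: (IH sl') => [l0|b bl bmin] /=.
  apply: ArgminSome; first by rewrite mem_rcons inE eqxx.
  by move=> y; rewrite l0 /= inE => /eqP ->; right.
case: ltP => ib.
  apply: ArgminSome; first by rewrite mem_rcons inE eqxx.
  move=> y; rewrite mem_rcons inE => /predU1P[->|yl]; first by right.
  by left; case: (bmin _ yl) => [|[<- _]//]; apply: lt_trans.
apply: ArgminSome; first by rewrite mem_rcons inE bl orbT.
move=> y; rewrite mem_rcons inE => /predU1P[->|/bmin//].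
move: ib; rewrite le_eqVlt => /predU1P[->|]; last by left.
by right; split => //; exact/ltnW/lti.
Qed.

Lemma argmin_le l b y : sorted ltn l -> argmin l = b.+1 -> y \in l -> key b <= key y.
Proof.
by move=> sl; case: (argminP sl) => // c cl cmin [<-] /cmin[/ltW//|[->]].
Qed.

Lemma argmin_mem l b : sorted ltn l -> argmin l = b.+1 -> b \in l.
Proof. by move=> sl; case: (argminP sl) => // c cl cmin [<-]. Qed.

Lemma argmin_some l : sorted ltn l -> l != [::] -> exists b, argmin l = b.+1.
Proof. by move=> sl; case: (argminP sl) => [->//|b _ _ _]; exists b. Qed.

(** Ties go to the least index, so the result depends only on the members of the list and their
    keys. This identifies the minimum of a sublist of the pending requests, and the triggers of two
    runs that share a past. *)
Lemma argmin_unique l b : sorted ltn l -> b \in l ->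
  (forall y, y \in l -> key b < key y \/ key b = key y /\ (b <= y)%N) ->
  argmin l = b.+1.
Proof.
move=> sl bl bmin; case: (argminP sl) => [l0|c cl cmin]; first by rewrite l0 in bl.
case: (bmin _ cl) => [bc|[bc bc']]; case: (cmin _ bl) => [cb|[cb cb']].
- by move: (lt_trans bc cb); rewrite ltxx.
- by move: bc; rewrite cb ltxx.
- by move: cb; rewrite bc ltxx.
- by congr _.+1; apply/eqP; rewrite eqn_leq bc' cb'.
Qed.

End Argmin.

Lemma eq_argmin (R : realType) (key key' : nat -> R) l :
  {in l, key =1 key'} -> argmin key l = argmin key' l.
Proof.
elim/last_ind: l => // l i IH e.
have el : {in l, key =1 key'} by move=> y yl; apply: e; rewrite mem_rcons inE yl orbT.
rewrite !argmin_rcons -IH // e ?mem_rcons ?inE ?eqxx //.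
have [//|] := eqVneq (argmin key l) 0%N; rewrite /=.
have mem_arg : forall l', argmin key l' != 0%N -> (argmin key l').-1 \in l'.
  elim/last_ind => // l' j IH'; rewrite argmin_rcons; case: ifP => /= [|/norP[ne _] _].
    by rewrite mem_rcons inE eqxx.
  by rewrite mem_rcons inE IH' ?orbT.
by move=> /mem_arg/el ->.
Qed.

Section FoldMin.
Variable R : realType.
Implicit Types (x y : R) (l : seq R).

Lemma foldl_min_le x l : foldl Num.min x l <= x.
Proof. by elim: l x => //= y l IH x; rewrite (le_trans (IH _))// ge_min lexx. Qed.

Lemma foldl_min_le_mem x l y : y \in l -> foldl Num.min x l <= y.
Proof.
elim: l x => //= z l IH x; rewrite inE => /predU1P[->|/IH //].
by rewrite (le_trans (foldl_min_le _ _))// ge_min lexx orbT.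
Qed.

Lemma foldl_min_mem x l : foldl Num.min x l = x \/ foldl Num.min x l \in l.
Proof.
elim: l x => [|z l IH] x /=; first by left.
case: (IH (Num.min x z)) => [->|zl]; last by right; rewrite inE zl orbT.
by rewrite minEle; case: ifP => _; [left|right; rewrite inE eqxx].
Qed.

End FoldMin.

(** * Facility location duals *)

Section Dual.
Variables (R : realType) (n : nat) (c : nat -> R) (d : nat -> nat -> R).
Variables (q0 : nat) (Q : seq nat).

(** Among the stars centred at [v], one of least average cost consists of all requests within some
    distance [d v i], so only these balls are compared. *)
Definition ball_sum v i : R := \sum_(j <- Q | d v j <= d v i) d v j.
Definition ball_size v i : nat := count (fun j => d v j <= d v i) Q.
Definition star v i : R := (c v + ball_sum v i) / (ball_size v i)%:R.

(* The solution [r] of [\sum_(i <- Q) (r - d v i)^+ = c v], as the least average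
   cost of a star centred at [v]. *)
Definition dual_radius v : R := foldl Num.min (c v + d v q0) [seq star v i | i <- Q].

(* A feasible dual solution, as in the analysis of Mettu and Plaxton. *)
Definition price i : R :=
  foldl Num.min (Num.max (dual_radius 0) (d 0 i))
    [seq Num.max (dual_radius v) (d v i) | v <- iota 0 n].

Definition dual_value : R := \sum_(i <- Q) price i.

Hypothesis q0Q : q0 \in Q.
Hypothesis c_ge0 : forall v, 0 <= c v.
Hypothesis d_ge0 : forall v i, 0 <= d v i.

Lemma sum_ball v i (r : R) :
  \sum_(j <- Q | d v j <= d v i) (r - d v j) = r * (ball_size v i)%:R - ball_sum v i.
Proof.
by rewrite sumrB big_const_seq iter_addr addr0 mulr_natr.
Qed.

Lemma ball_size_gt0 v i : i \in Q -> 0 < (ball_size v i)%:R :> R.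
Proof. by move=> iQ; rewrite ltr0n -has_count; apply/hasP; exists i. Qed.

Lemma radius_ge0 v : 0 <= dual_radius v.
Proof.
rewrite /dual_radius; case: (foldl_min_mem (c v + d v q0) [seq star v i | i <- Q]) => [->|].
  by rewrite addr_ge0.
by move=> /mapP[i iQ ->]; rewrite divr_ge0 ?ler0n// addr_ge0// sumr_ge0.
Qed.

Lemma mem_argmax (l : seq nat) (g : nat -> R) : l != [::] ->
  exists2 i, i \in l & forall j, j \in l -> g j <= g i.
Proof.
elim: l => // a [|b l] IH _.
  by exists a; rewrite ?inE // => j; rewrite inE => /eqP ->.
have [//|i il imax] := IH; have [ga|ga] := leP (g a) (g i).
  exists i; first by rewrite inE il orbT.
  by move=> j; rewrite inE => /predU1P[->|/imax].
exists a; first by rewrite inE eqxx.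
by move=> j; rewrite inE => /predU1P[->|/imax/le_trans]; last by apply; exact: ltW.
Qed.

(** The requests strictly inside the radius, if any, form the ball through the farthest of them. The
    radius is at most the average cost of that star, and clearing the denominator gives the
    bound. *)
Lemma sum_radius_le v : \sum_(i <- Q) Num.max 0 (dual_radius v - d v i) <= c v.
Proof.
pose T := [seq i <- Q | d v i < dual_radius v].
have -> : \sum_(i <- Q) Num.max 0 (dual_radius v - d v i) =
          \sum_(i <- Q | d v i < dual_radius v) (dual_radius v - d v i).
  rewrite [RHS]big_mkcond; apply: eq_bigr => i _.
  by rewrite /Num.max subr_gt0.
have [T0|Tn0] := eqVneq T [::].
  by rewrite -big_filter -/T T0 big_nil.
have [i] := mem_argmax (d v) Tn0; rewrite mem_filter => /andP[ir iQ] imax.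
have -> : \sum_(i <- Q | d v i < dual_radius v) (dual_radius v - d v i) =
          \sum_(j <- Q | d v j <= d v i) (dual_radius v - d v j).
  rewrite big_seq_cond [RHS]big_seq_cond; apply: eq_bigl => j.
  case jQ : (j \in Q) => //=; apply/idP/idP => [jr|ji].
    by apply: imax; rewrite mem_filter jr.
  exact: le_lt_trans ir.
have : dual_radius v <= star v i.
  by apply: foldl_min_le_mem; apply/mapP; exists i.
by rewrite /star ler_pdivlMr ?ball_size_gt0// sum_ball; lra.
Qed.

(** The radius is attained by some star, whose ball already contributes [c v]; all other terms are
    nonnegative. *)
Lemma sum_radius_ge v : c v <= \sum_(i <- Q) Num.max 0 (dual_radius v - d v i).
Proof.
have ge0 (j : nat) : 0 <= Num.max 0 (dual_radius v - d v j) by rewrite le_max lexx.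
have : dual_radius v = c v + d v q0 \/ dual_radius v \in [seq star v i | i <- Q].
  exact: foldl_min_mem.
(* When the minimum is the starting value of the fold, the star of [q0] alone, the term of [q0] is
   at least [c v]. *)
case=> [e|].
  rewrite (big_rem q0) //= -[c v]addr0 lerD ?sumr_ge0// le_max {1}e.
  by apply/orP; right; lra.
move=> /mapP[i iQ e].
suff : c v <= \sum_(j <- Q | d v j <= d v i) (dual_radius v - d v j).
  move=> /le_trans; apply; rewrite big_mkcond; apply: ler_sum => j _.
  by case: ifP => _; rewrite ?le_max ?lexx ?orbT.
have bs := ball_size_gt0 v iQ.
rewrite sum_ball e /star mulfVK ?gt_eqF//; lra.
Qed.

Lemma price_le v i : (v < n)%N -> price i <= Num.max (dual_radius v) (d v i).
Proof.
move=> vn; apply: foldl_min_le_mem; apply/mapP; exists v => //.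
by rewrite mem_iota.
Qed.

Lemma price_attained i : (0 < n)%N ->
  exists2 v, (v < n)%N & price i = Num.max (dual_radius v) (d v i).
Proof.
move=> n0; have : price i = Num.max (dual_radius 0) (d 0 i) \/
    price i \in [seq Num.max (dual_radius v) (d v i) | v <- iota 0 n] by exact: foldl_min_mem.
case=> [e|]; first by exists 0%N.
by move=> /mapP[v]; rewrite mem_iota => vn e; exists v.
Qed.

(** The dual constraint of facility [v]: the price of [i] exceeds [d v i] by at most the
    contribution of [i] to [v], and the contributions sum to at most [c v]. *)
Lemma price_sum_le v (P : pred nat) : (v < n)%N ->
  \sum_(i <- Q | P i) price i <= c v + \sum_(i <- Q | P i) d v i.
Proof.
move=> vn; rewrite -lerBlDr -sumrB; apply: le_trans (sum_radius_le v).
rewrite big_mkcond; apply: ler_sum => i _; case: ifP => _.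
  by rewrite le_max subr_le0 lerD2r orbC -le_max price_le.
by rewrite le_max lexx.
Qed.

(** Weak duality: the dual constraint of each element of [A] is summed over the requests assigned to
    it. As [A] is a list of arbitrary items, this applies both to solutions built by the algorithm
    and to the actions of an offline schedule. *)
Lemma dual_value_le (T : eqType) (A : seq T) (fac : T -> nat) (sigma : nat -> T) :
  (forall i, i \in Q -> sigma i \in A) -> (forall a, a \in A -> (fac a < n)%N) ->
  dual_value <= \sum_(a <- A) c (fac a) + \sum_(i <- Q) d (fac (sigma i)) i.
Proof.
rewrite /dual_value -lerBlDr -sumrB.
have : (forall a, a \in A -> (fac a < n)%N) ->
  (forall i, i \in Q -> sigma i \in A -> sigma i \in A) by [].
(* The induction on [A] splits off the requests assigned to its head, which forces the restriction
   to a subset [P]. *)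
suff main (P : pred nat) : (forall i, i \in Q -> P i -> sigma i \in A) ->
    (forall a, a \in A -> (fac a < n)%N) ->
    \sum_(i <- Q | P i) (price i - d (fac (sigma i)) i) <= \sum_(a <- A) c (fac a).
  by move=> _ sA An; apply: (main xpredT) => // i /sA.
elim: A P => [|a A IH] P sA An.
  rewrite big_nil big_seq_cond big_pred0// => i.
  by apply/negP => /andP[iQ] /(sA _ iQ).
rewrite big_cons (bigID (fun i => sigma i == a)) /= lerD//.
  rewrite (eq_bigr (fun i => price i - d (fac a) i)); last by move=> i /andP[_ /eqP ->].
  by rewrite sumrB lerBlDr price_sum_le// An// inE eqxx.
apply: IH => [i iQ /andP[Pi ne]|b bA]; last by apply: An; rewrite inE bA orbT.
by have := sA _ iQ Pi; rewrite inE (negPf ne).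
Qed.

End Dual.

(** * The greedy rounding of Mettu and Plaxton *)

Section MettuPlaxton.
Variables (R : realType) (n : nat) (delta : nat -> nat -> R) (loc : nat -> nat).
Variables (c : nat -> R) (q0 : nat) (Q : seq nat).
Let d v i := delta v (loc i).
Let r := dual_radius c d q0 Q.

(** The pair holds the unprocessed vertices and the opened ones, in order of opening. Vertices come
    by increasing radius, and one is opened unless an open vertex lies within twice its radius. *)
Definition open_step (x : seq nat * seq nat) : seq nat * seq nat :=
  if argmin r x.1 is v.+1 then
    ([seq w <- x.1 | w != v],
     if has (fun z => delta z v <= r v *+ 2) x.2 then x.2 else rcons x.2 v)
  else x.

Definition opened : seq nat := (iter n open_step (iota 0 n, [::])).2.

Definition closest i : nat :=
  (argmin (d^~ i) [seq z <- iota 0 n | z \in opened]).-1.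

Hypothesis q0Q : q0 \in Q.
Hypothesis c_ge0 : forall v, 0 <= c v.
Hypothesis delta_ge0 : forall u v, 0 <= delta u v.
Hypothesis delta_refl : forall v, delta v v = 0.
Hypothesis deltaC : forall u v, delta u v = delta v u.
Hypothesis delta_triangle : forall u v w, delta u w <= delta u v + delta v w.

(** By the third clause radii are processed in increasing order. Hence the test made with the radius
    of the newly opened vertex, the larger of the two, gives the separation of the last clause for
    either endpoint. *)
Let open_inv (x : seq nat * seq nat) :=
  [/\ sorted ltn x.1 /\ {subset x.1 <= iota 0 n},
      uniq x.2 /\ {subset x.2 <= [predD iota 0 n & x.1]},
      forall p w, (p < n)%N -> p \notin x.1 -> w \in x.1 -> r p <= r w,
      forall p, (p < n)%N -> p \notin x.1 ->
        exists z, [/\ z \in x.2, delta z p <= r p *+ 2 & r z <= r p]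
    & forall z z', z \in x.2 -> z' \in x.2 -> z != z' -> r z *+ 2 < delta z z'].

Lemma open_stepP x : open_inv x -> open_inv (open_step x).
Proof.
move=> [[s1 sub1] [u2 sub2] mono dom sep]; rewrite /open_step.
case E : (argmin r x.1) => [|v] //.
have vx : v \in x.1 by apply: argmin_mem E.
have vmin w : w \in x.1 -> r v <= r w by apply: argmin_le E.
have vn : (v < n)%N by have := sub1 _ vx; rewrite mem_iota.
have r0 w : 0 <= r w by apply: radius_ge0 => // *; exact: delta_ge0.
have in1 p : (p \notin [seq w <- x.1 | w != v]) = (p == v) || (p \notin x.1).
  by rewrite mem_filter negb_and negbK.
have zlt z : z \in x.2 -> (z < n)%N /\ z \notin x.1.
  by move=> /sub2; rewrite inE /= mem_iota => /andP[? ?].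
split=> /=.
- split; first by apply: sorted_filter => //; exact: ltn_trans.
  by move=> w; rewrite mem_filter => /andP[_ /sub1].
- case: ifP => [_|_]; split => //.
  + move=> z zx; have [zn zx1] := zlt _ zx.
    by rewrite inE /= mem_iota zn in1 zx1 orbT.
  + by rewrite rcons_uniq u2 andbT; apply/negP => /zlt[_]; rewrite vx.
  + move=> z; rewrite mem_rcons !inE => /predU1P[->|zx].
      by rewrite in1 eqxx mem_iota vn.
    by have [zn zx1] := zlt _ zx; rewrite in1 zx1 orbT mem_iota zn.
- move=> p w pn; rewrite in1 mem_filter => /predU1P[->|px] /andP[_ wx].
    exact: vmin.
  exact: mono.
- move=> p pn; rewrite in1 => /predU1P[->|px].
    case: ifP => [/hasP[z zx zv]|_].
      by exists z; split => //; have [zn zx1] := zlt _ zx; apply: mono.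
    exists v; rewrite mem_rcons inE eqxx; split => //.
    by rewrite delta_refl mulrn_wge0.
  have [z [zx zp rz]] := dom _ pn px; exists z; split => //.
  by case: ifP => // _; rewrite mem_rcons inE zx orbT.
- case: ifP => // /hasPn nh z z'.
  have rzv y : y \in x.2 -> r y *+ 2 < delta y v /\ r v *+ 2 < delta v y.
    move=> yx; have := nh _ yx; rewrite -ltNge => vy; rewrite (deltaC v); split=> //.
    by apply: le_lt_trans vy; have [yn yx1] := zlt _ yx; rewrite lerMn2r mono.
  rewrite !mem_rcons !inE => /predU1P[->|zx] /predU1P[->|zx'].
  + by rewrite eqxx.
  + by move=> _; case: (rzv _ zx').
  + by move=> _; case: (rzv _ zx).
  + exact: sep.
Qed.

Let open_size k x : open_inv x -> (size x.1 <= k)%N ->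
  (iter k open_step x).1 = [::] /\ open_inv (iter k open_step x).
Proof.
elim: k x => [|k IH] x ix; first by rewrite leqn0 size_eq0 => /eqP.
move=> xk; rewrite iterSr; apply: IH; first exact: open_stepP.
rewrite /open_step; case E : (argmin r x.1) => [|v] /=.
  have [[s1 _] _ _ _ _] := ix.
  by have [->//|/(argmin_some r s1)[b]] := eqVneq x.1 [::]; rewrite E.
have [[s1 _] _ _ _ _] := ix.
have vx : v \in x.1 by apply: argmin_mem E.
by rewrite -ltnS; apply: leq_trans xk; apply: (size_filter_lt vx); rewrite eqxx.
Qed.

Let open_init : open_inv (iota 0 n, [::]).
Proof.
split => //=; first by split => //; exact: iota_ltn_sorted.
by move=> p w pn; rewrite mem_iota pn.
by move=> p pn; rewrite mem_iota pn.
Qed.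

Let open_final : (iter n open_step (iota 0 n, [::])).1 = [::] /\
  open_inv (iter n open_step (iota 0 n, [::])).
Proof. by apply: open_size; rewrite ?size_iota. Qed.

Lemma opened_uniq : uniq opened.
Proof. by have [_ [_ []]] := open_final. Qed.

Lemma opened_lt z : z \in opened -> (z < n)%N.
Proof.
by have [_ [_ [_ sub] _ _ _]] := open_final; move=> /sub; rewrite inE /= mem_iota => /andP[].
Qed.

Lemma opened_dominates v : (v < n)%N ->
  exists z, [/\ z \in opened, delta z v <= r v *+ 2 & r z <= r v].
Proof. by have [e [_ _ _ dom _]] := open_final; move=> vn; apply: dom; rewrite ?e. Qed.

Lemma opened_separated z z' : z \in opened -> z' \in opened -> z != z' ->
  r z *+ 2 < delta z z'.
Proof. by have [_ [_ _ _ _ ]] := open_final; apply. Qed.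

Lemma closestP i : (0 < n)%N ->
  closest i \in opened /\ forall z, z \in opened -> d (closest i) i <= d z i.
Proof.
move=> n0; have [z0 [z0o _ _]] := opened_dominates n0; rewrite /closest.
set l := [seq z <- _ | _].
have sl : sorted ltn l by apply: sorted_filter; [exact: ltn_trans|exact: iota_ltn_sorted].
have ml z : (z \in l) = (z \in opened).
  rewrite mem_filter mem_iota /=; case zo : (z \in opened) => //=.
  by rewrite opened_lt.
have [|b E] := argmin_some (d^~ i) sl.
  by apply/eqP => l0; move: (ml z0); rewrite l0 z0o.
rewrite E /= -ml; split; first exact: argmin_mem E.
by move=> z; rewrite -ml; apply: (argmin_le sl E).
Qed.

(** The factor three, request by request: three times its price pays for its connection and for all
    its contributions to open facilities. Here [v] attains the price, [z'] is the open vertex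
    dominating [v], and [p] is the price. *)
Let charge_le i : (0 < n)%N ->
  d (closest i) i + \sum_(z <- opened) Num.max 0 (r z - d z i) <= price n c d q0 Q i *+ 3.
Proof.
move=> n0; have [co cmin] := closestP i n0.
have [v vn ->] := price_attained c d q0 Q i n0; rewrite -/r.
have [z' [z'o z'v rz'v]] := opened_dominates vn.
have r0 w : 0 <= r w by apply: radius_ge0 => // *; exact: delta_ge0.
set p := Num.max _ _.
have [rp dp] : r v <= p /\ d v i <= p by rewrite !le_max !lexx orbT.
(* If [i] contributes to no open facility, going through [v] to [z'] costs at most
   [d v i + 2 * r v], which is at most [3 * p]. *)
have [/hasP[z zo zi]|/hasPn nh] := boolP (has (fun z => d z i < r z) opened); last first.
  rewrite big_seq big1 ?addr0 => [|z zo]; last first.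
    by apply/max_idPl; rewrite subr_le0 leNgt; exact: nh.
  apply: le_trans (cmin _ z'o) _.
  have := delta_triangle z' v (loc i); rewrite -/(d _ _) -/(d _ _); lra.
(* By separation no two balls of radius [r] around open facilities contain [i], so [z] is the only
   facility receiving a contribution. *)
have far w : w \in opened -> w != z -> r w <= d w i.
  move=> wo wz; rewrite leNgt; apply/negP => wi.
  have := opened_separated wo zo wz.
  have := opened_separated zo wo; rewrite eq_sym wz => /(_ isT).
  have := delta_triangle w (loc i) z; rewrite (deltaC (loc i) z) (deltaC z w).
  rewrite -/(d w i) -/(d z i); lra.
rewrite (big_rem z) //= big_seq big1 ?addr0 => [|w]; last first.
  rewrite mem_rem_uniq ?opened_uniq// inE /= => /andP[wz wo].
  by apply/max_idPl; rewrite subr_le0 far.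
rewrite (max_idPr _); last by rewrite subr_ge0 ltW.
(* Connection and contribution to [z] add up to [r z]. For [z] distinct from [z'], separation and
   the path through [i] and [v] give [2 * r z < r z + 3 * p]. *)
suff : r z <= p *+ 3 by have := cmin _ zo; lra.
have [e|ne] := eqVneq z z'; first by rewrite e; have := r0 v; lra.
have := opened_separated zo z'o ne.
have := delta_triangle z (loc i) z'; have := delta_triangle (loc i) v z'.
rewrite (deltaC (loc i) v) (deltaC v z') -/(d z i) -/(d v i); lra.
Qed.

Lemma opened_cost : (0 < n)%N ->
  \sum_(v <- opened) c v + \sum_(i <- Q) d (closest i) i <= dual_value n c d q0 Q *+ 3.
Proof.
move=> n0; rewrite /dual_value -sumrMnl.
have : \sum_(v <- opened) c v <= \sum_(v <- opened) \sum_(i <- Q) Num.max 0 (r v - d v i).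
  by apply: ler_sum => v _; apply: sum_radius_ge => // *; exact: delta_ge0.
rewrite exchange_big /= => h.
apply: le_trans (_ : \sum_(i <- Q)
  (d (closest i) i + \sum_(z <- opened) Num.max 0 (r z - d z i)) <= _); last first.
  by apply: ler_sum => i _; exact: charge_le.
by rewrite big_split /=; lra.
Qed.

End MettuPlaxton.

(** * The algorithm *)

Section Algorithm.
Variables (R : realType) (n m : nat) (f : nat -> R) (delta : nat -> nat -> R).
Variables (loc : nat -> nat) (rel dl : nat -> R).
Let d v i := delta v (loc i).

Definition min_cost : R := foldl Num.min (f 0) [seq f v | v <- iota 0 n].

Definition single_cost i : R :=
  foldl Num.min (f 0 + d 0 i) [seq f v + d v i | v <- iota 0 n].

Definition scale k : R := min_cost * 2 ^+ k.

(** A suitable level exists once facility costs are positive, by [scale_unbounded]; the definition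
    is made before that hypothesis, so it decides existence, and the default 0 is then never
    taken. *)
Definition base_level i : nat :=
  if pselect (exists k, single_cost i <= scale k) is left h then ex_minn h else 0%N.

(* All the facilities that are made free may be opened at total cost [B]. *)
Definition reduced_cost B v : R := if n%:R * f v <= B then 0 else f v.

(* Which requests have been served, and the levels of the others. *)
Definition progress : Type := (nat -> bool) * (nat -> nat).
Implicit Type x : progress.

Definition pending x : seq nat := [seq i <- iota 0 m | ~~ x.1 i].

Definition eligible x q : seq nat :=
  [seq i <- iota 0 m | [&& ~~ x.1 i, rel i <= dl q & (x.2 i <= x.2 q)%N]].

Definition select (E todo : seq nat) : seq nat := [seq i <- E | i \notin todo].

Definition pick_step B q E todo : seq nat :=
  if dual_value n (reduced_cost B) d q (select E todo) < B then
    if argmin dl todo is b.+1 then [seq i <- todo | i != b] else todo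
  else todo.

Definition deferred x q : seq nat :=
  iter m (pick_step (scale (x.2 q)) q (eligible x q)) (eligible x q).

Definition taken x q : seq nat := select (eligible x q) (deferred x q).

Definition serve_step x : progress :=
  if argmin dl (pending x) is q.+1 then
    (fun i => x.1 i || (i \in taken x q),
     fun i => if i \in deferred x q then (x.2 q).+1 else x.2 i)
  else x.

Definition state_at j : progress := iter j serve_step (fun=> false, base_level).

Definition facilities x q : seq nat :=
  opened n delta loc (reduced_cost (scale (x.2 q))) q (taken x q).

Definition assigned x q i : nat :=
  closest n delta loc (reduced_cost (scale (x.2 q))) q (taken x q) i.

(* Time, facility and requests served. *)
Definition services x : seq (R * nat * seq nat) :=
  if argmin dl (pending x) is q.+1 then
    [seq (dl q, v, [seq i <- taken x q | assigned x q i == v]) | v <- facilities x q]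
  else [::].

(** At most [m] services occur, since each one serves at least its trigger; later steps produce
    nothing. *)
Definition schedule : seq (R * nat * seq nat) :=
  flatten [seq services (state_at j) | j <- iota 0 m].

Hypothesis n_gt0 : (0 < n)%N.
Hypothesis f_gt0 : forall v, 0 < f v.
Hypothesis delta_ge0 : forall u v, 0 <= delta u v.
Hypothesis delta_refl : forall v, delta v v = 0.
Hypothesis deltaC : forall u v, delta u v = delta v u.
Hypothesis delta_triangle : forall u v w, delta u w <= delta u v + delta v w.
Hypothesis rel_le_dl : forall i, (i < m)%N -> rel i <= dl i.

Lemma min_cost_gt0 : 0 < min_cost.
Proof.
rewrite /min_cost; have [->//|] := foldl_min_mem (f 0) [seq f v | v <- iota 0 n].
by move=> /mapP[v _ ->].
Qed.

Lemma min_cost_le v : (v < n)%N -> min_cost <= f v.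
Proof.
move=> vn; apply: foldl_min_le_mem; apply/mapP; exists v => //.
by rewrite mem_iota.
Qed.

Lemma scale_gt0 k : 0 < scale k.
Proof. by rewrite mulr_gt0 ?min_cost_gt0// exprn_gt0. Qed.

Lemma scaleS k : scale k.+1 = scale k * 2.
Proof. by rewrite /scale exprSr mulrA. Qed.

Lemma ler_scale k l : (k <= l)%N -> scale k <= scale l.
Proof.
by move=> kl; rewrite ler_pM2l ?min_cost_gt0// ler_weXn2l// ler1n.
Qed.

Lemma single_cost_le v i : (v < n)%N -> single_cost i <= f v + d v i.
Proof.
move=> vn; apply: foldl_min_le_mem; apply/mapP; exists v => //.
by rewrite mem_iota.
Qed.

Lemma single_cost_attained i : exists2 v, (v < n)%N & single_cost i = f v + d v i.
Proof.
have : single_cost i = f 0 + d 0 i \/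
    single_cost i \in [seq f v + d v i | v <- iota 0 n] by exact: foldl_min_mem.
case=> [e|]; first by exists 0%N.
by move=> /mapP[v]; rewrite mem_iota => vn e; exists v.
Qed.

Lemma scale_unbounded (y : R) : exists k, y <= scale k.
Proof.
have h := min_cost_gt0.
have [k hk] : exists k : nat, y / min_cost < k%:R.
  exists (Num.truncn `|y / min_cost|).+1.
  exact: le_lt_trans (ler_norm _) (truncnS_gt _).
exists k; rewrite /scale mulrC -ler_pdivrMr//; apply: le_trans (ltW hk) _.
by rewrite -natrX ler_nat ltnW// ltn_expl.
Qed.

Lemma base_levelP i : single_cost i <= scale (base_level i) /\
  forall k, single_cost i <= scale k -> (base_level i <= k)%N.
Proof.
rewrite /base_level; case: pselect => [h|[]]; last exact: scale_unbounded.
by case: ex_minnP.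
Qed.

(** At a positive level, the preceding scale is below the single cost by minimality. At level 0 the
    scale is the least facility cost, which no single cost undercuts. *)
Lemma scale_base_level i : scale (base_level i) <= single_cost i * 2.
Proof.
have [_ h] := base_levelP i; case E : (base_level i) h => [|k] h.
  have [v vn ->] := single_cost_attained i; rewrite /scale expr0 mulr1.
  by have := min_cost_le vn; have := delta_ge0 v (loc i); have := f_gt0 v; rewrite /d; lra.
rewrite scaleS ler_pM2r//; apply: ltW; rewrite ltNge; apply/negP => /h.
by rewrite ltnn.
Qed.

Lemma reduced_cost_ge0 B v : 0 <= reduced_cost B v.
Proof. by rewrite /reduced_cost; case: ifP => // _; exact: ltW. Qed.

Lemma reduced_cost_le B v : reduced_cost B v <= f v.
Proof. by rewrite /reduced_cost; case: ifP => // _; exact: ltW. Qed.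

Lemma le_reduced_cost B v : 0 <= B -> f v <= reduced_cost B v + B / n%:R.
Proof.
move=> B0; have n0 : 0 < n%:R :> R by rewrite ltr0n.
rewrite /reduced_cost; case: ifP => [h|_]; last by rewrite lerDl divr_ge0// ltW.
by rewrite add0r ler_pdivlMr// mulrC.
Qed.

Lemma pending_sorted x : sorted ltn (pending x).
Proof. by apply: sorted_filter; [exact: ltn_trans|exact: iota_ltn_sorted]. Qed.

Lemma eligible_sorted x q : sorted ltn (eligible x q).
Proof. by apply: sorted_filter; [exact: ltn_trans|exact: iota_ltn_sorted]. Qed.

Lemma mem_pending x i : (i \in pending x) = (i < m)%N && ~~ x.1 i.
Proof. by rewrite mem_filter mem_iota andbC. Qed.

Lemma mem_eligible x q i :
  (i \in eligible x q) = [&& (i < m)%N, ~~ x.1 i, rel i <= dl q & (x.2 i <= x.2 q)%N].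
Proof. by rewrite mem_filter mem_iota andbC. Qed.

Lemma trigger_eligible x q : argmin dl (pending x) = q.+1 -> q \in eligible x q.
Proof.
move=> /(argmin_mem (pending_sorted x)); rewrite mem_pending mem_eligible => /andP[qm ->].
by rewrite qm rel_le_dl /=.
Qed.

Lemma trigger_first x q : argmin dl (pending x) = q.+1 ->
  argmin dl (eligible x q) = q.+1.
Proof.
move=> E; apply: argmin_unique; first exact: eligible_sorted.
  exact: trigger_eligible.
move=> y; rewrite mem_eligible => /and4P[ym ys _ _].
case: (argminP dl (pending_sorted x)) E => // b _ h [<-].
by apply: h; rewrite mem_pending ym.
Qed.

Section Service.
Variables (x : progress) (q : nat).
Hypothesis trig : argmin dl (pending x) = q.+1.
Hypothesis base_le : forall i, (base_level i <= x.2 i)%N.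

Let B := scale (x.2 q).
Let E := eligible x q.
Let c := reduced_cost B.

(** Invariant of the picking loop. The third clause says that the trigger is picked first; its
    membership is needed for [q] to be a legitimate starting value in the radii. The factor 4 allows
    for the overshoot of the last pick. *)
Let picked (todo : seq nat) :=
  [/\ sorted ltn todo, {subset todo <= E}, todo = E \/ q \in select E todo,
      forall i j, i \in select E todo -> j \in todo -> dl i <= dl j
    & dual_value n c d q (select E todo) <= B *+ 4].

Let single_le i : i \in E -> single_cost i <= B.
Proof.
rewrite mem_eligible => /and4P[_ _ _ iq]; have [h _] := base_levelP i.
by apply: le_trans h (ler_scale _); apply: leq_trans (base_le i) iq.
Qed.

Let select_refl : select E E = [::].
Proof.
rewrite /select (eq_in_filter (a2 := pred0)) ?filter_pred0// => i iE /=.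
by rewrite iE.
Qed.

Let select_step todo b : b \in todo -> {subset todo <= E} ->
  perm_eq (select E [seq i <- todo | i != b]) (b :: select E todo).
Proof.
move=> bt sub; apply: uniq_perm.
- by rewrite filter_uniq// (sorted_uniq ltn_trans ltnn (eligible_sorted _ _)).
- by rewrite /= mem_filter bt /= filter_uniq// (sorted_uniq ltn_trans ltnn (eligible_sorted _ _)).
- move=> i; rewrite inE ![i \in select _ _]mem_filter mem_filter negb_and negbK.
  by case: eqVneq => [->|_] //=; rewrite sub.
Qed.

Let pick_stepP todo : picked todo -> picked (pick_step B q E todo).
Proof.
move=> [st sub qs ord dv]; rewrite /pick_step -/c.
case: ifP => [small|_] //; case Eb : (argmin dl todo) => [|b] //.
have bt : b \in todo := argmin_mem st Eb.
have bE := sub _ bt.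
have /perm_mem mem_sel := select_step bt sub.
have c0 w : 0 <= c w by exact: reduced_cost_ge0.
split.
- by apply: sorted_filter => //; exact: ltn_trans.
- by move=> i; rewrite mem_filter => /andP[_ /sub].
- right; rewrite mem_sel inE; case: qs Eb => [->|->]; last by rewrite orbT.
  by rewrite trigger_first// => -[->]; rewrite eqxx.
- move=> i j; rewrite mem_sel inE mem_filter => /predU1P[->|iS] /andP[_ jt].
    exact: argmin_le Eb jt.
  exact: ord.
have [v vn gb] := single_cost_attained b.
have cb : c v + d v b <= B.
  by apply: le_trans (single_le bE); rewrite gb lerD2r reduced_cost_le.
(* Before the first pick, [opened_cost] does not apply, and [v] alone serves [b] at cost at most
   [B]. Afterwards [v] is added to the rounding of the previous dual, which was below [B]: the cost
   is at most [3 * B + B], and weak duality transfers this to the new dual. *)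
case: qs => [tE|qS].
  pose A := [:: v]; apply: le_trans (_ : \sum_(a <- A) c a +
      \sum_(i <- select E [seq i <- todo | i != b]) d v i <= _).
    apply: (@dual_value_le _ n c d q _ c0 _ A id (fun=> v)) => //.
    + by move=> i _; rewrite inE.
    + by move=> a; rewrite inE => /eqP ->.
  rewrite (perm_big _ (select_step bt sub)) tE select_refl !big_cons !big_nil.
  by have := scale_gt0 (x.2 q); rewrite -/B /=; lra.
pose s i := if i == b then v else closest n delta loc c q (select E todo) i.
pose A := v :: opened n delta loc c q (select E todo).
apply: le_trans (_ : \sum_(a <- A) c a +
      \sum_(i <- select E [seq i <- todo | i != b]) d (s i) i <= _).
  apply: (@dual_value_le _ n c d q _ c0 _ A id s) => //.
  + move=> i _; rewrite /s inE; case: (i == b); first by rewrite eqxx.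
    by have [-> _] := closestP loc q (select E todo) c0 delta_ge0 delta_refl deltaC i n_gt0; rewrite orbT.
  + move=> a; rewrite inE => /predU1P[->//|].
    exact: (opened_lt c0 delta_ge0 delta_refl deltaC).
rewrite (perm_big _ (select_step bt sub)) !big_cons {1}/s eqxx /=.
have -> : \sum_(j <- select E todo) d (s j) j =
   \sum_(j <- select E todo) d (closest n delta loc c q (select E todo) j) j.
  rewrite big_seq [RHS]big_seq; apply: eq_bigr => i; rewrite /s mem_filter => /andP[it _].
  by case: eqP => // ib; rewrite ib bt in it.
have := opened_cost loc qS c0 delta_ge0 delta_refl deltaC delta_triangle n_gt0.
rewrite -/d; lra.
Qed.

Let picked_iter k : picked (iter k (pick_step B q E) E).
Proof.
elim: k => [|k IH] /=; last exact: pick_stepP.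
split; rewrite ?select_refl//; [exact: eligible_sorted|by left|].
by rewrite /dual_value big_nil mulrn_wge0// ltW// scale_gt0.
Qed.

Let picked_end k todo : {subset todo <= E} -> sorted ltn todo -> (size todo <= k)%N ->
  let todo' := iter k (pick_step B q E) todo in
  todo' != [::] -> B <= dual_value n c d q (select E todo').
Proof.
elim: k todo => [|k IH] todo sub st.
  by rewrite leqn0 size_eq0 => /eqP ->.
move=> sz /=; have [h _|h] := leP B (dual_value n c d q (select E todo)).
  have fix_step : pick_step B q E todo = todo by rewrite /pick_step -/c ltNge h.
  suff -> : pick_step B q E (iter k (pick_step B q E) todo) = todo by [].
  by rewrite -iterS; elim: k.+1 {IH sz} => //= k' ->.
rewrite -iterS iterSr; have [todo0|todo0] := eqVneq todo [::].
  have -> : pick_step B q E todo = todo by rewrite todo0 /pick_step; case: ifP.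
  by move: (IH todo sub st); rewrite todo0; apply.
have [b Eb] := argmin_some dl st todo0.
have bt := argmin_mem st Eb.
have -> : pick_step B q E todo = [seq i <- todo | i != b] by rewrite /pick_step -/c h Eb.
apply: IH.
- by move=> i; rewrite mem_filter => /andP[_ /sub].
- by apply: sorted_filter => //; exact: ltn_trans.
- by rewrite -ltnS; apply: leq_trans sz; apply: (size_filter_lt bt); rewrite eqxx.
Qed.

Lemma deferred_sub : {subset deferred x q <= eligible x q}.
Proof. by have [] := picked_iter m. Qed.

Lemma mem_taken i : (i \in taken x q) = (i \notin deferred x q) && (i \in eligible x q).
Proof. exact: mem_filter. Qed.

Lemma taken_before i j : i \in taken x q -> j \in deferred x q -> dl i <= dl j.
Proof. by have [_ _ _ + _] := picked_iter m; apply. Qed.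

Lemma dual_value_taken : deferred x q != [::] ->
  B <= dual_value n c d q (taken x q).
Proof.
apply: picked_end => //; first exact: eligible_sorted.
by rewrite size_filter (leq_trans (count_size _ _))// size_iota.
Qed.

(** If nothing were picked, the dual value would be 0 while the nonempty list of eligible requests
    is deferred, contradicting [dual_value_taken]. *)
Lemma trigger_taken : q \in taken x q.
Proof.
have [_ _ [h|//] _ _] := picked_iter m; have qE := trigger_eligible trig.
have m0 : (0 < m)%N by move: qE; rewrite mem_eligible => /andP[/(leq_ltn_trans _) -> ].
have := dual_value_taken; rewrite /taken /deferred h select_refl.
rewrite /dual_value big_nil leNgt scale_gt0; case: eqVneq => [E0|_ /(_ isT)//].
by rewrite -/E E0 in qE.
Qed.

(** The constant is [3 * 4 + 1]: the dual value is at most [4 * B], rounding triples it, and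
    restoring the true costs adds at most [B / n] for each of at most [n] facilities. *)
Lemma service_cost : \sum_(v <- facilities x q) f v +
  \sum_(i <- taken x q) d (assigned x q i) i <= B *+ 13.
Proof.
have c0 w : 0 <= c w by exact: reduced_cost_ge0.
have [_ _ _ _ dv] := picked_iter m.
have n0 : 0 < n%:R :> R by rewrite ltr0n.
have B0 := scale_gt0 (x.2 q).
have oc := opened_cost loc trigger_taken c0 delta_ge0 delta_refl deltaC delta_triangle n_gt0.
have : \sum_(v <- facilities x q) f v <= \sum_(v <- facilities x q) (c v + B / n%:R).
  by apply: ler_sum => v _; apply: le_reduced_cost; exact: ltW.
rewrite big_split /= big_const_seq iter_addr addr0 count_predT.
have : (B / n%:R) *+ size (facilities x q) <= B.
  rewrite -mulr_natr mulrAC ler_pdivrMr// ler_pM2l// ler_nat.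
  rewrite -[X in (_ <= X)%N](size_iota 0); apply: uniq_leq_size.
    by rewrite /facilities; apply: opened_uniq c0 delta_ge0 delta_refl deltaC.
  move=> v /(opened_lt c0 delta_ge0 delta_refl deltaC).
  by rewrite mem_iota.
move: oc dv; rewrite -/(taken x q) -/(facilities x q) -/(assigned x q) -/c -/d; lra.
Qed.

End Service.

End Algorithm.

(** * Competitive analysis *)

Section Sums.
Variable R : realType.

Lemma sum_at_most_one (I : finType) (P : pred I) (y : R) : 0 <= y ->
  (forall i j, P i -> P j -> i = j) -> \sum_(i | P i) y <= y.
Proof.
move=> y0 P1; case: (pickP P) => [i0 Pi0|P0]; last by rewrite big_pred0.
by rewrite (bigD1 i0)//= big1 ?addr0// => i /andP[Pi]; rewrite (P1 _ _ Pi Pi0) eqxx.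
Qed.

Lemma sum_injective_le (I : finType) (P : pred I) (k : I -> nat) (phi : nat -> R) K :
  (forall l, 0 <= phi l) -> (forall i, P i -> (k i < K)%N) ->
  (forall i j, P i -> P j -> k i = k j -> i = j) ->
  \sum_(i | P i) phi (k i) <= \sum_(l < K) phi l.
Proof.
move=> phi0 kK kinj.
have -> : \sum_(i | P i) phi (k i) = \sum_(i | P i) \sum_(l < K | val l == k i) phi l.
  apply: eq_bigr => i Pi; rewrite (big_pred1 (Ordinal (kK i Pi)))//.
rewrite (exchange_big_dep xpredT)//=; apply: ler_sum => l _.
apply: sum_at_most_one => // i j /andP[Pi /eqP li] /andP[Pj /eqP lj].
by apply: kinj => //; rewrite -li -lj.
Qed.

(** Truncation loses nothing: a term that exceeds [B] still pays all of [B] after being cut. *)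
Lemma le_sum_min (I : eqType) (A : seq I) (g : I -> R) (B y : R) :
  (forall a, 0 <= g a) -> 0 <= B -> 0 <= y -> B <= \sum_(a <- A) g a + y ->
  B <= \sum_(a <- A) Num.min (g a) B + y.
Proof.
move=> g0 B0 y0 h.
have m0 a : 0 <= Num.min (g a) B by rewrite le_min g0.
have [/hasP[a aA ga]|/hasPn nh] := boolP (has (fun a => B < g a) A).
  rewrite (big_rem a) //= (min_idPr _); last exact: ltW.
  by rewrite -addrA lerDl addr_ge0// sumr_ge0.
rewrite big_seq (eq_bigr g) -?big_seq// => a aA.
by apply/min_idPl; rewrite leNgt nh.
Qed.

End Sums.

Section Analysis.
Variables (R : realType) (n m : nat) (f : nat -> R) (delta : nat -> nat -> R).
Variables (loc : nat -> nat) (rel dl : nat -> R).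
Let d v i := delta v (loc i).

Hypothesis n_gt0 : (0 < n)%N.
Hypothesis f_gt0 : forall v, 0 < f v.
Hypothesis delta_ge0 : forall u v, 0 <= delta u v.
Hypothesis delta_refl : forall v, delta v v = 0.
Hypothesis deltaC : forall u v, delta u v = delta v u.
Hypothesis delta_triangle : forall u v w, delta u w <= delta u v + delta v w.
Hypothesis rel_le_dl : forall i, (i < m)%N -> rel i <= dl i.

Let st := state_at n m f delta loc rel dl.
Let base := base_level n f delta loc.
Let trig j := argmin dl (pending m (st j)).
Let q j := (trig j).-1.
Let busy j := trig j != 0%N.
Let k j := (st j).2 (q j).
Let defer j := deferred n m f delta loc rel dl (st j) (q j).
Let take j := taken n m f delta loc rel dl (st j) (q j).
Let scale := scale n f.

Let trigE j : busy j -> argmin dl (pending m (st j)) = (q j).+1.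
Proof. by rewrite /busy /q /trig; case: argmin. Qed.

Let stepE j : busy j -> st j.+1 =
  (fun i => (st j).1 i || (i \in take j), fun i => if i \in defer j then (k j).+1 else (st j).2 i).
Proof. by move=> /trigE e; rewrite /st /state_at iterS -/(st j) /serve_step e. Qed.

Let stepN j : ~~ busy j -> st j.+1 = st j.
Proof.
by rewrite /busy negbK => /eqP e; rewrite /st /state_at iterS -/(st j) /serve_step -/(trig j) e.
Qed.

Let eligibleP j i : i \in eligible m rel dl (st j) (q j) ->
  [/\ (i < m)%N, ~~ (st j).1 i, rel i <= dl (q j) & ((st j).2 i <= k j)%N].
Proof. by rewrite mem_eligible => /and4P[]. Qed.

Let served_mono1 j i : (st j).1 i -> (st j.+1).1 i.
Proof. by move=> h; case: (boolP (busy j)) => b; [rewrite stepE//= h|rewrite stepN]. Qed.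

Let served_mono j j' i : (j <= j')%N -> (st j).1 i -> (st j').1 i.
Proof.
by move=> /subnK <-; elim: (j' - j)%N => // p IH h; rewrite addSn; apply/served_mono1/IH.
Qed.

Lemma base_level_le j i : (base i <= (st j).2 i)%N.
Proof.
elim: j i => // j IH i; case: (boolP (busy j)) => b; last by rewrite stepN.
rewrite stepE//=; case: ifP => // /deferred_sub.
move=> /(_ n_gt0 f_gt0 delta_ge0 delta_refl deltaC delta_triangle rel_le_dl (trigE b) IH).
by move=> /eligibleP[_ _ _ h]; rewrite (leq_trans (IH i))// leqW.
Qed.

Let defer_sub j i : busy j -> i \in defer j -> i \in eligible m rel dl (st j) (q j).
Proof.
move=> b; apply: deferred_sub => //; first exact: trigE.
exact: base_level_le.
Qed.

Let mem_take j i : (i \in take j) = (i \notin defer j) && (i \in eligible m rel dl (st j) (q j)).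
Proof. exact: mem_taken. Qed.

Let level_mono j j' i : (j <= j')%N -> ((st j).2 i <= (st j').2 i)%N.
Proof.
move=> /subnK <-; elim: (j' - j)%N => // p IH; apply: leq_trans IH _; rewrite addSn.
case: (boolP (busy (p + j))) => b; last by rewrite stepN.
rewrite stepE//=; case: ifP => // /(defer_sub b)/eligibleP[_ _ _ h].
exact: leqW.
Qed.

(* A service defers, hence raises above its own level, every eligible request
   that it does not serve. *)
Let level_after j j' i : (j < j')%N -> busy j -> (i < m)%N -> ~~ (st j').1 i ->
  rel i <= dl (q j) -> (k j < (st j').2 i)%N.
Proof.
move=> jj' b im ns ri; apply: leq_trans (level_mono i jj'); rewrite stepE//=.
have ns1 : ~~ (st j.+1).1 i by apply: contra ns; exact: served_mono.
have ns0 : ~~ (st j).1 i by apply: contra ns1; exact: served_mono1.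
case: ifP => // nd; rewrite ltnNge; apply/negP => h.
by move: ns1; rewrite stepE//= mem_take nd mem_eligible im ns0 ri h /= orbT.
Qed.

(** A raised level records the service that set it, which is where a service triggered by a raised
    request sends its charge. *)
Let levelP j i : (st j).2 i = base i \/
  exists mu, [/\ (mu < j)%N, busy mu, i \in defer mu & (st j).2 i = (k mu).+1].
Proof.
elim: j i => [|j IH] i; first by left.
have old : (st j).2 i = base i \/ (exists mu,
    [/\ (mu < j.+1)%N, busy mu, i \in defer mu & (st j).2 i = (k mu).+1]).
  case: (IH i) => [->|[mu [mj bm im e]]]; first by left.
  by right; exists mu; split => //; exact: ltnW.
case: (boolP (busy j)) => b; last by rewrite stepN.
rewrite stepE//=; case: ifP => // id; by right; exists j.
Qed.

Let trigP j : busy j -> [/\ (q j < m)%N, ~~ (st j).1 (q j) &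
  forall i, (i < m)%N -> ~~ (st j).1 i -> dl (q j) <= dl i].
Proof.
move=> /trigE e; have := argmin_mem (pending_sorted m (st j)) e.
rewrite mem_pending => /andP[? ?]; split => // i im ns.
by apply: argmin_le e _; [exact: pending_sorted|rewrite mem_pending im].
Qed.

Let take_served j i : busy j -> i \in take j -> (st j.+1).1 i.
Proof. by move=> b h; rewrite stepE//= h orbT. Qed.

Let q_take j : busy j -> q j \in take j.
Proof.
move=> b; apply: trigger_taken => //; first exact: trigE.
exact: base_level_le.
Qed.

Lemma busy_mono j j' : (j <= j')%N -> busy j' -> busy j.
Proof.
move=> jj' /trigP[qm ns _]; rewrite /busy.
have [|b] := argmin_some dl (pending_sorted m (st j)); last by rewrite /trig => ->.
apply/eqP => p0; have : q j' \in pending m (st j); last by rewrite p0.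
by rewrite mem_pending qm; apply: contra ns; exact: served_mono.
Qed.

(** Pending sets only shrink, so the earliest pending deadline never decreases. *)
Lemma trigger_mono j j' : (j <= j')%N -> busy j' -> dl (q j) <= dl (q j').
Proof.
move=> jj' b'; have [_ _ h] := trigP (busy_mono jj' b').
have [qm ns _] := trigP b'; apply: h => //.
by apply: contra ns; exact: served_mono.
Qed.

Lemma take_disjoint j j' i : busy j -> busy j' -> i \in take j -> i \in take j' -> j = j'.
Proof.
wlog : j j' / (j < j')%N.
  move=> h b b' ij ij'; case: (ltngtP j j') => // jj'; first exact: h.
  by apply/esym; apply: h.
move=> jj' b b' ij; rewrite mem_take => /andP[_ /eligibleP[_ + _ _]].
by rewrite (served_mono jj' (take_served b ij)).
Qed.

Lemma q_inj j j' : busy j -> busy j' -> q j = q j' -> j = j'.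
Proof.
move=> b b' e; have h := q_take b; have h' := q_take b'.
by apply: (take_disjoint b b' h); rewrite e.
Qed.

(** As long as a request is pending, a step serves its trigger, so the number of pending requests
    drops by at least one. *)
Lemma all_served : pending m (st m) = [::].
Proof.
suff h j : (size (pending m (st j)) <= m - j)%N.
  by apply/eqP; rewrite -size_eq0 -leqn0; have := h m; rewrite subnn.
elim: j => [|j IH].
  by rewrite subn0 size_filter (leq_trans (count_size _ _))// size_iota.
case: (boolP (busy j)) => b; last first.
  move: b; rewrite /busy negbK => /eqP; rewrite /trig.
  case: (argminP dl (pending_sorted m (st j))) => // p0 _.
  rewrite stepN ?p0//; rewrite /busy /trig p0 //.
have [qm ns _] := trigP b.
rewrite subnS -ltnS; apply: leq_trans (_ : size (pending m (st j)) <= _)%N; last first.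
  by apply: leq_trans IH _; exact: leqSpred.
have -> : pending m (st j.+1) = [seq i <- pending m (st j) | ~~ (st j.+1).1 i].
  rewrite /pending -filter_predI; apply: eq_filter => i /=.
  by case h : ((st j.+1).1 i) => //=; apply/esym; apply: contraFN h; exact: served_mono1.
apply: (@size_filter_lt _ _ _ (q j)); first by rewrite mem_pending qm.
by rewrite negbK; apply: take_served b (q_take b).
Qed.

(** * Charging an offline schedule: [sigma i] is the action serving [i], with facility [fac] and
    time [tau] *)

Section Charging.
Variables (N : nat) (sigma fac : nat -> nat) (tau : nat -> R) (L : nat).
Hypothesis sigma_lt : forall i, (i < m)%N -> (sigma i < N)%N.
Hypothesis fac_lt : forall a, (fac a < n)%N.
Hypothesis sigma_time : forall i, (i < m)%N -> rel i <= tau (sigma i) <= dl i.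
Hypothesis n_le : (n <= 2 ^ L)%N.

Let conn i := d (fac (sigma i)) i.
Let B j := scale (k j).
Let K := (\max_(j < m) k j).+1.

Let kK (j : 'I_m) : (k j < K)%N.
Proof. by rewrite ltnS leq_bigmax. Qed.

Let conn_ge0 i : 0 <= conn i. Proof. exact: delta_ge0. Qed.

Let scale_ge0 l : 0 <= scale l.
Proof. by apply/ltW/scale_gt0. Qed.

Let scale2 l l' : (l < l')%N -> scale l * 2 <= scale l'.
Proof. by move=> ll'; rewrite /scale -scaleS; apply: ler_scale. Qed.

Lemma sum_scale_le (y : R) p : 0 <= y -> \sum_(l < p | scale l <= y) scale l <= y * 2.
Proof.
move=> y0; elim: p => [|p IH]; first by rewrite big_ord0 mulr_ge0.
rewrite big_mkcond big_ord_recr /= -big_mkcond /=; case: ifP => h; last by rewrite addr0.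
suff : \sum_(l < p) scale l <= scale p.
  move=> h'; rewrite mulrDr mulr1 lerD//; apply: le_trans (le_trans h' h).
  by rewrite big_mkcond; apply: ler_sum => l _; case: ifP.
elim: p {IH h} => [|p IH]; first by rewrite big_ord0.
by rewrite big_ord_recr /= [leRHS]scaleS mulrDr mulr1 lerD.
Qed.

(** A window of ratio [2 ^ w] contains at most [w] scales, because its last octave contains at most
    one. *)
Lemma sum_window_le (y : R) p w : 0 <= y ->
  \sum_(l < p | (y < scale l) && (scale l < y * 2 ^+ w)) y <= y *+ w.
Proof.
move=> y0; elim: w => [|w IH].
  rewrite big_pred0 // => l; rewrite expr0 mulr1; apply/negP => /andP[h1 h2].
  by have := lt_trans h1 h2; rewrite ltxx.
rewrite [leRHS]mulrSr (bigID (fun l : 'I_p => scale l < y * 2 ^+ w)) /= lerD//.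
  apply: le_trans IH; rewrite big_mkcond [leRHS]big_mkcond; apply: ler_sum => l _.
  by case: (y < _) => //=; case: (scale l < y * 2 ^+ w) => //=; rewrite ?andbF ?andbT//; case: ifP.
apply: sum_at_most_one => // l l'.
rewrite exprSr mulrA -!leNgt => /andP[/andP[_ h1] h2] /andP[/andP[_ h1'] h2'].
apply: val_inj => /=; case: (ltngtP l l') => // /scale2 h; exfalso.
  by have := le_lt_trans h h1'; rewrite ltr_pM2r// ltNge h2.
by have := le_lt_trans h h1; rewrite ltr_pM2r// ltNge h2'.
Qed.

(** The payment of action [a] to a service of level [l]. The cut at the budget makes the low levels
    sum geometrically, instead of paying the full facility cost at each. *)
Let psi a l := Num.min (reduced_cost n f (scale l) (fac a)) (scale l).

Let psi_ge0 a l : 0 <= psi a l.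
Proof. by rewrite /psi le_min scale_ge0 reduced_cost_ge0. Qed.

Let sum_psi a : \sum_(l < K) psi a l <= f (fac a) * (L%:R + 2).
Proof.
set y := f (fac a); have y0 : 0 <= y by apply: ltW; exact: f_gt0.
have := sum_window_le K L y0; have := sum_scale_le K y0.
suff : \sum_(l < K) psi a l <= \sum_(l < K | scale l <= y) scale l +
  \sum_(l < K | (y < scale l) && (scale l < y * 2 ^+ L)) y.
  by rewrite -mulr_natr; lra.
rewrite (bigID (fun l : 'I_K => scale l <= y)) /= lerD//.
  by apply: ler_sum => l _; rewrite ge_min lexx orbT.
rewrite [leRHS]big_mkcond [leLHS]big_mkcond; apply: ler_sum => l _.
rewrite -ltNge; case: ifP => //= yl; rewrite /psi /reduced_cost -/y.
case: ifP => h; first by rewrite (min_idPl _) ?scale_ge0//; case: ifP.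
rewrite ifT ?ge_min ?lexx//; move/negbT: h; rewrite -ltNge => /lt_le_trans; apply.
by rewrite mulrC ler_wpM2l// -natrX ler_nat.
Qed.

Let primary j := busy j && (k j == base (q j)).

(** [B j] is at most twice facility plus connection cost. If it exceeds four times the facility
    cost, the facility accounts for less than half of it, and connection pays the rest. *)
Let primary_le j : primary j ->
  B j <= conn (q j) *+ 4 + (if B j <= f (fac (sigma (q j))) *+ 4 then B j else 0).
Proof.
move=> /andP[b /eqP kb].
have h1 : B j <= single_cost n f delta loc (q j) * 2.
  by rewrite /B kb; exact: scale_base_level.
have h2 : single_cost n f delta loc (q j) <= f (fac (sigma (q j))) + conn (q j).
  exact: single_cost_le.
have h3 := conn_ge0 (q j); case: ifP => [_|/negbT]; first by rewrite lerDr mulrn_wge0.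
by rewrite -ltNge addr0 => h4; lra.
Qed.

(** Triggers are distinct, so each connection is charged once. Primary services charged to one
    action have distinct levels, so their scales, all at most [4 * f], sum to at most [8 * f]. *)
Let sum_primary : \sum_(j < m | primary j) B j <=
  (\sum_(i < m) conn i) *+ 4 + (\sum_(a < N) f (fac a)) *+ 8.
Proof.
apply: le_trans (_ : \sum_(j < m | primary j) (conn (q j) *+ 4 +
  (if B j <= f (fac (sigma (q j))) *+ 4 then B j else 0)) <= _).
  by apply: ler_sum => j; exact: primary_le.
rewrite big_split /= lerD//.
  rewrite sumrMnl lerMn2r/=; apply: (@sum_injective_le R _ (fun j : 'I_m => primary j) (fun j : 'I_m => q j) conn m) => //.
    by move=> j /andP[/trigP[]].
  by move=> i j /andP[bi _] /andP[bj _] /(q_inj bi bj)/val_inj.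
rewrite -big_mkcondr /= -sumrMnl.
have -> : \sum_(j < m | primary j && (B j <= f (fac (sigma (q j))) *+ 4)) B j =
  \sum_(j < m | primary j && (B j <= f (fac (sigma (q j))) *+ 4))
     \sum_(a < N | val a == sigma (q j)) B j.
  apply: eq_bigr => j /andP[/andP[/trigP[qm _ _] _] _].
  by rewrite (big_pred1 (Ordinal (sigma_lt qm))).
rewrite (exchange_big_dep xpredT)//=; apply: ler_sum => a _.
have y0 : 0 <= f (fac a) *+ 4 by rewrite mulrn_wge0// ltW.
have := sum_scale_le K y0; rewrite -mulr_natr -[_ *+ 8]mulr_natr => h.
apply: le_trans (_ : \sum_(l < K) (if scale l <= f (fac a) *+ 4 then scale l else 0) <= _);
  last by rewrite -big_mkcond /= -mulr_natr; lra.
pose P (j : 'I_m) := [&& primary j, B j <= f (fac a) *+ 4 & val a == sigma (q j)].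
rewrite (eq_bigl P); last first.
  by move=> j; rewrite /P; case: (@eqP _ (val a)) => [->|_]; rewrite ?andbT ?andbF.
rewrite (eq_bigr (fun j : 'I_m =>
  if scale (k j) <= f (fac a) *+ 4 then scale (k j) else 0)); last first.
  by move=> j /and3P[_ Bj _]; rewrite -/(B j) Bj.
apply: (@sum_injective_le R _ P (fun j : 'I_m => k j) (fun l => if scale l <= f (fac a) *+ 4 then scale l else 0)).
- by move=> l; case: ifP.
- by move=> j _; exact: kK.
(* Both triggers are served offline by [a], so the later one is released by [tau a], hence by the
   deadline of the earlier one. The earlier service therefore raised it. *)
have lt i j : P i -> P j -> (i < j)%N -> (k i < k j)%N.
  move=> /and3P[/andP[bi _] _ /eqP ai] /and3P[/andP[bj _] _ /eqP aj] ij.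
  have [qi _ _] := trigP bi; have [qj ns _] := trigP bj.
  apply: (level_after ij bi qj ns).
  have /andP[_] := sigma_time qi; have /andP[+ _] := sigma_time qj.
  by rewrite -ai -aj; exact: le_trans.
move=> i j Pi Pj kij; apply: val_inj => /=; case: (ltngtP i j) => //.
  by move=> /(lt _ _ Pi Pj); rewrite kij ltnn.
by move=> /(lt _ _ Pj Pi); rewrite kij ltnn.
Qed.

(* The service [mu] exhausted its budget and thereby deferred the request that
   triggers the service [la]. *)
Let witness mu la :=
  [&& (mu < la)%N, busy mu, busy la, q la \in defer mu & k la == (k mu).+1].

(** Two requests deferred by [mu] wait at the same level; the service triggered by the first raises
    the second beyond it. *)
Let witness_unique mu la la' : witness mu la -> witness mu la' -> la = la'.
Proof.
suff lt l l' : witness mu l -> witness mu l' -> (l < l')%N -> False.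
  by move=> w w'; case: (ltngtP la la') => // h; exfalso; [apply: lt h|apply: lt h].
move=> /and5P[ml bm bl dm /eqP kl] /and5P[ml' _ bl' dm' /eqP kl'] ll'.
have [qm ns _] := trigP bl'.
have /eligibleP[_ _ rq _] := defer_sub bm dm'.
have := level_after ll' bl qm ns (le_trans rq (trigger_mono (ltnW ml) bl)).
by rewrite -/(k l') kl kl' ltnn.
Qed.

Let uses mu a := has (fun i => sigma i == a) (take mu).
(** Only services that receive a charge count here. The existence of a witness, and not merely of a
    deferred request, is what [exhausted_injective] uses. *)
Let exhausted mu := [exists la : 'I_m, witness mu la].

(** Something was deferred, so the dual value of the taken requests reached the budget. By weak
    duality it is at most what the offline schedule pays for those requests at reduced facility
    costs, and the facility terms may be cut at the budget. *)
Let exhausted_le mu : exhausted mu -> B mu <=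
  \sum_(i <- take mu) conn i + \sum_(a < N | uses mu a) psi a (k mu).
Proof.
move=> /existsP[la /and5P[ml bm bl dm _]].
have ne : defer mu != [::] by apply/eqP => e; rewrite e in dm.
have Bd : B mu <= dual_value n (reduced_cost n f (B mu)) d (q mu) (take mu).
  by apply: dual_value_taken => //; exact: trigE.
pose A := [seq a <- iota 0 N | uses mu a].
have c0 v : 0 <= reduced_cost n f (B mu) v by exact: reduced_cost_ge0.
have lt_m i : i \in take mu -> (i < m)%N by rewrite mem_take => /andP[_ /eligibleP[]].
have /(le_trans Bd) : dual_value n (reduced_cost n f (B mu)) d (q mu) (take mu) <=
  \sum_(a <- A) reduced_cost n f (B mu) (fac a) + \sum_(i <- take mu) conn i.
  apply: dual_value_le => //.
  move=> i it; rewrite mem_filter mem_iota /= add0n sigma_lt ?lt_m// andbT.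
  by apply/hasP; exists i.
move=> h; apply: le_trans (le_sum_min _ _ _ h) _ => //; first exact: scale_ge0.
  by rewrite sumr_ge0.
by rewrite addrC lerD2l /A big_filter -[N in iota 0 N]subn0 big_mkord.
Qed.

(** At most one exhausted service of each level uses [a] in each class, where [late] tells whether
    [a] comes after the deadline of the trigger. *)
Let exhausted_injective a (late : bool) (i j : 'I_m) :
  exhausted i && uses i a && ((dl (q i) < tau a) == late) ->
  exhausted j && uses j a && ((dl (q j) < tau a) == late) ->
  k i = k j -> i = j.
Proof.
suff lt (i' j' : 'I_m) :
    exhausted i' && uses i' a && ((dl (q i') < tau a) == late) ->
    exhausted j' && uses j' a && ((dl (q j') < tau a) == late) ->
    k i' = k j' -> (i' < j')%N -> False.
  move=> Pi Pj kij; apply: val_inj => /=.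
  by case: (ltngtP i j) => // h; exfalso; [apply: lt h|apply: lt h].
move=> /andP[/andP[/existsP[la wa] /hasP[p pt /eqP pa]] /eqP late1].
move=> /andP[/andP[/existsP[la' wa'] /hasP[p' pt' /eqP pa']] /eqP late2] kij ij.
have := wa => /and5P[ml bm bl dm /eqP kl].
have := wa' => /and5P[ml' bm' bl' dm' /eqP kl'].
have := pt'; rewrite mem_take => /andP[_ /eligibleP[pm' pns' _ pk']].
have := pt; rewrite mem_take => /andP[_ /eligibleP[pm _ _ _]].
have /andP[rp' tp'] := sigma_time pm'; have /andP[_ tp] := sigma_time pm.
(* In the early class, the request [p'] of the second service is released by [tau a], hence by the
   time of the first service, which raised it above the common level; yet the second service takes
   it at that level. *)
case: late late1 late2 => [late1 late2|/negbT + _]; last first.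
  rewrite -leNgt => early.
  have := level_after ij bm pm' pns'; rewrite pa' in rp'.
  by move=> /(_ (le_trans rp' early)); rewrite kij ltnNge pk'.
(* A deferred request is due no earlier than any taken one, and a taken request served offline by
   [a] is due no earlier than [tau a]. *)
have after (mu la0 : nat) z : witness mu la0 -> z \in take mu -> sigma z = a ->
    (z < m)%N -> tau a <= dl (q la0).
  move=> /and5P[_ bmu _ dmu _] zt za zm; have /andP[_] := sigma_time zm.
  rewrite za => /le_trans; apply; apply: taken_before zt dmu => //.
    exact: trigE.
  exact: base_level_le.
have tl := after _ _ _ wa pt pa pm; have tl' := after _ _ _ wa' pt' pa' pm'.
(* The second trigger is due before [tau a], the witness [la] of the first service not before; so
   both deferred requests wait at the next level once the second service is over. *)
have jla : (j' < la)%N.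
  rewrite ltnNge; apply/negP => /trigger_mono/(_ bm') h.
  by have := lt_le_trans (le_lt_trans h late2) tl; rewrite ltxx.
have [ql ns _] := trigP bl; have [ql' ns' _] := trigP bl'.
have /eligibleP[_ _ rq _] := defer_sub bm dm.
have /eligibleP[_ _ rq' kq'] := defer_sub bm' dm'.
(* If the witnesses differ, the earlier one raises the trigger of the other beyond its level. If
   they coincide, the first service already lifted the common request above the level at which the
   second could defer it. *)
case: (ltngtP la la') => ll.
- have := level_after ll bl ql' ns' (le_trans rq' (trigger_mono (ltnW jla) bl)).
  by rewrite -/(k la') kl kl' kij ltnn.
- have := level_after ll bl' ql ns (le_trans rq (trigger_mono _ bl')).
  by rewrite -/(k la) kl kl' kij ltnn => /(_ (ltnW (ltn_trans ij ml'))).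
- have : ((st j').2 (q la) <= k j')%N by move: kq'; rewrite -(val_inj ll).
  have e : (st i'.+1).2 (q la) = (k i').+1 by rewrite stepE//= dm.
  by have := level_mono (q la) ij; rewrite e -kij => /leq_trans h /h; rewrite ltnn.
Qed.

Let sum_exhausted : \sum_(mu < m | exhausted mu) B mu <=
  \sum_(i < m) conn i + (\sum_(a < N) f (fac a)) * (L%:R + 2) * 2.
Proof.
apply: le_trans (_ : \sum_(mu < m | exhausted mu) (\sum_(i <- take mu) conn i +
  \sum_(a < N | uses mu a) psi a (k mu)) <= _).
  by apply: ler_sum => mu; exact: exhausted_le.
rewrite big_split /= lerD//.
  have lt_m mu i : i \in take mu -> (i < m)%N by rewrite mem_take => /andP[_ /eligibleP[]].
  rewrite (eq_bigr (fun mu : 'I_m => \sum_(i < m | val i \in take mu) conn i)).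
    rewrite (exchange_big_dep xpredT)//=; apply: ler_sum => i _.
    apply: sum_at_most_one => // mu mu' /andP[/existsP[? /and5P[_ b _ _ _]] h].
    move=> /andP[/existsP[? /and5P[_ b' _ _ _]] h'].
    by apply: val_inj; exact: take_disjoint h h'.
  move=> mu _; rewrite -(big_mkord (fun i => i \in take mu)) -[RHS]big_filter.
  apply: perm_big; apply: uniq_perm.
  - by rewrite filter_uniq// filter_uniq// iota_uniq.
  - by rewrite filter_uniq// iota_uniq.
  - move=> i; rewrite [RHS]mem_filter mem_index_iota.
    by case h : (i \in take mu) => //=; rewrite (lt_m _ _ h).
rewrite (exchange_big_dep xpredT)//= !mulr_suml; apply: ler_sum => a _.
(* The early and the late services each use every level at most once, whence the factor 2. *)
rewrite (bigID (fun mu : 'I_m => (dl (q mu) < tau a) == true)) /= mulr2n mulrDr mulr1 lerD//.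
  apply: le_trans (sum_psi a).
  apply: (@sum_injective_le R _ (fun mu : 'I_m => exhausted mu && uses mu a &&
    ((dl (q mu) < tau a) == true)) (fun mu : 'I_m => k mu) (psi a) K) => // mu mu'.
  exact: exhausted_injective.
apply: le_trans (sum_psi a).
rewrite (eq_bigl (fun mu : 'I_m => exhausted mu && uses mu a &&
    ((dl (q mu) < tau a) == false))); last by move=> mu; case: (_ < _).
apply: (@sum_injective_le R _ (fun mu : 'I_m => exhausted mu && uses mu a &&
    ((dl (q mu) < tau a) == false)) (fun mu : 'I_m => k mu) (psi a) K) => // mu mu'.
exact: exhausted_injective.
Qed.

(** A service that is not primary has exactly twice the budget of the service that deferred its
    trigger, and by [witness_unique] each service is charged at most once in this way. *)
Let sum_charged : \sum_(la < m | busy la && ~~ primary la) B la <=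
  (\sum_(mu < m | exhausted mu) B mu) * 2.
Proof.
apply: le_trans (_ : \sum_(la < m | busy la && ~~ primary la)
  \sum_(mu < m | witness mu la) B mu * 2 <= _).
  apply: ler_sum => la /andP[b]; rewrite /primary b /= => np.
  case: (levelP la (q la)) => [e|[mu [ml bm dm e]]]; first by rewrite /k e eqxx in np.
  pose mu' := Ordinal (ltn_trans ml (ltn_ord la)).
  have w : witness mu' la by rewrite /witness ml bm b dm /k e eqxx.
  rewrite (bigD1 mu')//= -[leLHS]addr0 lerD ?sumr_ge0//.
    by rewrite /B {1}/k e; rewrite /scale scaleS.
  by move=> mu2 _; apply: mulr_ge0 => //; exact: scale_ge0.
rewrite (exchange_big_dep (fun mu : 'I_m => exhausted mu))//=; last first.
  by move=> la mu _ w; apply/existsP; exists la.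
rewrite mulr_suml; apply: ler_sum => mu _; apply: sum_at_most_one; first by apply: mulr_ge0 => //; exact: scale_ge0.
by move=> la la' /andP[_ w] /andP[_ w']; apply: val_inj; exact: witness_unique w w'.
Qed.

(** Primary services contribute 8 times the facility costs and 4 times the connections; the others
    twice [2 * (L + 2)] and twice 1. The totals are [16 + 4 * L] and 6. *)
Lemma sum_scale_level_le : \sum_(j < m | busy j) B j <=
  (\sum_(a < N) f (fac a) + \sum_(i < m) conn i) * (16 + L%:R * 4).
Proof.
rewrite (bigID (fun j : 'I_m => primary j)) /=.
have -> : \sum_(j < m | busy j && primary j) B j = \sum_(j < m | primary j) B j.
  by apply: eq_bigl => j; rewrite /primary; case: busy.
have h1 := sum_primary; have h2 := sum_exhausted; have h3 := sum_charged.
have c0 : 0 <= \sum_(i < m) conn i by rewrite sumr_ge0.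
have f0 : 0 <= \sum_(a < N) f (fac a) by rewrite sumr_ge0// => a _; exact: ltW.
have L0 : 0 <= L%:R :> R by [].
nra.
Qed.

End Charging.

(** * Cost and feasibility of the schedule *)

Let serv j := services n m f delta loc rel dl (st j).

Let servicesE j : serv j = if busy j then
  [seq (dl (q j), v, [seq i <- take j | assigned n m f delta loc rel dl (st j) (q j) i == v])
     | v <- facilities n m f delta loc rel dl (st j) (q j)] else [::].
Proof.
rewrite /serv /services; case: (boolP (busy j)) => [/trigE -> //|].
by rewrite /busy negbK /trig => /eqP ->.
Qed.

Let assigned_mem j i : assigned n m f delta loc rel dl (st j) (q j) i
  \in facilities n m f delta loc rel dl (st j) (q j).
Proof.
have c0 w : 0 <= reduced_cost n f (scale (k j)) w by exact: reduced_cost_ge0.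
by have [] := closestP loc (q j) (take j) c0 delta_ge0 delta_refl deltaC i n_gt0.
Qed.

Let facilities_uniq j : uniq (facilities n m f delta loc rel dl (st j) (q j)).
Proof.
have c0 w : 0 <= reduced_cost n f (scale (k j)) w by exact: reduced_cost_ge0.
by rewrite /facilities; apply: opened_uniq c0 delta_ge0 delta_refl deltaC.
Qed.

Lemma services_cost_le j : busy j ->
  \sum_(y <- serv j) (f y.1.2 + \sum_(i <- y.2) d y.1.2 i) <= scale (k j) *+ 13.
Proof.
move=> b; have := @service_cost R n m f delta loc rel dl n_gt0 f_gt0 delta_ge0 delta_refl deltaC
  delta_triangle rel_le_dl (st j) (q j) (trigE b) (base_level_le j).
apply: le_trans; rewrite servicesE b big_map big_split /= lerD2l le_eqVlt.
apply/orP; left; apply/eqP; under eq_bigr do rewrite big_filter.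
rewrite (exchange_big_dep xpredT)//=; apply: eq_bigr => i _.
set a := assigned _ _ _ _ _ _ _ _ _ _.
rewrite (eq_bigr (fun=> d a i)) => [|v /eqP <- //].
rewrite big_const_seq (eq_count (a2 := pred1 a)) => [|v /=]; last by rewrite eq_sym.
by rewrite count_uniq_mem ?facilities_uniq// assigned_mem /= addr0.
Qed.

Lemma schedule_cost_le :
  \sum_(y <- schedule n m f delta loc rel dl) (f y.1.2 + \sum_(i <- y.2) d y.1.2 i) <=
  (\sum_(j < m | busy j) scale (k j)) *+ 13.
Proof.
rewrite /schedule big_flatten big_map -[m in iota 0 m]subn0 big_mkord.
rewrite (bigID (fun j : 'I_m => busy j)) /= [X in _ + X]big1 ?addr0 => [|j nb]; last first.
  by rewrite -/(st j) -/(serv j) servicesE (negPf nb) big_nil.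
by rewrite -sumrMnl; apply: ler_sum => j; exact: services_cost_le.
Qed.

Lemma services_time j y : y \in serv j -> busy j /\ y.1.1 = dl (q j).
Proof. by rewrite servicesE; case: ifP => // b /mapP[v _ ->]. Qed.

Lemma schedule_sorted :
  sorted (fun y z : R * nat * seq nat => y.1.1 <= z.1.1) (schedule n m f delta loc rel dl).
Proof.
rewrite sorted_pairwise; last by move=> ? ? ?; exact: le_trans.
suff h M : pairwise (fun y z : R * nat * seq nat => y.1.1 <= z.1.1)
    (flatten [seq serv j | j <- iota 0 M]) by exact: h.
elim: M => // M IH; rewrite -addn1 iotaD map_cat flatten_cat pairwise_cat IH /= cats0.
apply/andP; split.
  apply/allrelP => y z /flattenP[_ /mapP[j + ->] /services_time[bj ->]] /services_time[b ->].
  by rewrite mem_iota /= add0n => /ltnW jM; exact: trigger_mono.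
have : all (fun y : R * nat * seq nat => y.1.1 == dl (q M)) (serv M).
  by apply/allP => y /services_time[_ ->].
elim: (serv M) => //= y l IH2 /andP[/eqP ey al]; rewrite IH2// andbT.
by apply: sub_all al => z /eqP ->; rewrite ey.
Qed.

Lemma schedule_window y i : y \in schedule n m f delta loc rel dl -> i \in y.2 ->
  (i < m)%N /\ rel i <= y.1.1 <= dl i.
Proof.
move=> /flattenP[_ /mapP[j _ ->]]; rewrite -/(st j) -/(serv j) servicesE.
case: ifP => // b /mapP[v _ ->] /=; rewrite mem_filter mem_take => /andP[_ /andP[_]].
move=> /eligibleP[im ns ri _]; split => //; rewrite ri /=.
by have [_ _] := trigP b; apply.
Qed.

Lemma schedule_uniq y : y \in schedule n m f delta loc rel dl -> uniq y.2.
Proof.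
move=> /flattenP[_ /mapP[j _ ->]]; rewrite -/(st j) -/(serv j) servicesE.
case: ifP => // b /mapP[v _ ->] /=; rewrite filter_uniq// filter_uniq//.
exact: (sorted_uniq ltn_trans ltnn (eligible_sorted _ _ _ _ _)).
Qed.

Lemma schedule_count i : (i < m)%N ->
  count (fun y => i \in y.2) (schedule n m f delta loc rel dl) = 1%N.
Proof.
move=> im; have [j [jm b ij]] : exists j, [/\ (j < m)%N, busy j & i \in take j].
  have : (st m).1 i.
    have : i \notin pending m (st m) by rewrite all_served.
    by rewrite mem_pending im /= negbK.
  suff gen M : (M <= m)%N -> (st M).1 i -> exists j, [/\ (j < m)%N, busy j & i \in take j].
    exact: gen.
  elim: M => // j IH jm.
  case: (boolP (busy j)) => b; last by rewrite stepN// => /(IH (ltnW jm)).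
  by rewrite stepE//= => /orP[/(IH (ltnW jm))//|it]; exists j.
have one j' : count (fun y : R * nat * seq nat => i \in y.2) (serv j') = (j' == j).
  rewrite servicesE; case: ifP => b'; last by case: eqP b' b => // -> ->.
  rewrite count_map /=; case: (boolP (i \in take j')) => ij'.
    rewrite (take_disjoint b' b ij' ij) eqxx.
    rewrite (eq_count (a2 := pred1 (assigned n m f delta loc rel dl (st j) (q j) i))).
      by rewrite count_uniq_mem ?facilities_uniq// assigned_mem.
    by move=> v /=; rewrite mem_filter ij andbT eq_sym.
  rewrite (eq_count (a2 := pred0)) ?count_pred0; last first.
    by move=> v /=; rewrite mem_filter (negPf ij') andbF.
  by case: eqP ij' => // ->; rewrite ij.
rewrite /schedule count_flatten -map_comp.
rewrite (eq_map (g := fun j' => (j' == j : nat))) => [|j' /=]; last exact: one.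
by rewrite sumn_count count_uniq_mem ?iota_uniq// mem_iota /= add0n jm.
Qed.

(** Lets two runs with different numbers of requests be compared over the same number of steps. *)
Lemma schedule_extend K : (m <= K)%N ->
  schedule n m f delta loc rel dl = flatten [seq serv j | j <- iota 0 K].
Proof.
move=> /subnKC <-; rewrite iotaD map_cat flatten_cat add0n.
suff gen p j : (m <= j)%N -> flatten [seq serv i | i <- iota j p] = [::].
  by rewrite (gen (K - m)%N m (leqnn m)) cats0.
elim: p j => // p IH j mj /=; rewrite IH ?leqW// cats0 servicesE.
by case: ifP => // /(busy_mono mj); rewrite /busy /trig all_served.
Qed.

End Analysis.

(** * Nonanticipation *)

(** The picking loop runs as many times as there are requests, a number that depends on the future.
    Past the fixed point the count does not matter. *)
Lemma iter_shrink (T : Type) (g : seq T -> seq T) (l : seq T) k k' :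
  (forall l, g l = l \/ (size (g l) < size l)%N) -> (size l <= k)%N -> (size l <= k')%N ->
  iter k g l = iter k' g l.
Proof.
move=> gs.
have fixg p l0 : g l0 = l0 -> iter p g l0 = l0 by move=> e; elim: p => //= p ->.
have nilg : g [::] = [::] by case: (gs [::]) => //=; rewrite ltn0.
elim: k k' l => [|k IH] k' l; first by rewrite leqn0 => /eqP/size0nil ->; rewrite !fixg.
case: k' => [|k']; first by rewrite leqn0 => _ /eqP/size0nil ->; rewrite !fixg.
move=> lk lk'; have [e|lt] := gs l; first by rewrite !fixg.
by rewrite !iterSr; apply: IH; rewrite -ltnS (leq_trans lt).
Qed.

Section Congruence.
Variables (R : realType) (n : nat) (f : nat -> R) (delta : nat -> nat -> R).
Variables (loc loc' : nat -> nat).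
Let d v i := delta v (loc i).
Let d' v i := delta v (loc' i).

Lemma eq_dual_radius (c : nat -> R) q0 (Q : seq nat) : loc q0 = loc' q0 -> {in Q, loc =1 loc'} ->
  dual_radius c d q0 Q = dual_radius c d' q0 Q.
Proof.
move=> e0 e; apply: boolp.funext => v; rewrite /dual_radius /d /d' e0; congr foldl.
apply/eq_in_map => i iQ; rewrite /star /ball_sum /ball_size e//; congr (_ / _).
  congr (_ + _); rewrite big_seq_cond [RHS]big_seq_cond.
  rewrite (eq_bigl (fun j => (j \in Q) && (delta v (loc' j) <= delta v (loc' i)))).
    by apply: eq_bigr => j /andP[jQ _]; rewrite e.
  by move=> j; case jQ : (j \in Q) => //=; rewrite e.
by congr _%:R; apply: eq_in_count => j jQ; rewrite e.
Qed.

Lemma eq_dual_value (c : nat -> R) q0 (Q : seq nat) : loc q0 = loc' q0 -> {in Q, loc =1 loc'} ->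
  dual_value n c d q0 Q = dual_value n c d' q0 Q.
Proof.
move=> e0 e; rewrite /dual_value big_seq [RHS]big_seq; apply: eq_bigr => i iQ.
rewrite /price (eq_dual_radius c e0 e) /d /d' e//.
Qed.

Lemma eq_opened (c : nat -> R) q0 (Q : seq nat) : loc q0 = loc' q0 -> {in Q, loc =1 loc'} ->
  opened n delta loc c q0 Q = opened n delta loc' c q0 Q.
Proof. by move=> e0 e; rewrite /opened /open_step (eq_dual_radius c e0 e). Qed.

Lemma eq_closest (c : nat -> R) q0 (Q : seq nat) i : loc q0 = loc' q0 -> {in Q, loc =1 loc'} ->
  i \in Q -> closest n delta loc c q0 Q i = closest n delta loc' c q0 Q i.
Proof. by move=> e0 e iQ; rewrite /closest (eq_opened c e0 e) e. Qed.

Lemma eq_base_level i : loc i = loc' i ->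
  base_level n f delta loc i = base_level n f delta loc' i.
Proof.
move=> e; have h : single_cost n f delta loc i = single_cost n f delta loc' i.
  by rewrite /single_cost e.
by rewrite /base_level h.
Qed.

End Congruence.

Section Online.
Variables (R : realType) (n : nat) (f : nat -> R) (delta : nat -> nat -> R) (T : R) (M : nat).
Hypothesis n_gt0 : (0 < n)%N.
Hypothesis f_gt0 : forall v, 0 < f v.
Hypothesis delta_ge0 : forall u v, 0 <= delta u v.
Hypothesis delta_refl : forall v, delta v v = 0.
Hypothesis deltaC : forall u v, delta u v = delta v u.
Hypothesis delta_triangle : forall u v w, delta u w <= delta u v + delta v w.

Definition agree (x x' : progress) := forall i, (i < M)%N -> x.1 i = x'.1 i /\ x.2 i = x'.2 i.

(** Once the next trigger is due after [T], no action by time [T] can follow, and the states of the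
    two runs may diverge freely. *)
Definition late m (dl : nat -> R) (x : progress) :=
  forall q, argmin dl (pending m x) = q.+1 -> T < dl q.

Lemma late_step m loc rel dl j : (forall i, (i < m)%N -> rel i <= dl i) ->
  late m dl (state_at n m f delta loc rel dl j) ->
  late m dl (state_at n m f delta loc rel dl j.+1).
Proof.
move=> rel_le_dl; set st := state_at _ _ _ _ _ _ _ => lj q Eq.
have b : argmin dl (pending m (st j.+1)) != 0%N by rewrite Eq.
have bj : argmin dl (pending m (st j)) != 0%N := busy_mono (leqnSn j) b.
have := trigger_mono (leqnSn j) b; rewrite -/st Eq /=; apply: lt_le_trans; apply: lj.
by move: bj; case: argmin.
Qed.

Section Step.
Variables (m m' : nat) (loc loc' : nat -> nat) (rel rel' dl dl' : nat -> R).
Hypothesis rel_le_dl : forall i, (i < m)%N -> rel i <= dl i.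
Hypothesis rel_le_dl' : forall i, (i < m')%N -> rel' i <= dl' i.
Hypothesis Mm : forall i, (i < m)%N -> (rel i <= T) = (i < M)%N.
Hypothesis Mm' : forall i, (i < m')%N -> (rel' i <= T) = (i < M)%N.
Hypothesis le_M : (M <= m)%N /\ (M <= m')%N.
Hypothesis same : forall i, (i < M)%N -> [/\ loc i = loc' i, rel i = rel' i & dl i = dl' i].

(** Requests beyond the first [M] are released, hence due, after [T], and cannot compete with a
    trigger due by [T]. *)
Lemma eq_argmin_pending x x' q : agree x x' ->
  argmin dl (pending m x) = q.+1 -> dl q <= T ->
  (q < M)%N /\ argmin dl' (pending m' x') = q.+1.
Proof.
move=> ag; case: (argminP dl (pending_sorted m x)) => // b.
rewrite mem_pending => /andP[bm nb] bmin [<-{q}] bT; have [_ Mm2] := le_M.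
have bM : (b < M)%N by rewrite -Mm// (le_trans (rel_le_dl bm)).
split=> //; have [eloc erel edl] := same bM; have [e1 e2] := ag _ bM.
apply: argmin_unique; first exact: pending_sorted.
  by rewrite mem_pending -e1 nb (leq_trans bM).
move=> y; rewrite mem_pending => /andP[ym ny]; case: (ltnP y M) => yM.
  have [_ _ edly] := same yM; rewrite -edl -edly; apply: bmin.
  by have [e3 _] := ag _ yM; rewrite mem_pending e3 ny (leq_trans yM)//; case: le_M.
left; rewrite -edl; apply: le_lt_trans bT _; apply: lt_le_trans (rel_le_dl' ym).
by rewrite ltNge Mm'// -leqNgt.
Qed.

(** Eligible requests are released by the deadline of the trigger, hence by [T], so they lie in the
    common prefix. *)
Lemma eq_eligible x x' q : agree x x' -> (q < M)%N -> dl q <= T ->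
  eligible m rel dl x q = eligible m' rel' dl' x' q.
Proof.
move=> ag qM qT; have [_ e2] := ag _ qM; have [_ _ edl] := same qM; have [M1 M2] := le_M.
apply: (irr_sorted_eq ltn_trans ltnn); [exact: eligible_sorted..|].
move=> i; rewrite !mem_eligible; case: (ltnP i M) => iM.
  have [-> ->] := ag _ iM; have [_ -> _] := same iM.
  by rewrite edl e2 (leq_trans iM M1) (leq_trans iM M2).
apply/idP/idP => /and4P[im _ ri _].
  by move: iM; rewrite leqNgt -Mm// (le_trans ri qT).
by move: iM; rewrite leqNgt -Mm'// (le_trans ri) // -edl.
Qed.

Lemma eligible_lt x q i : (q < M)%N -> dl q <= T -> i \in eligible m rel dl x q -> (i < M)%N.
Proof. by move=> qM qT; rewrite mem_eligible => /and4P[im _ ri _]; rewrite -Mm// (le_trans ri). Qed.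

Lemma pick_step_shrink (dl0 : nat -> R) loc0 B q E l :
  pick_step n f delta loc0 dl0 B q E l = l \/
  (size (pick_step n f delta loc0 dl0 B q E l) < size l)%N.
Proof.
rewrite /pick_step; case: ifP => _; last by left.
case Eb : (argmin dl0 l) => [|b]; first by left.
case: (boolP (b \in l)) => bl; last first.
  left; apply/all_filterP/allP => i il; apply/eqP => ib; by rewrite -ib il in bl.
by right; apply: (size_filter_lt bl); rewrite eqxx.
Qed.

Lemma eq_deferred x x' q : agree x x' -> (q < M)%N -> dl q <= T ->
  deferred n m f delta loc rel dl x q = deferred n m' f delta loc' rel' dl' x' q.
Proof.
move=> ag qM qT; have [_ e2] := ag _ qM; have [eloc _ _] := same qM.
have szE mm (rl ddl : nat -> R) xx : (size (eligible mm rl ddl xx q) <= mm)%N.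
  by rewrite size_filter (leq_trans (count_size _ _))// size_iota.
have eE := eq_eligible ag qM qT.
rewrite /deferred -eE -e2; set E := eligible _ _ _ _ _.
rewrite [RHS](@iter_shrink _ _ _ _ m); [|exact: pick_step_shrink|by rewrite /E eE|exact: szE].
have EM i : i \in E -> (i < M)%N by exact: eligible_lt.
suff : forall k l, {subset l <= E} ->
  iter k (pick_step n f delta loc dl (scale n f (x.2 q)) q E) l =
  iter k (pick_step n f delta loc' dl' (scale n f (x.2 q)) q E) l by apply.
elim=> // k IH l lE; rewrite !iterSr.
have -> : pick_step n f delta loc' dl' (scale n f (x.2 q)) q E l =
          pick_step n f delta loc dl (scale n f (x.2 q)) q E l.
  rewrite /pick_step -(@eq_argmin _ dl dl') ?(@eq_dual_value _ _ _ loc loc')//.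
    by move=> i; rewrite mem_filter => /andP[_ /EM/same[]].
  by move=> i /lE/EM/same[].
apply: IH => i; rewrite /pick_step; case: ifP => _; last exact: lE.
by case: argmin => [|b]; [exact: lE|rewrite mem_filter => /andP[_ /lE]].
Qed.

Lemma eq_taken x x' q : agree x x' -> (q < M)%N -> dl q <= T ->
  taken n m f delta loc rel dl x q = taken n m' f delta loc' rel' dl' x' q.
Proof.
by move=> ag qM qT; rewrite /taken (eq_deferred ag qM qT) (eq_eligible ag qM qT).
Qed.

Lemma eq_step x x' q : agree x x' -> argmin dl (pending m x) = q.+1 -> dl q <= T ->
  agree (serve_step n m f delta loc rel dl x) (serve_step n m' f delta loc' rel' dl' x') /\
  services n m f delta loc rel dl x = services n m' f delta loc' rel' dl' x'.
Proof.
move=> ag Eq qT; have [qM Eq'] := eq_argmin_pending ag Eq qT.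
have [eloc erel edl] := same qM; have [_ e2] := ag _ qM.
have et := eq_taken ag qM qT; have ed := eq_deferred ag qM qT.
have tl : {in taken n m' f delta loc' rel' dl' x' q, loc =1 loc'}.
  move=> i; rewrite -et mem_filter => /andP[_ /(eligible_lt qM qT) iM].
  by have [] := same iM.
rewrite /serve_step /services Eq Eq'; split.
  by move=> i iM /=; rewrite et ed e2; have [-> ->] := ag _ iM.
rewrite edl /facilities et e2 (eq_opened n delta _ eloc tl).
apply: eq_map => v; congr (_, _, _); apply: eq_in_filter => i it.
by rewrite /assigned et e2 (eq_closest n delta _ eloc tl it).
Qed.

End Step.

Section Run.
Variables (m m' : nat) (loc loc' : nat -> nat) (rel rel' dl dl' : nat -> R).
Hypothesis rel_le_dl : forall i, (i < m)%N -> rel i <= dl i.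
Hypothesis rel_le_dl' : forall i, (i < m')%N -> rel' i <= dl' i.
Hypothesis Mm : forall i, (i < m)%N -> (rel i <= T) = (i < M)%N.
Hypothesis Mm' : forall i, (i < m')%N -> (rel' i <= T) = (i < M)%N.
Hypothesis le_M : (M <= m)%N /\ (M <= m')%N.
Hypothesis same : forall i, (i < M)%N -> [/\ loc i = loc' i, rel i = rel' i & dl i = dl' i].
Let st := state_at n m f delta loc rel dl.
Let st' := state_at n m' f delta loc' rel' dl'.

(** If either run has a trigger due by [T], the other has the same one, by symmetry; otherwise both
    are late. *)
Let step_or_late j : agree (st j) (st' j) ->
  agree (st j.+1) (st' j.+1) /\
    services n m f delta loc rel dl (st j) = services n m' f delta loc' rel' dl' (st' j) \/
  late m dl (st j) /\ late m' dl' (st' j).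
Proof.
move=> ag; have ag' : agree (st' j) (st j) by move=> i /ag[-> ->].
have le_M' : (M <= m')%N /\ (M <= m)%N by case: le_M.
have same' i : (i < M)%N -> [/\ loc' i = loc i, rel' i = rel i & dl' i = dl i].
  by move=> /same[-> -> ->].
have [[q [E qT]]|no] := pselect (exists q, argmin dl (pending m (st j)) = q.+1 /\ dl q <= T).
  by left; apply: (eq_step _ _ _ _ _ _ ag E qT).
have [[q [E qT]]|no'] := pselect (exists q, argmin dl' (pending m' (st' j)) = q.+1 /\ dl' q <= T).
  left; suff [h1 h2] : agree (st' j.+1) (st j.+1) /\
      services n m' f delta loc' rel' dl' (st' j) = services n m f delta loc rel dl (st j).
    by split=> [i /h1[-> ->]|].
  by apply: (eq_step _ _ _ _ _ _ ag' E qT).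
right; split=> q E; rewrite ltNge; apply/negP => qT; [apply: no|apply: no']; by exists q.
Qed.

Let run_inv j : agree (st j) (st' j) \/ late m dl (st j) /\ late m' dl' (st' j).
Proof.
elim: j => [|j [ag|[l l']]].
- left=> i /same[e _ _] /=; split => //; exact: eq_base_level.
- case: (step_or_late ag) => [[]|[l l']]; first by left.
  by right; split; apply: late_step.
- by right; split; apply: late_step.
Qed.

Lemma services_online j :
  [seq y <- services n m f delta loc rel dl (st j) | y.1.1 <= T] =
  [seq y <- services n m' f delta loc' rel' dl' (st' j) | y.1.1 <= T].
Proof.
have lateE mm lc rl ddl x : late mm ddl x ->
    [seq y <- services n mm f delta lc rl ddl x | y.1.1 <= T] = [::].
  rewrite /services /late; case: argmin => // q /(_ q erefl) qT.
  rewrite (eq_in_filter (a2 := pred0)) ?filter_pred0// => y /mapP[v _ ->] /=.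
  by rewrite leNgt qT.
case: (run_inv j) => [ag|[l l']]; last by rewrite !lateE.
by case: (step_or_late ag) => [[_ ->]|[l l']] //; rewrite !lateE.
Qed.

Lemma schedule_online :
  [seq y <- schedule n m f delta loc rel dl | y.1.1 <= T] =
  [seq y <- schedule n m' f delta loc' rel' dl' | y.1.1 <= T].
Proof.
rewrite (@schedule_extend _ n m _ _ _ _ _ _ _ _ _ _ _ _ (maxn m m'))//; last exact: leq_maxl.
rewrite [in RHS](@schedule_extend _ n m' _ _ _ _ _ _ _ _ _ _ _ _ (maxn m m'))//; last exact: leq_maxr.
rewrite !filter_flatten -!map_comp; congr flatten; apply: eq_map => j /=.
exact: services_online.
Qed.

End Run.

End Online.

(** * Distances and schedules *)

(** Requests are named by position, and sorting by release makes those released by [t] a prefix. So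
    two instances that agree up to [t] give the same names to the same requests. *)
Lemma sorted_prefix (R : realType) (T : Type) (key : T -> R) (t : R) (s : seq T) :
  sorted (fun q q' => key q <= key q') s ->
  [seq q <- s | key q <= t] = take (count (fun q => key q <= t) s) s /\
  forall x0 i, (i < size s)%N -> (key (nth x0 s i) <= t) = (i < count (fun q => (key q <= t)%R) s)%N.
Proof.
elim: s => // q s IH /= qs.
have qall : all (fun x => key q <= key x) s.
  by apply: order_path_min qs => x y z; exact: le_trans.
have [f1 r1] := IH (path_sorted qs).
have [qt|qt] := leP (key q) t; first by split=> [|x0 [|i] //=]; [rewrite /= f1|exact: r1].
have gt : all (fun x => ~~ (key x <= t)) s.
  by apply: sub_all qall => x; rewrite -ltNge; exact: lt_le_trans.
have c0 : count (fun x => key x <= t) s = 0%N.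
  by apply/eqP; move: gt; rewrite all_predC has_count -leqNgt leqn0.
split=> [|x0 i]; first by rewrite f1 c0 take0.
rewrite c0 addn0 ltn0; case: i => [|i] /= ilt; first by rewrite leNgt qt.
by rewrite r1// c0.
Qed.

Section Metric.
Variables (R : realType) (n : nat) (G : network R n).
Hypothesis wfG : wf_network G.

Lemma walk_weight_ge0 u p : path (edge G) u p -> 0 <= walk_weight G u p.
Proof.
have [_ _ wG _] := wfG; elim: p u => //= v p IH u /andP[/wG[w0 _] /IH].
by apply: addr_ge0; exact: ltW.
Qed.

Lemma walk_weight_cat u p p' :
  walk_weight G u (p ++ p') = walk_weight G u p + walk_weight G (last u p) p'.
Proof. by elim: p u => [|v p IH] u /=; rewrite ?add0r// IH addrA. Qed.

Lemma dist_le_walk u p : path (edge G) u p -> dist G u (last u p) <= walk_weight G u p.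
Proof.
move=> up; apply: ge_inf; last by exists p.
by exists 0 => _ [p' [up' _] <-]; exact: walk_weight_ge0.
Qed.

(** Connectedness makes the set of walk weights nonempty, as a bound from below on an infimum
    requires. *)
Lemma le_dist u v (y : R) :
  (forall p, path (edge G) u p -> last u p = v -> y <= walk_weight G u p) -> y <= dist G u v.
Proof.
move=> h; apply: lb_le_inf; last by move=> _ [p [up pv] <-]; exact: h.
have [_ _ _ /(_ u v)/connectP[p up ->]] := wfG.
by exists (walk_weight G u p); exists p.
Qed.

Lemma dist_ge0 u v : 0 <= dist G u v.
Proof. by apply: le_dist => p up _; exact: walk_weight_ge0. Qed.

Lemma dist_refl u : dist G u u = 0.
Proof.
by apply/eqP; rewrite eq_le dist_ge0 andbT; exact: (@dist_le_walk u [::]).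
Qed.

Lemma dist_triangle u v w : dist G u w <= dist G u v + dist G v w.
Proof.
rewrite -lerBlDr; apply: le_dist => p up pv; rewrite lerBlDl -lerBlDr.
apply: le_dist => p' vp' pw; rewrite lerBlDr addrC -{1}pv -walk_weight_cat.
have -> : w = last u (p ++ p') by rewrite last_cat pv.
by apply: dist_le_walk; rewrite cat_path up pv.
Qed.

Lemma dist_sym u v : dist G u v = dist G v u.
Proof.
have [_ [symG _] wG _] := wfG.
have rev_walk x p : path (edge G) x p -> exists p',
    [/\ path (edge G) (last x p) p', last (last x p) p' = x &
        walk_weight G (last x p) p' = walk_weight G x p].
  elim: p x => [|y p IH] x /=; first by exists [::].
  move=> /andP[xy /IH[p' [yp lp wp]]]; exists (rcons p' x).
  rewrite rcons_path last_rcons yp lp symG xy -cats1 walk_weight_cat wp lp /= addr0 addrC.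
  by have [_ ->] := wG _ _ xy.
have le x y : dist G x y <= dist G y x.
  apply: le_dist => p /rev_walk[p' [yp lp <-]] e.
  by have := dist_le_walk yp; rewrite lp e.
by apply/eqP; rewrite eq_le !le.
Qed.

End Metric.

Section Wrap.
Variable R : realType.

Definition to_action n (y : R * nat * seq nat) : action R n.+1 :=
  Action y.1.1 (inord y.1.2) [fset i in y.2]%fset.

Section Data.
Variables (n : nat) (G : network R n.+1) (s : seq (request R n.+1)).

Definition req_nth i : request R n.+1 := nth (Request ord0 0 0) s i.

Definition facility_cost (v : nat) : R := fac_cost G (inord v).
Definition vertex_dist (u v : nat) : R := dist G (inord u) (inord v).
Definition req_loc i : nat := loc (req_nth i).
Definition req_release i : R := release (req_nth i).
Definition req_deadline i : R := deadline (req_nth i).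

Definition fl_schedule : seq (R * nat * seq nat) :=
  schedule n.+1 (size s) facility_cost vertex_dist req_loc req_release req_deadline.

End Data.

(** Without vertices there are no requests. The successor form of the number of vertices gives
    access to [inord], which turns numbers into vertices. *)
Definition fl_algorithm : algorithm R := fun n =>
  match n return network R n -> seq (request R n) -> seq (action R n) with
  | 0 => fun _ _ => [::]
  | n'.+1 => fun G s => map (@to_action n') (fl_schedule G s)
  end.

Section Spec.
Variables (n : nat) (G : network R n.+1).
Hypothesis wfG : wf_network G.

Let f_gt0 v : 0 < facility_cost G v.
Proof. by have [h _ _ _] := wfG; exact: h. Qed.

Let delta_ge0 u v : 0 <= vertex_dist G u v. Proof. exact: dist_ge0. Qed.
Let delta_refl v : vertex_dist G v v = 0. Proof. exact: dist_refl. Qed.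
Let deltaC u v : vertex_dist G u v = vertex_dist G v u. Proof. exact: dist_sym. Qed.
Let delta_triangle u v w : vertex_dist G u w <= vertex_dist G u v + vertex_dist G v w.
Proof. exact: dist_triangle. Qed.

Let rel_le_dl (s : seq (request R n.+1)) : wf_requests s ->
  forall i, (i < size s)%N -> req_release s i <= req_deadline s i.
Proof. by move=> [_ /all_nthP h] i si; exact: h. Qed.

Lemma req_nthE (s : seq (request R n.+1)) (i : 'I_(size s)) : req i = req_nth s i.
Proof. exact: tnth_nth. Qed.

Lemma fl_feasible (s : seq (request R n.+1)) : wf_requests s ->
  feasible s (fl_algorithm G s).
Proof.
move=> wfs; have h := rel_le_dl wfs; split.
- rewrite /= sorted_map; exact: schedule_sorted.
- rewrite all_map; apply/allP => y ys; apply/allP => i; rewrite !inE => iy.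
  by have [] := schedule_window ys iy.
- move=> i; rewrite count_map.
  have := @schedule_count R n.+1 (size s) (facility_cost G) (vertex_dist G) (req_loc s)
    (req_release s) (req_deadline s) isT f_gt0 delta_ge0 delta_refl deltaC delta_triangle h i (ltn_ord i).
  by move=> <-; apply: eq_count => y /=; rewrite !inE.
- move=> i; rewrite all_map; apply/allP => y ys; apply/implyP; rewrite !inE => iy.
  by have [_] := schedule_window ys iy; rewrite req_nthE.
Qed.

Lemma fl_nonanticipating (s s' : seq (request R n.+1)) (t : R) :
  wf_requests s -> wf_requests s' ->
  [seq q <- s | release q <= t] = [seq q <- s' | release q <= t] ->
  [seq a <- fl_algorithm G s | act_time a <= t] =
  [seq a <- fl_algorithm G s' | act_time a <= t].
Proof.
move=> wfs wfs' e; rewrite /= !filter_map; congr map.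
set M := size [seq q <- s | release q <= t].
have eM' : M = size [seq q <- s' | release q <= t] by rewrite /M e.
have eM : M = count (fun q => release q <= t) s by rewrite /M size_filter.
have {}eM' : M = count (fun q => release q <= t) s' by rewrite eM' size_filter.
have [f1 r1] := sorted_prefix t wfs.1; have [f2 r2] := sorted_prefix t wfs'.1.
apply: (@schedule_online R n.+1 (facility_cost G) (vertex_dist G) t M) => //.
- exact: rel_le_dl.
- exact: rel_le_dl.
- by move=> i; rewrite eM; exact: r1.
- by move=> i; rewrite eM'; exact: r2.
- by rewrite {1}eM eM' !count_size.
- move=> i iM; suff h : req_nth s i = req_nth s' i.
    by rewrite /req_loc /req_release /req_deadline h.
  by rewrite /req_nth -(nth_take _ iM) {1}eM -f1 e f2 -eM' nth_take.
Qed.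

Lemma fl_competitive (s : seq (request R n.+1)) L : wf_requests s -> (n.+1 <= 2 ^ L)%N ->
  cost G s (fl_algorithm G s) <= ((16 + L%:R * 4) * 13) * opt G s.
Proof.
move=> wfs nL; set alpha := _ * 13.
have alpha0 : 0 < alpha :> R by rewrite /alpha mulr_gt0// addr_gt0// mulr_ge0.
rewrite mulrC -ler_pdivrMr//; apply: lb_le_inf.
  by exists (cost G s (fl_algorithm G s)), (fl_algorithm G s) => //; exact: fl_feasible.
move=> _ [S [_ S_lt S_one S_time] <-]; rewrite ler_pdivrMr// mulrC.
have h := rel_le_dl wfs.
pose a0 := Action 0 ord0 fset0 : action R n.+1.
(* The optimum is an infimum, so the analysis is applied to each feasible [S]; [sigma i] is the
   position of the action of [S] that serves [i]. *)
pose sigma i := find (fun a => i \in served a) S.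
pose fac a : nat := facility (nth a0 S a).
pose tau a := act_time (nth a0 S a).
have sigma_lt i : (i < size s)%N -> (sigma i < size S)%N.
  by move=> im; rewrite -has_find has_count (S_one (Ordinal im)).
have sigma_in i : (i < size s)%N -> i \in served (nth a0 S (sigma i)).
  by move=> /sigma_lt; rewrite -has_find => /(nth_find a0).
have sigma_time i : (i < size s)%N ->
    req_release s i <= tau (sigma i) <= req_deadline s i.
  move=> im; have /(all_nthP a0)/(_ _ (sigma_lt i im)) := S_time (Ordinal im).
  by rewrite /= sigma_in //= req_nthE.
have fac_lt a : (fac a < n.+1)%N by exact: ltn_ord.
have main := @sum_scale_level_le R n.+1 (size s) (facility_cost G) (vertex_dist G) (req_loc s)
  (req_release s) (req_deadline s) isT f_gt0 delta_ge0 delta_refl deltaC delta_triangle h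
  (size S) sigma fac tau L sigma_lt fac_lt sigma_time nL.
have sched := @schedule_cost_le R n.+1 (size s) (facility_cost G) (vertex_dist G) (req_loc s)
  (req_release s) (req_deadline s) isT f_gt0 delta_ge0 delta_refl deltaC delta_triangle h.
have alg_cost : cost G s (fl_algorithm G s) <= \sum_(y <- fl_schedule G s)
    (facility_cost G y.1.2 + \sum_(i <- y.2) vertex_dist G y.1.2 (req_loc s i)).
  rewrite /cost /= big_map big_seq [leRHS]big_seq; apply: ler_sum => y ys.
  rewrite /action_cost /= lerD2l le_eqVlt; apply/orP; left; apply/eqP.
  rewrite (eq_bigr (fun i : 'I_(size s) => vertex_dist G y.1.2 (req_loc s i))); last first.
    by move=> i _; rewrite /vertex_dist /req_loc req_nthE inord_val.
  rewrite (eq_bigl (fun i : 'I_(size s) => val i \in y.2)); last by move=> i; rewrite !inE.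
  rewrite -(big_mkord (fun i => i \in y.2) (fun i => vertex_dist G y.1.2 (req_loc s i))).
  rewrite -big_filter; apply: perm_big; apply: uniq_perm.
  - by rewrite filter_uniq// iota_uniq.
  - exact: schedule_uniq ys.
  - move=> i; rewrite mem_filter mem_index_iota /=; case iy : (i \in y.2) => //=.
    by have [] := schedule_window ys iy.
have opt_cost : \sum_(a < size S) facility_cost G (fac a) +
    \sum_(i < size s) vertex_dist G (fac (sigma i)) (req_loc s i) <= cost G s S.
  rewrite /cost (big_nth a0) big_mkord big_split /= lerD//.
    by apply: ler_sum => a _; rewrite /facility_cost /fac inord_val.
  rewrite (exchange_big_dep xpredT)//=; apply: ler_sum => i _.
  rewrite (bigD1 (Ordinal (sigma_lt _ (ltn_ord i)))) /=; last by rewrite sigma_in.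
  rewrite /vertex_dist /req_loc /fac !inord_val req_nthE lerDl sumr_ge0// => *.
  exact: dist_ge0.
apply: le_trans alg_cost (le_trans sched _).
move: main sched; rewrite /alpha; set C := \sum_(j < _ | _) _ => main _.
have a0' : 0 <= 16 + L%:R * 4 :> R by rewrite addr_ge0// mulr_ge0.
have := ler_wpM2r a0' opt_cost; nra.
Qed.

End Spec.
End Wrap.

(** * Running programs *)

(** A crude bound, sufficient because the natural numbers stored remain polynomial in the input
    length. *)
Lemma bitlen_le k : (bitlen k <= k.+1)%N.
Proof.
rewrite /bitlen ltnS; case: k => // k; apply: ltnW.
by apply: leq_trans (ltn_expl _ (isT : 1 < 2)%N) (trunc_logP _ _).
Qed.

Section Cost.
Variable N : nat.

Fixpoint nbound (e : nexp) : nat :=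
  match e with
  | NLit k => k
  | NGet _ _ => N
  | NAdd e1 e2 => nbound e1 + nbound e2
  | NSub e1 _ => nbound e1
  | NMul e1 e2 => nbound e1 * nbound e2
  end%N.

Fixpoint ncost_bound (e : nexp) : nat :=
  ((nbound e).+1 +
   match e with
   | NLit _ => 0
   | NGet _ i => ncost_bound i
   | NAdd e1 e2 | NSub e1 e2 | NMul e1 e2 => ncost_bound e1 + ncost_bound e2
   end)%N.

Fixpoint rcost_bound (e : rexp) : nat :=
  match e with
  | RNat i | RGet _ i => (ncost_bound i).+1
  | RAdd e1 e2 | RSub e1 e2 => (rcost_bound e1 + rcost_bound e2).+1
  | RMulN e1 i | RDivN e1 i => (rcost_bound e1 + ncost_bound i).+1
  end%N.

Fixpoint bcost_bound (b : bexp) : nat :=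
  match b with
  | BLeN e1 e2 => (ncost_bound e1 + ncost_bound e2).+1
  | BLeR e1 e2 => (rcost_bound e1 + rcost_bound e2).+1
  | BNot b1 => (bcost_bound b1).+1
  | BAnd b1 b2 => (bcost_bound b1 + bcost_bound b2).+1
  end%N.

(* The cost of a run whose loops are all iterated at most [N] times and in which
   the natural numbers stored never exceed [N]. *)
Fixpoint cost_bound (c : cmd) : nat :=
  match c with
  | CSkip => 1
  | CSetN _ i e => (ncost_bound i + ncost_bound e).+1
  | CSetR _ i e => (ncost_bound i + rcost_bound e).+1
  | CSeq c1 c2 => (cost_bound c1 + cost_bound c2).+1
  | CIf b c1 c2 => (bcost_bound b + (cost_bound c1 + cost_bound c2)).+1
  | CWhile b c1 => N.+1 * (bcost_bound b + cost_bound c1).+1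
  end%N.

End Cost.

(** Tracking whole arrays rather than cells is coarse but computable, so the preservation of the
    other arrays is checked by evaluation. *)
Fixpoint nat_writes (c : cmd) : seq nat :=
  match c with
  | CSetN x _ _ => [:: x]
  | CSeq c1 c2 | CIf _ c1 c2 => nat_writes c1 ++ nat_writes c2
  | CWhile _ c1 => nat_writes c1
  | _ => [::]
  end.

Fixpoint real_writes (c : cmd) : seq nat :=
  match c with
  | CSetR x _ _ => [:: x]
  | CSeq c1 c2 | CIf _ c1 c2 => real_writes c1 ++ real_writes c2
  | CWhile _ c1 => real_writes c1
  | _ => [::]
  end.

Section Logic.
Variables (R : realType) (N : nat).
Implicit Types (st : state R) (Q : state R -> Prop) (c : cmd).

Definition bounded st := forall x i, (nmem st x i <= N)%N.

Lemma neval_bound st e : bounded st -> (neval st e <= nbound N e)%N.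
Proof.
move=> b; elim: e => //= [e1 h1 e2 h2|e1 h1 e2 h2|e1 h1 e2 h2].
- exact: leq_add.
- exact: leq_trans (leq_subr _ _) h1.
- exact: leq_mul.
Qed.

Lemma ncost_le st e : bounded st -> (ncost st e <= ncost_bound N e)%N.
Proof.
move=> b; have hb e0 : (bitlen (neval st e0) <= (nbound N e0).+1)%N.
  by apply: leq_trans (bitlen_le _) _; rewrite ltnS neval_bound.
by elim: e => [k|x i IH|e1 h1 e2 h2|e1 h1 e2 h2|e1 h1 e2 h2]; apply: leq_add => //; exact: leq_add.
Qed.

Lemma rcost_le st e : bounded st -> (rcost st e <= rcost_bound N e)%N.
Proof.
move=> b; elim: e => /= [i|x i|e1 h1 e2 h2|e1 h1 e2 h2|e1 h1 i|e1 h1 i]; rewrite ltnS.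
all: by rewrite ?leq_add// ncost_le.
Qed.

Lemma bcost_le st b : bounded st -> (bcost st b <= bcost_bound N b)%N.
Proof.
move=> bd; elim: b => /= [e1 e2|e1 e2|b1 h1|b1 h1 b2 h2]; rewrite ltnS// leq_add//.
all: by rewrite ?ncost_le ?rcost_le.
Qed.

Definition frame (wn wr : seq nat) st st' :=
  (forall y, y \notin wn -> nmem st' y = nmem st y) /\
  (forall y, y \notin wr -> rmem st' y = rmem st y).

Lemma frame_refl wn wr st : frame wn wr st st.
Proof. by []. Qed.

Lemma frame_trans wn wr st1 st2 st3 :
  frame wn wr st1 st2 -> frame wn wr st2 st3 -> frame wn wr st1 st3.
Proof. by move=> [n1 r1] [n2 r2]; split => y yw; rewrite ?n2 ?r2 ?n1 ?r1. Qed.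

Lemma frame_sub wn wr wn' wr' st st' : {subset wn <= wn'} -> {subset wr <= wr'} ->
  frame wn wr st st' -> frame wn' wr' st st'.
Proof.
move=> sn sr [n1 r1]; split=> y yw; [apply: n1|apply: r1]; apply: contra yw; [exact: sn|exact: sr].
Qed.

Lemma update_other T (m : nat -> nat -> T) x i v y : y != x -> update m x i v y = m y.
Proof. by move=> /negPf yx; apply: boolp.funext => j; rewrite /update yx. Qed.

Lemma frame_widen wn wr wn' wr' st st' : all [in wn'] wn -> all [in wr'] wr ->
  frame wn wr st st' -> frame wn' wr' st st'.
Proof. by move=> /allP sn /allP sr; exact: frame_sub. Qed.

Lemma exec_frame c st st' k : exec c st st' k -> frame (nat_writes c) (real_writes c) st st'.
Proof.
elim=> {c st st' k}.
- by [].
- by move=> st x i e; split=> y //=; rewrite inE => yx; exact: update_other.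
- by move=> st x i e; split=> y //=; rewrite inE => yx; exact: update_other.
- move=> c1 c2 st st1 st2 k1 k2 _ f1 _ f2; apply: (frame_trans (st2 := st1)).
    by apply: frame_sub f1 => y yw; rewrite mem_cat yw.
  by apply: frame_sub f2 => y yw; rewrite mem_cat yw orbT.
- move=> b c1 c2 st st1 k _; case: beval => f1; apply: frame_sub f1 => y yw;
    by rewrite mem_cat yw ?orbT.
- by [].
- by move=> b c st st1 st2 k1 k2 _ _ f1 _ f2; exact: frame_trans f1 f2.
Qed.

(** Total correctness together with a cost bound. Boundedness of the stored numbers is assumed and
    restored here, so that postconditions need not mention it. *)
Definition runs c st Q := bounded st -> exists st' k,
  [/\ exec c st st' k, (k <= cost_bound N c)%N, bounded st' & Q st'].

Lemma runs_conseq c st Q Q' : runs c st Q ->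
  (forall st', frame (nat_writes c) (real_writes c) st st' -> Q st' -> Q' st') ->
  runs c st Q'.
Proof.
move=> h qq /h[st' [k [ex kc b q]]]; exists st', k; split => //.
by apply: qq q; exact: exec_frame ex.
Qed.

Lemma runs_skip st Q : Q st -> runs CSkip st Q.
Proof. by move=> q b; exists st, 1%N; split => //; exact: ExecSkip. Qed.

Lemma bounded_update st x i v : bounded st -> (v <= N)%N ->
  forall y j, (update (nmem st) x i v y j <= N)%N.
Proof. by move=> b vN y j; rewrite /update; case: ifP. Qed.

Lemma runs_setN st x i e Q : (bounded st -> neval st e <= N)%N ->
  Q (State (update (nmem st) x (neval st i) (neval st e)) (rmem st)) ->
  runs (CSetN x i e) st Q.
Proof.
move=> eN q b; eexists; eexists; split; [exact: ExecSetN| | |exact: q].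
  by rewrite /= ltnS leq_add// ncost_le.
by move=> y j; apply: bounded_update => //; exact: eN.
Qed.

Lemma runs_setR st x i e Q :
  Q (State (nmem st) (update (rmem st) x (neval st i) (reval st e))) ->
  runs (CSetR x i e) st Q.
Proof.
move=> q b; eexists; eexists; split; [exact: ExecSetR| | |exact: q]; last exact: b.
by rewrite /= ltnS leq_add// ?ncost_le ?rcost_le.
Qed.

Lemma runs_seq c1 c2 st Q : runs c1 st (fun st1 => runs c2 st1 Q) -> runs (CSeq c1 c2) st Q.
Proof.
move=> h b; have [st1 [k1 [e1 l1 b1 h2]]] := h b; have [st2 [k2 [e2 l2 b2 q]]] := h2 b1.
exists st2, (k1 + k2).+1; split => //; first exact: ExecSeq e1 e2.
by rewrite /= ltnS leq_add.
Qed.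

Lemma runs_if b c1 c2 st Q : (beval st b -> runs c1 st Q) -> (~~ beval st b -> runs c2 st Q) ->
  runs (CIf b c1 c2) st Q.
Proof.
move=> h1 h2 bd; have : exists st' k, [/\ exec (if beval st b then c1 else c2) st st' k,
    (k <= cost_bound N c1 + cost_bound N c2)%N, bounded st' & Q st'].
  case: (boolP (beval st b)) => [/h1|/h2] /(_ bd)[st' [k [e l b' q]]]; exists st', k; split=> //.
    by rewrite (leq_trans l)// leq_addr.
  by rewrite (leq_trans l)// leq_addl.
move=> [st' [k [e l b' q]]]; exists st', (bcost st b + k).+1; split => //.
  exact: ExecIf.
by rewrite /= ltnS leq_add// bcost_le.
Qed.

(** Each iteration receives the frame relative to the state before the loop, so [I] need only
    describe what the loop writes. *)
Lemma runs_while b c st p (I : nat -> state R -> Prop) : (p <= N)%N ->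
  I 0%N st ->
  (forall j st1, (j < p)%N -> frame (nat_writes c) (real_writes c) st st1 ->
     I j st1 -> beval st1 b /\ runs c st1 (I j.+1)) ->
  (forall st1, I p st1 -> ~~ beval st1 b) ->
  runs (CWhile b c) st (I p).
Proof.
move=> pN I0 step stop b0.
suff gen r st1 : (r <= p)%N -> bounded st1 -> frame (nat_writes c) (real_writes c) st st1 ->
    I (p - r)%N st1 -> exists st' k, [/\ exec (CWhile b c) st1 st' k,
      (k <= r.+1 * (bcost_bound N b + cost_bound N c).+1)%N, bounded st' & I p st'].
  have [|st' [k [e l b' q]]] := gen p st (leqnn p) b0 (frame_refl _ _ _); first by rewrite subnn.
  exists st', k; split => //=; apply: leq_trans l _; by rewrite leq_mul2r ltnS pN orbT.
elim: r st1 => [|r IH] st1 rp b1 f1 Ir.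
  rewrite subn0 in Ir; exists st1, (bcost st1 b).+1; split => //; first exact/ExecWhileF/stop.
  by rewrite mul1n ltnS (leq_trans (bcost_le b b1))// leq_addr.
have jp : (p - r.+1 < p)%N by rewrite ltn_subrL (leq_trans _ rp).
have [bt /(_ b1)[st2 [k1 [e1 l1 b2]]]] := step _ _ jp f1 Ir.
rewrite subnSK// => I2; have f2 := frame_trans f1 (exec_frame e1).
have [st3 [k2 [e2 l2 b3 q]]] := IH st2 (ltnW rp) b2 f2 I2.
exists st3, (bcost st1 b + k1 + k2).+1; split => //; first exact: ExecWhileT e1 e2.
by rewrite mulSn addSn ltnS leq_add// leq_add// bcost_le.
Qed.

Definition CFor x b body :=
  CSeq (CSetN x (NLit 0) (NLit 0))
    (CWhile (BNot (BLeN (NGet 0 (NLit b)) (NGet x (NLit 0))))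
       (CSeq body (CSetN x (NLit 0) (NAdd (NGet x (NLit 0)) (NLit 1))))).

(* The loop bounds are the numbers of vertices and of requests, in array [0]. *)
Lemma runs_for x b body st cnt (I : nat -> state R -> Prop) Q :
  (0%N \notin nat_writes body) && (x \notin nat_writes body) && (x != 0%N) ->
  nmem st 0 b = cnt -> I 0%N (State (update (nmem st) x 0 0) (rmem st)) ->
  (forall j st1, (j < cnt)%N ->
     frame (x :: nat_writes body) (real_writes body) st st1 -> nmem st1 x 0 = j ->
     I j st1 -> runs body st1 (fun st2 =>
        I j.+1 (State (update (nmem st2) x 0 j.+1) (rmem st2)))) ->
  (forall st', I cnt st' -> Q st') -> runs (CFor x b body) st Q.
Proof.
move=> /andP[/andP[w0 wx] x0] ecnt I0 step IQ; subst cnt; apply: runs_seq; apply: runs_setN => //=.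
set st0 := State _ _ => bd0; have p0 : nmem st0 0 b = nmem st 0 b.
  by rewrite /st0 /= update_other// eq_sym.
have f0 : frame (x :: nat_writes body) (real_writes body) st st0.
  by split=> y //; rewrite inE negb_or => /andP[yx _]; rewrite /st0 /= update_other.
have pN : (nmem st 0 b <= N)%N by rewrite -p0; exact: bd0.
suff : runs (CWhile (BNot (BLeN (NGet 0 (NLit b)) (NGet x (NLit 0))))
       (CSeq body (CSetN x (NLit 0) (NAdd (NGet x (NLit 0)) (NLit 1))))) st0
    ((fun j st1 => [/\ nmem st1 x 0 = j, nmem st1 0 b = nmem st 0 b & I j st1]) (nmem st 0 b)).
  by move=> /(_ bd0)[st' [k [e l b' [_ _ /IQ q]]]]; exists st', k.
apply: (@runs_while _ _ st0 _ (fun j st1 => [/\ nmem st1 x 0 = j, nmem st1 0 b = nmem st 0 b & I j st1])) => //=.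
- by split=> //; rewrite /update !eqxx.
- move=> j st1 jp f1 [ej _ Ij].
  have f2 : frame (x :: nat_writes body) (real_writes body) st st1.
    apply: frame_trans f0 _; apply: frame_sub f1 => y //=; rewrite ?cats0 //.
    by rewrite mem_cat !inE orbC.
  have e0 : nmem st1 0 b = nmem st 0 b by rewrite f2.1// inE negb_or eq_sym x0.
  split; first by rewrite e0 ej -ltnNge.
  apply: runs_seq; apply: runs_conseq (step j st1 jp f2 ej Ij) _ => st2 f3 q.
  have e2 : nmem st2 x 0 = j by rewrite f3.1.
  apply: runs_setN => /= [_|]; first by rewrite e2 addn1 (leq_trans jp).
  rewrite e2 addn1; split=> //; first by rewrite /update !eqxx.
  by rewrite update_other 1?eq_sym// f3.1.
- by move=> st1 [-> -> Ip]; rewrite negbK.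
Qed.

End Logic.

(** * The program *)

Local Notation V x := (NGet x (NLit 0)).
Local Notation W x := (RGet x (NLit 0)).

Definition BEq a b := BAnd (BLeN a b) (BLeN b a).

Lemma beval_eq (R : realType) (st : state R) a b :
  beval st (BEq a b) = (neval st a == neval st b).
Proof. by rewrite /= eqn_leq. Qed.

Lemma filter_iotaS (P : pred nat) j : [seq i <- iota 0 j.+1 | P i] =
  if P j then rcons [seq i <- iota 0 j | P i] j else [seq i <- iota 0 j | P i].
Proof.
by rewrite -addn1 iotaD filter_cat /= add0n; case: ifP; rewrite ?cats1 ?cats0.
Qed.

Lemma filter_iota_sorted (P : pred nat) j : sorted ltn [seq i <- iota 0 j | P i].
Proof. by apply: sorted_filter; [exact: ltn_trans|exact: iota_ltn_sorted]. Qed.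

Local Arguments iota : simpl never.
Local Arguments seq.filter : simpl never.
Local Arguments seq.map : simpl never.
Local Arguments seq.foldl : simpl never.

(* Array cell [20] receives the least index of status [c] with minimal key, plus
   one, or [0] if there is none. *)
Definition CArgmin x b S c (key : nexp -> rexp) :=
  CSeq (CSetN 20 (NLit 0) (NLit 0))
    (CFor x b
      (CIf (BAnd (BEq (NGet S (V x)) (NLit c))
             (BNot (BAnd (BLeN (NLit 1) (V 20))
                (BLeR (key (NSub (V 20) (NLit 1))) (key (V x))))))
         (CSetN 20 (NLit 0) (NAdd (V x) (NLit 1))) CSkip)).

Definition CMaxR x a b :=
  CSeq (CSetR x (NLit 0) a) (CIf (BLeR b (W x)) CSkip (CSetR x (NLit 0) b)).

(* Arrays: natural [6] holds the status of the requests, real [7] the radii,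
   real [8] the reduced costs; scalar [21] is the triggering request. *)
Definition Dst u i := RGet 5 (NAdd (NMul u (NGet 0 (NLit 0))) (NGet 2 i)).

Definition CStar :=
  CSeq (CSetR 14 (NLit 0) (RGet 8 (V 12)))
    (CSeq (CSetN 25 (NLit 0) (NLit 0))
      (CFor 14 1
        (CIf (BAnd (BEq (NGet 6 (V 14)) (NLit 3))
                (BLeR (Dst (V 12) (V 14)) (Dst (V 12) (V 13))))
           (CSeq (CSetR 14 (NLit 0) (RAdd (W 14) (Dst (V 12) (V 14))))
              (CSetN 25 (NLit 0) (NAdd (V 25) (NLit 1))))
           CSkip))).

Definition CRadius1 :=
  CSeq (CSetR 13 (NLit 0) (RAdd (RGet 8 (V 12)) (Dst (V 12) (V 21))))
    (CFor 13 1
      (CIf (BEq (NGet 6 (V 13)) (NLit 3))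
        (CSeq CStar
          (CIf (BLeR (W 13) (RDivN (W 14) (V 25))) CSkip
             (CSetR 13 (NLit 0) (RDivN (W 14) (V 25)))))
        CSkip)).

Definition CRadius := CFor 12 0 (CSeq CRadius1 (CSetR 7 (V 12) (W 13))).

Definition CPrice :=
  CSeq (CMaxR 13 (RGet 7 (NLit 0)) (Dst (NLit 0) (V 12)))
    (CFor 13 0
       (CSeq (CMaxR 14 (RGet 7 (V 13)) (Dst (V 13) (V 12)))
          (CIf (BLeR (W 13) (W 14)) CSkip (CSetR 13 (NLit 0) (W 14))))).

Definition CDual :=
  CSeq (CSetR 12 (NLit 0) (RNat (NLit 0)))
    (CFor 12 1
      (CIf (BEq (NGet 6 (V 12)) (NLit 3))
        (CSeq CPrice (CSetR 12 (NLit 0) (RAdd (W 12) (W 13)))) CSkip)).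

Section Program.
Variables (R : realType) (N : nat).
Implicit Types (st : state R) (Q : state R -> Prop).

Lemma frame_setN wn wr st x i v : x \in wn ->
  frame wn wr st (State (update (nmem st) x i v) (rmem st)).
Proof. by move=> xw; split=> y yw //=; rewrite update_other//; apply: contraNneq yw => ->. Qed.

Lemma frame_setR wn wr st x i v : x \in wr ->
  frame wn wr st (State (nmem st) (update (rmem st) x i v)).
Proof. by move=> xw; split=> y yw //=; rewrite update_other//; apply: contraNneq yw => ->. Qed.

(** The loop performs the fold of [argmin]. Keys are evaluated in intermediate states, so they may
    depend only on what the counter and cell 20 leave intact. *)
Lemma runs_argmin x b S c key st (kf : nat -> R) cnt :
  nmem st 0 b = cnt -> [&& x != 0, x != 20, S != x & S != 20]%N ->
  (forall st' e i, frame [:: 20; x] [::] st st' -> (i < cnt)%N -> neval st' e = i ->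
     reval st' (key e) = kf i) ->
  runs N (CArgmin x b S c key) st (fun st' =>
    nmem st' 20 0 = argmin kf [seq i <- iota 0 cnt | nmem st S i == c]).
Proof.
move=> ecnt /and4P[x0 x20 Sx S20] hkey; apply: runs_seq; apply: runs_setN => //=.
set st0 := State _ _.
have f0 : frame [:: 20; x] [::] st st0 by exact: frame_setN.
have e0 : nmem st0 0 b = cnt by rewrite f0.1// !inE /= eq_sym.
apply: (runs_for (I := fun j st1 => nmem st1 20 0 =
  argmin kf [seq i <- iota 0 j | nmem st S i == c]) _ e0) => //=.
- by rewrite !inE x0 x20.
- by rewrite /update eqxx; case: eqP.
- move=> j st1 jc f1 ej Ij.
  have f2 : frame [:: 20; x] [::] st st1.
    by apply: frame_trans f0 _; apply: frame_sub f1 => y //; rewrite !inE orbC.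
  have e1 : nmem st1 0 b = cnt by rewrite f2.1// !inE /= eq_sym.
  have eS : nmem st1 S = nmem st S by rewrite f2.1// !inE negb_or S20.
  have eb b0 : argmin kf [seq i <- iota 0 j | nmem st S i == c] = b0.+1 -> (b0 < cnt)%N.
    move=> /(argmin_mem (filter_iota_sorted _ _)); rewrite mem_filter mem_iota => /andP[_ /=].
    by move=> /ltn_trans; exact.
  have upd : beval st1 (BAnd (BEq (NGet S (V x)) (NLit c))
             (BNot (BAnd (BLeN (NLit 1) (V 20))
                (BLeR (key (NSub (V 20) (NLit 1))) (key (V x)))))) =
     (nmem st S j == c) && ((nmem st1 20 0 == 0%N) || (kf j < kf (nmem st1 20 0).-1)).
    rewrite [LHS]/= -eqn_leq eS ej; congr (_ && _); rewrite Ij.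
    case E : (argmin _ _) => [|b0] //=.
    rewrite (hkey st1 _ b0)// ?(hkey st1 _ j)//= ?Ij ?E ?subn1 //; last exact: eb.
    by rewrite -ltNge.
  apply: runs_if; rewrite upd; [move=> /andP[Sj cj]|move=> nc].
    apply: runs_setN => /=; first by move=> bd; rewrite ej addn1 (leq_trans jc)// -e1.
    rewrite ej addn1 filter_iotaS Sj argmin_rcons -Ij cj /update /=.
    by rewrite eqxx eq_sym (negPf x20).
  apply: runs_skip; rewrite filter_iotaS /= update_other ?(eq_sym 20%N x)// Ij.
  move: nc; rewrite Ij negb_and; case: (nmem st S j == c) => //= nc.
  by rewrite argmin_rcons (negPf nc).
Qed.

Lemma runs_maxR x a b st Q :
  reval (State (nmem st) (update (rmem st) x 0 (reval st a))) b = reval st b ->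
  (forall st', nmem st' = nmem st -> (forall y, y != x -> rmem st' y = rmem st y) ->
     rmem st' x 0 = Num.max (reval st a) (reval st b) -> Q st') ->
  runs N (CMaxR x a b) st Q.
Proof.
move=> eb h; apply: runs_seq; apply: runs_setR => /=; apply: runs_if => /=; rewrite eb.
  rewrite {1}/update !eqxx /= => ba; apply: runs_skip; apply: h => //=.
    by move=> y yx; rewrite update_other.
  by rewrite /update !eqxx /= (max_idPl ba).
rewrite {1}/update !eqxx /= -ltNge => ab; apply: runs_setR => /=; rewrite eb; apply: h => //=.
  by move=> y yx; rewrite !update_other.
by rewrite /update !eqxx /= (max_idPr (ltW ab)).
Qed.

Section Data.
Variables (n m : nat) (f : nat -> R) (delta : nat -> nat -> R).
Variables (loc : nat -> nat) (rel dl : nat -> R).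
Let d v i := delta v (loc i).

Hypothesis loc_lt : forall i, (i < m)%N -> (loc i < n)%N.

(** The data on which all phases after the distance computation rely and which none of them
    overwrites; real array 5 is the computed distance matrix. *)
Record env st : Prop := Env {
  env_n : nmem st 0 0 = n;
  env_m : nmem st 0 1 = m;
  env_loc : forall i, (i < m)%N -> nmem st 2 i = loc i;
  env_f : forall v, (v < n)%N -> rmem st 0 v = f v;
  env_rel : forall i, (i < m)%N -> rmem st 2 i = rel i;
  env_dl : forall i, (i < m)%N -> rmem st 3 i = dl i;
  env_dist : forall u v, (u < n)%N -> (v < n)%N -> rmem st 5 (u * n + v) = delta u v }.

Lemma env_frame wn wr st st' : frame wn wr st st' ->
  [&& 0 \notin wn, 2 \notin wn, 0 \notin wr, 2 \notin wr, 3 \notin wr & 5 \notin wr]%N ->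
  env st -> env st'.
Proof.
move=> [fn fr] /and5P[n0 n2 r0 r2 /andP[r3 r5]] [h1 h2 h3 h4 h5 h6 h7].
by split; rewrite ?(fn 0%N)// ?(fn 2%N)// ?(fr 0%N)// ?(fr 2%N)// ?(fr 3)// ?(fr 5).
Qed.

Lemma reval_dist st u i v j : env st -> neval st u = v -> neval st i = j ->
  (v < n)%N -> (j < m)%N -> reval st (Dst u i) = d v j.
Proof.
move=> e eu ei vn jm /=; rewrite eu ei (env_n e) (env_loc e)//.
by rewrite (env_dist e)// loc_lt.
Qed.

Lemma runs_star st (c : nat -> R) v i :
  env st -> nmem st 12 0 = v -> nmem st 13 0 = i -> (v < n)%N -> (i < m)%N ->
  rmem st 8 v = c v -> let Q := [seq j <- iota 0 m | nmem st 6 j == 3%N] in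
  runs N CStar st (fun st' =>
    rmem st' 14 0 = c v + ball_sum d Q v i /\ nmem st' 25 0 = ball_size d Q v i).
Proof.
move=> e ev ei vn im ec Q; apply: runs_seq; apply: runs_setR => /=.
apply: runs_seq; apply: runs_setN => //=; set st0 := State _ _.
have f0 : frame [:: 25] [:: 14] st st0.
  apply: frame_trans (frame_setR _ _ _ _ _) (frame_setN _ _ _ _ _);
  by rewrite inE.
have e0 := env_frame f0 isT e.
have em : nmem st0 0 1 = m := env_m e0.
apply: (runs_for (I := fun j st1 =>
  let Q := [seq j <- iota 0 j | nmem st 6 j == 3%N] in
  rmem st1 14 0 = c v + ball_sum d Q v i /\ nmem st1 25 0 = ball_size d Q v i) _ em) => //.
- by rewrite /= /ball_sum big_nil addr0 ev ec.
- move=> j st1 jm f1 ej [Is Ic].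
  have f2 : frame [:: 25; 14] [:: 14] st st1.
    apply: frame_trans (frame_widen _ _ f0) _ => //; exact: frame_widen f1.
  have e1 := env_frame f2 isT e.
  have ev1 : nmem st1 12 0 = v by rewrite f2.1.
  have ei1 : nmem st1 13 0 = i by rewrite f2.1.
  have dj : reval st1 (Dst (V 12) (V 14)) = d v j by exact: reval_dist.
  have di : reval st1 (Dst (V 12) (V 13)) = d v i by exact: reval_dist.
  have eb : beval st1 (BAnd (BEq (NGet 6 (V 14)) (NLit 3))
                (BLeR (Dst (V 12) (V 14)) (Dst (V 12) (V 13)))) =
            (nmem st 6 j == 3%N) && (d v j <= d v i).
    by rewrite -dj -di -(f2.1 6)// /= -eqn_leq ej.
  have cj : (ball_size d [seq j <- iota 0 j | nmem st 6 j == 3%N] v i <= j)%N.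
    rewrite (leq_trans (count_size _ _))// size_filter (leq_trans (count_size _ _))//.
    by rewrite size_iota.
  apply: runs_if; rewrite eb; [move=> /andP[S3 ji]|move=> nS].
    apply: runs_seq; apply: runs_setR; apply: runs_setN => [bd|].
      rewrite /= Ic addn1; apply: leq_ltn_trans cj (leq_trans jm _).
      by rewrite -(env_m e1); exact: bd.
    rewrite /= filter_iotaS S3 /ball_sum /ball_size -cats1 big_cat count_cat /=.
    by rewrite big_cons big_nil ji Is Ic addr0 addrA addn0 -dj.
  apply: runs_skip; rewrite /= filter_iotaS; case: ifP nS => [_ /= ji|//].
  rewrite /ball_sum /ball_size -cats1 big_cat count_cat /= big_cons big_nil (negPf ji).
  by rewrite addr0 /= ?addn0; split; [exact: Is|exact: Ic].
Qed.

Lemma foldl_min_rcons (y : R) l z : foldl Num.min y (rcons l z) = Num.min (foldl Num.min y l) z.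
Proof. by rewrite foldl_rcons. Qed.

Lemma runs_radius1 st (c : nat -> R) v q :
  env st -> nmem st 12 0 = v -> nmem st 21 0 = q -> (v < n)%N -> (q < m)%N ->
  rmem st 8 v = c v -> let Q := [seq j <- iota 0 m | nmem st 6 j == 3%N] in
  runs N CRadius1 st (fun st' => rmem st' 13 0 = dual_radius c d q Q v).
Proof.
move=> e ev eq vn qm ec Q; apply: runs_seq; apply: runs_setR; set st0 := State _ _.
have f0 : frame [::] [:: 13] st st0 by exact: frame_setR.
have e0 := env_frame f0 isT e.
apply: (runs_for (I := fun j st1 => rmem st1 13 0 = foldl Num.min (c v + d v q)
  [seq star c d Q v i | i <- [seq j <- iota 0 j | nmem st 6 j == 3%N]]) _ (env_m e0)) => //.
- have h : reval st (Dst (V 12) (V 21)) = d v q by exact: reval_dist.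
  by rewrite /st0 -h -ec -ev.
- move=> j st1 jm f1 ej Ij.
  have f2 : frame [:: 13; 14; 25] [:: 13; 14] st st1.
    apply: frame_trans (frame_widen _ _ f0) _ => //; exact: frame_widen f1.
  have e1 := env_frame f2 isT e.
  have ev1 : nmem st1 12 0 = v by rewrite f2.1.
  have e6 : nmem st1 6 = nmem st 6 by rewrite f2.1.
  have ec1 : rmem st1 8 v = c v by rewrite f2.2.
  apply: runs_if; rewrite beval_eq /= ej e6; last first.
    by move=> S3; apply: runs_skip; rewrite /= filter_iotaS (negPf S3).
  move=> S3; apply: runs_seq; apply: runs_conseq (runs_star e1 ev1 ej vn jm ec1) _.
  rewrite e6 -/Q => st2 f3 [h14 h25].
  have h13 : rmem st2 13 0 = rmem st1 13 0 by rewrite f3.2.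
  apply: runs_if; rewrite /= h13 h14 h25 -/(star c d Q v j) Ij => hle.
    apply: runs_skip; rewrite /= filter_iotaS S3 map_rcons foldl_min_rcons h13 Ij.
    by rewrite (min_idPl _).
  apply: runs_setR; rewrite /= filter_iotaS S3 map_rcons foldl_min_rcons h14 h25.
  by rewrite -/(star c d Q v j) (min_idPr _)// ltW// ltNge.
Qed.

Lemma runs_radius st (c : nat -> R) q :
  env st -> nmem st 21 0 = q -> (q < m)%N -> (forall v, (v < n)%N -> rmem st 8 v = c v) ->
  let Q := [seq j <- iota 0 m | nmem st 6 j == 3%N] in
  runs N CRadius st (fun st' => forall v, (v < n)%N -> rmem st' 7 v = dual_radius c d q Q v).
Proof.
move=> e eq qm ec Q.
apply: (runs_for (I := fun j st1 => forall v, (v < j)%N ->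
  rmem st1 7 v = dual_radius c d q Q v) _ (env_n e)) => //.
move=> v st1 vn f1 ev Iv; have e1 := env_frame f1 isT e.
have e6 : nmem st1 6 = nmem st 6 by rewrite f1.1.
have eq1 : nmem st1 21 0 = q by rewrite f1.1.
have ec1 : rmem st1 8 v = c v by rewrite f1.2// ec.
apply: runs_seq; apply: runs_conseq (runs_radius1 e1 ev eq1 vn qm ec1) _.
rewrite e6 -/Q => st2 f2 h; apply: runs_setR => u.
rewrite ltnS leq_eqVlt /= {1}/update /= => /predU1P[->|uv].
  by rewrite f2.1// ev eqxx h.
by rewrite f2.1// ev (ltn_eqF uv) f2.2// Iv.
Qed.

Lemma runs_price st (c : nat -> R) q i : let Q := [seq j <- iota 0 m | nmem st 6 j == 3%N] in
  env st -> nmem st 12 0 = i -> (i < m)%N ->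
  (forall v, (v < n)%N -> rmem st 7 v = dual_radius c d q Q v) ->
  runs N CPrice st (fun st' => rmem st' 13 0 = price n c d q Q i).
Proof.
move=> Q e ei im er; have n0 : (0 < n)%N by apply: leq_ltn_trans (loc_lt im).
apply: runs_seq; apply: runs_maxR; first by [].
move=> st0 en er0; rewrite (reval_dist e (v := 0) (j := i))//= er// => h13.
have f0 : frame [::] [:: 13] st st0.
  by split=> y; rewrite ?en// inE => /er0.
have e0 := env_frame f0 isT e.
apply: (runs_for (I := fun j st1 => rmem st1 13 0 =
  foldl Num.min (Num.max (dual_radius c d q Q 0) (d 0 i))
    [seq Num.max (dual_radius c d q Q v) (d v i) | v <- iota 0 j]) _ (env_n e0)) => //.
move=> v st1 vn f1 ev Iv.
have f2 : frame [:: 13] [:: 13; 14] st st1.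
  apply: frame_trans (frame_widen _ _ f0) _ => //; exact: frame_widen f1.
have e1 := env_frame f2 isT e.
apply: runs_seq; apply: runs_maxR; first by [].
move=> st2 en2 er2.
rewrite (reval_dist e1 (v := v) (j := i))//=; last by rewrite f2.1.
rewrite ev f2.2// er// => h14.
have hI : [seq Num.max (dual_radius c d q Q v) (d v i) | v <- iota 0 v.+1] =
  rcons [seq Num.max (dual_radius c d q Q v) (d v i) | v <- iota 0 v]
    (Num.max (dual_radius c d q Q v) (d v i)).
  by rewrite -addn1 iotaD map_cat cats1 add0n.
apply: runs_if; rewrite /= h14 er2// Iv => hle.
  by apply: runs_skip; cbv beta; rewrite hI foldl_min_rcons /= er2// Iv (min_idPl _).
apply: runs_setR; cbv beta; rewrite hI foldl_min_rcons /= h14 (min_idPr _)//.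
by rewrite ltW// ltNge.
Qed.

Lemma runs_dual st (c : nat -> R) q : let Q := [seq j <- iota 0 m | nmem st 6 j == 3%N] in
  env st -> (forall v, (v < n)%N -> rmem st 7 v = dual_radius c d q Q v) ->
  runs N CDual st (fun st' => rmem st' 12 0 = dual_value n c d q Q).
Proof.
move=> Q e er; apply: runs_seq; apply: runs_setR; set st0 := State _ _.
have f0 : frame [::] [:: 12] st st0 by exact: frame_setR.
have e0 := env_frame f0 isT e.
apply: (runs_for (I := fun j st1 => rmem st1 12 0 =
  \sum_(i <- [seq j <- iota 0 j | nmem st 6 j == 3%N]) price n c d q Q i) _ (env_m e0)) => //.
  by rewrite /= big_nil.
move=> j st1 jm f1 ej Ij.
have f2 : frame [:: 12; 13] [:: 12; 13; 14] st st1.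
  apply: frame_trans (frame_widen _ _ f0) _ => //; exact: frame_widen f1.
have e1 := env_frame f2 isT e.
have e6 : nmem st1 6 = nmem st 6 by rewrite f2.1.
have er1 v : (v < n)%N -> rmem st1 7 v = dual_radius c d q
    [seq j <- iota 0 m | nmem st1 6 j == 3%N] v.
  by move=> vn; rewrite e6 f2.2// er.
apply: runs_if; rewrite beval_eq /= ej e6; last first.
  by move=> S3; apply: runs_skip; rewrite /= filter_iotaS (negPf S3).
move=> S3; apply: runs_seq; apply: runs_conseq (runs_price e1 ej jm er1) _.
rewrite e6 -/Q => st2 f3 h13; apply: runs_setR => /=.
by rewrite filter_iotaS S3 -cats1 big_cat big_cons big_nil /= addr0 h13 f3.2// Ij.
Qed.

End Data.
End Program.

(** * Program for the choice of the requests served *)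

(* Status of a request: [0] pending, [1] served, [2] eligible for the current
   service and not picked, [3] picked.  Real array [6] holds [scale] of the
   levels, real cell [11] the budget, real cell [12] the dual value. *)
Definition CEligible :=
  CFor 11 1
    (CIf (BAnd (BEq (NGet 6 (V 11)) (NLit 0))
           (BAnd (BLeR (RGet 2 (V 11)) (RGet 3 (V 21))) (BLeR (RGet 6 (V 11)) (W 11))))
       (CSetN 6 (V 11) (NLit 2)) CSkip).

Definition CReduced :=
  CFor 11 0
    (CIf (BLeR (RMulN (RGet 0 (V 11)) (NGet 0 (NLit 0))) (W 11))
       (CSetR 8 (V 11) (RNat (NLit 0))) (CSetR 8 (V 11) (RGet 0 (V 11)))).

Definition CPick1 :=
  CIf (BLeR (W 11) (W 12)) CSkip
    (CSeq (CArgmin 12 1 6 2 (RGet 3))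
       (CIf (BLeN (NLit 1) (V 20))
          (CSeq (CSetN 6 (NSub (V 20) (NLit 1)) (NLit 3)) (CSeq CRadius CDual))
          CSkip)).

Definition CPick := CSeq (CSetR 12 (NLit 0) (RNat (NLit 0))) (CFor 11 1 CPick1).

Section Service.
Variables (R : realType) (N : nat).
Implicit Types (st : state R) (Q : state R -> Prop).
Variables (n m : nat) (f : nat -> R) (delta : nat -> nat -> R).
Variables (loc : nat -> nat) (rel dl : nat -> R).
Let d v i := delta v (loc i).

Hypothesis N3 : (3 <= N)%N.
Hypothesis loc_lt : forall i, (i < m)%N -> (loc i < n)%N.
Hypothesis f_gt0 : forall v, 0 < f v.

Let env := env n m f delta loc rel dl.

Variables (x : progress) (q : nat).
Hypothesis qm : (q < m)%N.
Let E := eligible m rel dl x q.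
Let B := scale n f (x.2 q).
Let c := reduced_cost n f B.

Let code (todo : seq nat) i : nat :=
  if x.1 i then 1 else if i \in todo then 2 else if i \in E then 3 else 0.

Definition status st todo := forall i, (i < m)%N -> nmem st 6 i = code todo i.

(** The program stores budgets instead of levels. Comparing budgets is equivalent, and deferring a
    request amounts to doubling by an addition. *)
Lemma le_scale a b : (scale n f a <= scale n f b) = (a <= b)%N.
Proof. by rewrite ler_pM2l ?min_cost_gt0// ler_eXn2l// ltr1n. Qed.

Lemma filter_status2 st todo : sorted ltn todo -> {subset todo <= E} -> status st todo ->
  [seq i <- iota 0 m | nmem st 6 i == 2%N] = todo.
Proof.
move=> so sub h; apply: (irr_sorted_eq ltn_trans ltnn) => //; first exact: filter_iota_sorted.
move=> i; rewrite mem_filter mem_iota /=; case: ltnP => im; rewrite ?andbT ?andbF.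
  rewrite h// /code; case it : (i \in todo).
    by have := sub _ it; rewrite mem_eligible => /and4P[_ /negPf ->].
  by do 2?case: ifP.
by apply/esym/negP => /sub; rewrite mem_eligible ltnNge im.
Qed.

Lemma filter_status3 st todo : status st todo ->
  [seq i <- iota 0 m | nmem st 6 i == 3%N] = select E todo.
Proof.
move=> h; apply: (irr_sorted_eq ltn_trans ltnn); first exact: filter_iota_sorted.
  by apply: sorted_filter; [exact: ltn_trans|exact: eligible_sorted].
move=> i; rewrite mem_filter mem_iota [i \in select _ _]mem_filter /=.
case: ltnP => im; last by rewrite andbF mem_eligible ltnNge im andbF.
rewrite h// /code mem_eligible im; case: (x.1 i); case: (i \in todo) => //=.
by case: ifP.
Qed.

Lemma runs_eligible st : env st -> nmem st 21 0 = q ->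
  (forall i, (i < m)%N -> nmem st 6 i = x.1 i) ->
  (forall i, (i < m)%N -> rmem st 6 i = scale n f (x.2 i)) ->
  rmem st 11 0 = B -> runs N CEligible st (status ^~ E).
Proof.
move=> e eq h6 hl hB; apply: (runs_for (I := fun j st1 => forall i, (i < m)%N ->
  nmem st1 6 i = if (i < j)%N && (i \in E) then 2%N else nmem st 6 i) _ (env_m e)) => //.
- move=> j st1 jm f1 ej Ij; have e1 := env_frame f1 isT e.
  have hb : beval st1 (BAnd (BEq (NGet 6 (V 11)) (NLit 0))
     (BAnd (BLeR (RGet 2 (V 11)) (RGet 3 (V 21))) (BLeR (RGet 6 (V 11)) (W 11)))) = (j \in E).
    rewrite /= -eqn_leq ej Ij// ltnn /= h6// (env_rel e1)// f1.1// eq (env_dl e1)//.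
    rewrite !f1.2// hl// hB le_scale mem_eligible jm /=.
    by case: (x.1 j).
  apply: runs_if; rewrite hb => jE.
    apply: runs_setN => [_|i im] /=; first by apply: leq_trans N3.
    rewrite ltnS leq_eqVlt ej [update _ _ _ _ _ _]/update /=.
    by rewrite [update _ _ _ _ _ _]/update /=; case: eqP => [->|_] /=; rewrite ?jE ?Ij.
  apply: runs_skip => i im /=; rewrite ltnS leq_eqVlt; case: eqP => [->|_] /=; last exact: Ij.
  by rewrite (negPf jE) /= [update _ _ _ _ _ _]/update /= Ij// ltnn.
move=> st' h i im; rewrite h// im /= h6// /code mem_eligible im /=.
by case: (x.1 i) => //=; case: ifP.
Qed.

Lemma runs_reduced st : env st -> rmem st 11 0 = B ->
  runs N CReduced st (fun st' => forall v, (v < n)%N -> rmem st' 8 v = c v).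
Proof.
move=> e hB; apply: (runs_for (I := fun j st1 => forall v, (v < j)%N ->
  rmem st1 8 v = c v) _ (env_n e)) => //.
move=> j st1 jn f1 ej Ij; have e1 := env_frame f1 isT e.
apply: runs_if; rewrite /= ej (env_f e1)// (env_n e1) f1.2// hB mulrC => h;
  apply: runs_setR => v /=; rewrite ltnS leq_eqVlt ej /update /= => /predU1P[->|vj].
- by rewrite eqxx /c /reduced_cost h.
- by rewrite (ltn_eqF vj) Ij.
- by rewrite eqxx /c /reduced_cost (negPf h) (env_f e1).
- by rewrite (ltn_eqF vj) Ij.
Qed.

Definition pick_rel st todo :=
  [/\ sorted ltn todo, {subset todo <= E}, status st todo &
      rmem st 12 0 = dual_value n c d q (select E todo)].

Lemma runs_pick1 st todo : env st -> nmem st 21 0 = q ->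
  (forall v, (v < n)%N -> rmem st 8 v = c v) -> rmem st 11 0 = B ->
  pick_rel st todo ->
  runs N CPick1 st (pick_rel ^~ (pick_step n f delta loc dl B q E todo)).
Proof.
move=> e eq h8 hB [so sub hs hD].
have f2 := filter_status2 so sub hs; have f3 := filter_status3 hs.
rewrite /pick_step -/c -/d -hD ltNge; apply: runs_if; rewrite /= hB => hle.
  by rewrite hle; apply: runs_skip.
rewrite hle; apply: runs_seq.
have hkey st' e0 i : frame [:: 20; 12]%N [::] st st' -> (i < m)%N -> neval st' e0 = i ->
    reval st' (RGet 3 e0) = dl i.
  by move=> f0 im /= ->; have e' := env_frame f0 isT e; rewrite (env_dl e').
apply: runs_conseq (@runs_argmin _ N 12 1 6 2 (RGet 3) st dl m (env_m e) isT hkey) _.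
rewrite f2 => st1 f1 h20; have e1 := env_frame f1 isT e.
apply: runs_if; rewrite /= h20; case Eb : (argmin dl todo) => [|b] //= _; last first.
  apply: runs_skip; split=> //; last by rewrite f1.2.
  by move=> i im; rewrite f1.1// hs.
have bt := argmin_mem so Eb; have bE := sub _ bt.
apply: runs_seq; apply: runs_setN => [_|] //=; rewrite h20 Eb subn1 /=.
set st2 := State _ _.
have fr2 : frame [:: 6] [::] st1 st2 by exact: frame_setN.
have e2 := env_frame fr2 isT e1.
have hs2 : status st2 [seq i <- todo | i != b].
  move=> i im; rewrite /st2 /= {1}/update /= f1.1// hs// /code.
  rewrite [i \in [seq _ <- todo | _]]mem_filter.
  case: (eqVneq i b) => [->|_] //=.
  by rewrite bE; move: bE; rewrite mem_eligible => /and4P[_ /negPf ->].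
have eq2 : nmem st2 21 0 = q by rewrite fr2.1// f1.1.
have h82 v : (v < n)%N -> rmem st2 8 v = c v by move=> vn; rewrite fr2.2// f1.2// h8.
apply: runs_seq; apply: runs_conseq (runs_radius loc_lt e2 eq2 qm h82) _ => st3 f3' h7.
have e3 := env_frame f3' isT e2.
have h63 : nmem st3 6 = nmem st2 6 by rewrite f3'.1.
rewrite -h63 in h7.
apply: runs_conseq (runs_dual loc_lt e3 h7) _ => st4 f4 h12.
have hs4 : status st4 [seq i <- todo | i != b].
  by move=> i im; rewrite f4.1// h63 hs2.
split=> //; first by apply: sorted_filter => //; exact: ltn_trans.
  by move=> i; rewrite mem_filter => /andP[_ /sub].
rewrite h12 h63; congr dual_value; exact: filter_status3.
Qed.

Lemma runs_pick st : env st -> nmem st 21 0 = q ->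
  (forall v, (v < n)%N -> rmem st 8 v = c v) -> rmem st 11 0 = B -> status st E ->
  runs N CPick st (status ^~ (deferred n m f delta loc rel dl x q)).
Proof.
move=> e eq h8 hB hs; apply: runs_seq; apply: runs_setR; set st0 := State _ _.
have f0 : frame [::] [:: 12] st st0 by exact: frame_setR.
have e0 := env_frame f0 isT e.
apply: (runs_for (I := fun j => pick_rel ^~ (iter j (pick_step n f delta loc dl B q E) E))
  _ (env_m e0)) => //.
- split=> //; first exact: eligible_sorted.
  rewrite /= /select (eq_in_filter (a2 := pred0)) ?filter_pred0 => [|i /= ->//].
  by rewrite /dual_value big_nil.
- move=> j st1 jm f1 ej Ij.
  have e1 := env_frame f1 isT e0.
  have eq1 : nmem st1 21 0 = q by rewrite f1.1.
  have h81 v : (v < n)%N -> rmem st1 8 v = c v by move=> vn; rewrite f1.2// f0.2// h8.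
  have hB1 : rmem st1 11 0 = B by rewrite f1.2// f0.2.
  by apply: runs_conseq (runs_pick1 e1 eq1 h81 hB1 Ij) _ => st2 f2 [].
- by move=> st' [].
Qed.

End Service.

(** * Program for the opening of facilities *)

(* Natural array [7] holds the status of the vertices ([0] unprocessed, [1]
   opened, [2] not opened), natural array [8] the actions of the opened ones. *)
Definition CBlocked :=
  CSeq (CSetN 24 (NLit 0) (NLit 0))
    (CFor 12 0
      (CIf (BAnd (BEq (NGet 7 (V 12)) (NLit 1))
              (BLeR (RGet 5 (NAdd (NMul (V 12) (NGet 0 (NLit 0))) (V 23)))
                 (RAdd (RGet 7 (V 23)) (RGet 7 (V 23)))))
         (CSetN 24 (NLit 0) (NLit 1)) CSkip)).

Definition CEmit :=
  CSeq (CSetN 7 (V 23) (NLit 1))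
    (CSeq (CSetN 8 (V 23) (V 3))
      (CSeq (CSetN 4 (V 3) (V 23))
        (CSeq (CSetR 4 (V 3) (RGet 3 (V 21)))
           (CSetN 3 (NLit 0) (NAdd (V 3) (NLit 1)))))).

Definition COpen1 :=
  CSeq (CArgmin 12 0 7 0 (RGet 7))
    (CIf (BLeN (NLit 1) (V 20))
      (CSeq (CSetN 23 (NLit 0) (NSub (V 20) (NLit 1)))
        (CSeq CBlocked
          (CIf (BEq (V 24) (NLit 0)) CEmit (CSetN 7 (V 23) (NLit 2)))))
      CSkip).

Definition COpen :=
  CSeq (CFor 11 0 (CSetN 7 (V 11) (NLit 0))) (CFor 11 0 COpen1).

Section Open.
Variables (R : realType) (N : nat).
Implicit Types (st : state R) (Q : state R -> Prop).
Variables (n m : nat) (f : nat -> R) (delta : nat -> nat -> R).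
Variables (loc : nat -> nat) (rel dl : nat -> R).
Let d v i := delta v (loc i).

Hypothesis N3 : (3 <= N)%N.
Hypothesis loc_lt : forall i, (i < m)%N -> (loc i < n)%N.

Let env := env n m f delta loc rel dl.

Variables (r : nat -> R) (q a0 : nat).
Hypothesis qm : (q < m)%N.

(* The state [st0] is the one before the actions of the current service, the
   first of which is number [a0]. *)
Definition open_rel st0 st (y : seq nat * seq nat) :=
  [/\ sorted ltn y.1 /\ {subset y.1 <= iota 0 n},
      forall z, z \in y.2 -> (z < n)%N /\ z \notin y.1,
      forall v, (v < n)%N ->
        nmem st 7 v = if v \in y.1 then 0%N else if v \in y.2 then 1%N else 2,
      nmem st 3 0 = (a0 + size y.2)%N /\ forall k, (k < a0)%N ->
        nmem st 4 k = nmem st0 4 k /\ rmem st 4 k = rmem st0 4 k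
    & forall k, (k < size y.2)%N ->
        [/\ nmem st 4 (a0 + k) = nth 0%N y.2 k, rmem st 4 (a0 + k) = dl q &
            nmem st 8 (nth 0%N y.2 k) = (a0 + k)%N]].

(** This is [open_step] for arbitrary radii, so that the verification does not depend on where the
    radii come from. *)
Let step := fun y : seq nat * seq nat =>
  if argmin r y.1 is v.+1 then
    ([seq w <- y.1 | w != v],
     if has (fun z => delta z v <= r v *+ 2) y.2 then y.2 else rcons y.2 v)
  else y.

Lemma runs_blocked st v : env st -> nmem st 23 0 = v -> (v < n)%N ->
  rmem st 7 v = r v ->
  runs N CBlocked st (fun st' => nmem st' 24 0 =
    has (fun z => delta z v <= r v *+ 2) [seq z <- iota 0 n | nmem st 7 z == 1%N]).
Proof.
move=> e ev vn er; apply: runs_seq; apply: runs_setN => //=; set st0 := State _ _.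
have f0 : frame [:: 24] [::] st st0 by exact: frame_setN.
have e0 := env_frame f0 isT e.
apply: (runs_for (I := fun j st1 => nmem st1 24 0 =
    has (fun z => delta z v <= r v *+ 2) [seq z <- iota 0 j | nmem st 7 z == 1%N]) _ (env_n e0)) => //.
move=> j st1 jn f1 ej Ij.
have f2 : frame [:: 24; 12] [::] st st1.
  apply: frame_trans (frame_widen _ _ f0) _ => //; exact: frame_widen f1.
have e1 := env_frame f2 isT e.
have hb : beval st1 (BAnd (BEq (NGet 7 (V 12)) (NLit 1))
              (BLeR (RGet 5 (NAdd (NMul (V 12) (NGet 0 (NLit 0))) (V 23)))
                 (RAdd (RGet 7 (V 23)) (RGet 7 (V 23))))) =
  (nmem st 7 j == 1%N) && (delta j v <= r v *+ 2).
  rewrite /= -eqn_leq ej f2.1// (f2.1 23)// ev (env_n e1) (env_dist e1)//.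
  by rewrite f2.2// er mulr2n.
apply: runs_if; rewrite hb; [move=> /andP[h7 h]|move=> h].
  apply: runs_setN => [_|] /=; first by apply: leq_trans N3.
  by rewrite filter_iotaS h7 has_rcons h.
apply: runs_skip; rewrite /= filter_iotaS.
case: ifP h => [_ /= h|_ _]; last exact: Ij.
by rewrite has_rcons (negPf h); exact: Ij.
Qed.

Lemma runs_open1 st0 st y : env st -> nmem st 21 0 = q ->
  (forall v, (v < n)%N -> rmem st 7 v = r v) -> (a0 + size y.2 < N)%N ->
  open_rel st0 st y -> runs N COpen1 st (fun st' => open_rel st0 st' (step y)).
Proof.
move=> e eq er aN [[so sub] h2 h7 [h3 hold] hnew]; apply: runs_seq.
have hkey st' e0 i : frame [:: 20; 12]%N [::] st st' -> (i < n)%N -> neval st' e0 = i ->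
    reval st' (RGet 7 e0) = r i.
  by move=> f0 im /= ->; rewrite f0.2// er.
apply: runs_conseq (@runs_argmin _ N 12 0 7 0 (RGet 7) st r n (env_n e) isT hkey) _.
have -> : [seq z <- iota 0 n | nmem st 7 z == 0%N] = y.1.
  apply: (irr_sorted_eq ltn_trans ltnn) => //; first exact: filter_iota_sorted.
  move=> z; rewrite mem_filter mem_iota /=; case: ltnP => zn; rewrite ?andbT ?andbF.
    by rewrite h7//; case: (z \in y.1) => //; case: ifP.
  by apply/esym/negP => /sub; rewrite mem_iota /= ltnNge zn.
move=> st1 f1 h20; have e1 := env_frame f1 isT e.
apply: runs_if; rewrite /= h20 /step; case Ev : (argmin r y.1) => [|v] //= _; last first.
  apply: runs_skip; split => //.
  - by move=> v vn; rewrite f1.1// h7.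
  - by rewrite f1.1//; split=> // k ka; rewrite f1.1// f1.2// ; exact: hold.
  - by move=> k ks; have [? ? ?] := hnew _ ks; rewrite !f1.1// f1.2.
have vy := argmin_mem so Ev; have vn : (v < n)%N by have := sub _ vy; rewrite mem_iota.
have vo : v \notin y.2 by apply/negP => /h2[_]; rewrite vy.
apply: runs_seq; apply: runs_setN => [bd|] /=.
  by rewrite (leq_trans (leq_subr _ _))//; exact: bd.
rewrite h20 Ev subn1 /=; set st2 := State _ _.
have f12 : frame [:: 23] [::] st1 st2 by exact: frame_setN.
have f2 : frame [:: 20; 12; 23] [::] st st2.
  apply: frame_trans (frame_widen _ _ f1) _ => //; exact: frame_widen f12.
have e2 := env_frame f2 isT e.
have h23 : nmem st2 23 0 = v by [].
have er2 : rmem st2 7 v = r v by rewrite f2.2// er.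
apply: runs_seq; apply: runs_conseq (runs_blocked e2 h23 vn er2) _ => st3 f23 h24.
(* The program scans the opened vertices by index, the greedy rule in order of opening; only
   membership matters. *)
have hh : has (fun z => delta z v <= r v *+ 2) [seq z <- iota 0 n | nmem st2 7 z == 1%N] =
    has (fun z => delta z v <= r v *+ 2) y.2.
  have -> : nmem st2 7 = nmem st 7 by rewrite f2.1.
  apply: eq_has_r => z; rewrite mem_filter mem_iota /=; case: ltnP => zn; rewrite ?andbT ?andbF.
    rewrite h7//; case zy : (z \in y.1).
      by apply/esym/negP => /h2[_]; rewrite zy.
    by case: ifP.
  by apply/esym/negP => /h2[]; rewrite ltnNge zn.
rewrite hh in h24.
have f3 : frame [:: 20; 12; 23; 24] [::] st st3.
  apply: frame_trans (frame_widen _ _ f2) _ => //; exact: frame_widen f23.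
have e3 := env_frame f3 isT e.
have h23' : nmem st3 23 0 = v by rewrite f23.1.
have sub' : {subset [seq w <- y.1 | w != v] <= iota 0 n}.
  by move=> w; rewrite mem_filter => /andP[_ /sub].
have so' : sorted ltn [seq w <- y.1 | w != v].
  by apply: sorted_filter => //; exact: ltn_trans.
have mem' w : (w \in [seq w <- y.1 | w != v]) = (w != v) && (w \in y.1) by rewrite mem_filter.
apply: runs_if; rewrite beval_eq /= h24; case: (has _ _) => //= _; last first.
  apply: runs_setN => [_|] /=; first by apply: leq_trans N3.
  rewrite h23'; split=> //=.
  - by move=> z zy; have [zn zn1] := h2 _ zy; rewrite mem' (negPf zn1) andbF.
  - move=> w wn; rewrite mem' {1}/update /=; case: eqVneq => [->|_] /=.
      by rewrite (negPf vo).
    by rewrite f3.1// h7.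
  - by rewrite /update /= f3.1//; split=> // k ka; rewrite f3.1// f3.2//; exact: hold.
  - by move=> k ks; have [? ? ?] := hnew _ ks; rewrite /update /= !f3.1// f3.2.
have h33 : nmem st3 3 0 = (a0 + size y.2)%N by rewrite f3.1.
apply: runs_seq; apply: runs_setN => [_|]; first by apply: leq_trans N3.
set s4 := State _ _; apply: runs_seq; apply: runs_setN => [_|].
  by rewrite /= /update /= h33 ltnW.
set s5 := State _ _; apply: runs_seq; apply: runs_setN => [bd|]; first exact: (bd 23 0).
set s6 := State _ _; apply: runs_seq; apply: runs_setR.
set s7 := State _ _; apply: runs_setN => [_|].
  by rewrite /= /update /= h33 addn1.
have hdl : rmem st3 3 (nmem st3 21 0) = dl q by rewrite (env_dl e3)// ?f3.1// eq.
rewrite /s7 /s6 /s5 /s4 /= /update /= h23' h33 hdl addn1 {s4 s5 s6 s7}.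
split=> //=.
- move=> z; rewrite mem_rcons inE mem' => /predU1P[->|zy]; first by rewrite eqxx.
  by have [zn zn1] := h2 _ zy; rewrite (negPf zn1) andbF.
- move=> w wn; rewrite mem' mem_rcons inE; case: eqVneq => [->|_] //=.
  by rewrite f3.1// h7.
- rewrite size_rcons addnS; split=> // k ka.
  rewrite (ltn_eqF (leq_trans ka (leq_addr _ _))) f3.1// f3.2//; exact: hold.
- move=> k; rewrite size_rcons ltnS leq_eqVlt nth_rcons => /predU1P[->|ks].
    by rewrite ltnn eqxx !eqxx.
  have [g1 g2 g3] := hnew _ ks.
  have nv : (nth 0%N y.2 k == v) = false by apply: contraNF vo => /eqP <-; exact: mem_nth.
  by rewrite ks eqn_add2l (ltn_eqF ks) nv !f3.1// f3.2.
Qed.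

Lemma open_rel_frame wn wr st0 st st' y :
  frame wn wr st st' -> [&& 3 \notin wn, 4 \notin wn, 7 \notin wn, 8 \notin wn & 4 \notin wr]%N ->
  open_rel st0 st y -> open_rel st0 st' y.
Proof.
move=> [fn fr] /and5P[w3 w4 w7 w8 wr4] [h1 h2 h7 [h3 hold] hnew].
split=> //; rewrite ?(fn 3%N)// ?(fn 4%N)// ?(fn 7%N)// ?(fn 8%N)// ?(fr 4%N)//.
Qed.

Lemma size_step j : (size (iter j step (iota 0 n, [::])).2 <= j)%N.
Proof.
elim: j => //= j IH; rewrite /step; case: argmin => [|v] /=; first exact: ltnW.
by case: ifP => _; rewrite ?size_rcons// ltnW.
Qed.

Lemma runs_open st : env st -> nmem st 21 0 = q -> nmem st 3 0 = a0 ->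
  (forall v, (v < n)%N -> rmem st 7 v = r v) -> (a0 + n <= N)%N ->
  runs N COpen st (fun st' => open_rel st st' (iter n step (iota 0 n, [::]))).
Proof.
move=> e eq e3 er aN; apply: runs_seq.
apply: runs_conseq (_ : runs N (CFor 11 0 (CSetN 7 (V 11) (NLit 0))) st
  (fun st1 => forall v, (v < n)%N -> nmem st1 7 v = 0%N)) _.
  apply: (runs_for (I := fun j st1 => forall v, (v < j)%N -> nmem st1 7 v = 0%N) _ (env_n e)) => //.
  move=> j st1 jn f1 ej Ij; apply: runs_setN => //= v.
  rewrite ltnS leq_eqVlt ej /update /= => /predU1P[->|vj]; first by rewrite eqxx.
  by rewrite (ltn_eqF vj) Ij.
move=> st0 f0 h7; have e0 := env_frame f0 isT e.
apply: (runs_for (I := fun j st1 => open_rel st st1 (iter j step (iota 0 n, [::]))) _ (env_n e0)) => //.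
  apply: (@open_rel_frame [:: 11] [::] _ st0) => //; first exact: frame_setN.
  split=> //=.
  - by split => //; exact: iota_ltn_sorted.
  - by move=> v vn; rewrite h7// mem_iota vn.
  - by rewrite f0.1// e3 addn0; split=> // k ka; rewrite f0.1// f0.2.
move=> j st1 jn f1 ej Ij.
have f2 : frame [:: 11; 7; 20; 12; 23; 24; 8; 4; 3] [:: 4] st st1.
  apply: frame_trans (frame_widen _ _ f0) _ => //; exact: frame_widen f1.
have e1 := env_frame f2 isT e.
have eq1 : nmem st1 21 0 = q by rewrite f2.1.
have er1 v : (v < n)%N -> rmem st1 7 v = r v by move=> vn; rewrite f2.2// er.
have sz : (a0 + size (iter j step (iota 0 n, [::])).2 < N)%N.
  by apply: leq_trans aN; rewrite ltn_add2l (leq_ltn_trans (size_step j)).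
apply: runs_conseq (runs_open1 e1 eq1 er1 sz Ij) _ => st2 f3 h.
by apply: (@open_rel_frame [:: 11] [::] _ st2) => //; exact: frame_setN.
Qed.

End Open.

(** * Assignment of the requests, and the main loop *)

Definition CFinal :=
  CFor 11 1
    (CIf (BEq (NGet 6 (V 11)) (NLit 3))
       (CSeq (CArgmin 12 0 7 1 (fun z => Dst z (V 11)))
          (CSeq (CSetN 5 (V 11) (NGet 8 (NSub (V 20) (NLit 1)))) (CSetN 6 (V 11) (NLit 1))))
       (CIf (BEq (NGet 6 (V 11)) (NLit 2))
          (CSeq (CSetR 6 (V 11) (RAdd (W 11) (W 11))) (CSetN 6 (V 11) (NLit 0)))
          CSkip)).

Definition CServe :=
  CSeq (CSetN 21 (NLit 0) (NSub (V 20) (NLit 1)))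
    (CSeq (CSetR 11 (NLit 0) (RGet 6 (V 21)))
      (CSeq CEligible (CSeq CReduced (CSeq CPick (CSeq CRadius (CSeq COpen CFinal)))))).

Definition CStep :=
  CSeq (CArgmin 11 1 6 0 (RGet 3)) (CIf (BLeN (NLit 1) (V 20)) CServe CSkip).

Definition CMain := CFor 10 1 CStep.

Section Main.
Variables (R : realType) (N : nat).
Implicit Types (st : state R) (Q : state R -> Prop).
Variables (n m : nat) (f : nat -> R) (delta : nat -> nat -> R).
Variables (loc : nat -> nat) (rel dl : nat -> R).
Let d v i := delta v (loc i).

Hypothesis N3 : (3 <= N)%N.
Hypothesis mnN : (m * n <= N)%N.
Hypothesis loc_lt : forall i, (i < m)%N -> (loc i < n)%N.
Hypothesis f_gt0 : forall v, 0 < f v.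
Hypothesis delta_ge0 : forall u v, 0 <= delta u v.
Hypothesis delta_refl : forall v, delta v v = 0.
Hypothesis deltaC : forall u v, delta u v = delta v u.

Let env := env n m f delta loc rel dl.

Lemma runs_final st (x : progress) q todo (o : seq nat) (B : R) :
  env st -> status m rel dl x q st todo ->
  {subset todo <= eligible m rel dl x q} ->
  (forall v, (v < n)%N -> (nmem st 7 v == 1%N) = (v \in o)) -> rmem st 11 0 = B ->
  let Q := select (eligible m rel dl x q) todo in
  runs N CFinal st (fun st' => forall i, (i < m)%N ->
    [/\ nmem st' 6 i = x.1 i || (i \in Q),
        rmem st' 6 i = (if i \in todo then B + B else rmem st 6 i) &
        nmem st' 5 i = if i \in Q
          then nmem st 8 (argmin (d^~ i) [seq z <- iota 0 n | z \in o]).-1 else nmem st 5 i]).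
Proof.
move=> e hs sub ho hB Q.
pose post (i : nat) st' := [/\ nmem st' 6 i = x.1 i || (i \in Q),
        rmem st' 6 i = (if i \in todo then B + B else rmem st 6 i) &
        nmem st' 5 i = if i \in Q
          then nmem st 8 (argmin (d^~ i) [seq z <- iota 0 n | z \in o]).-1 else nmem st 5 i].
have inQ i : (i < m)%N -> (nmem st 6 i == 3%N) = (i \in Q).
  move=> im; have /(congr1 (fun l : seq nat => i \in l)) := filter_status3 hs.
  by rewrite mem_filter mem_iota leq0n add0n im !andbT -/Q => ->.
have intodo i : (i < m)%N -> (nmem st 6 i == 2%N) = (i \in todo).
  move=> im; rewrite hs//; case it : (i \in todo).
    by have := sub _ it; rewrite mem_eligible => /and4P[_ /negPf -> _ _].
  by case: (x.1 i) => //; case: ifP.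
have other i : (i < m)%N -> i \notin todo -> i \notin Q -> nmem st 6 i = x.1 i.
  move=> im; rewrite -inQ// hs// => /negPf ->; case: (x.1 i) => //; by case: ifP.
have served i : i \in Q -> x.1 i = false.
  by rewrite mem_filter => /andP[_]; rewrite mem_eligible => /and4P[_ /negPf].
have servedt i : i \in todo -> x.1 i = false.
  by move=> /sub; rewrite mem_eligible => /and4P[_ /negPf].
have disj i : i \in Q -> i \notin todo by rewrite mem_filter => /andP[].
(* Statuses are overwritten in place: requests below the counter are final, the others still as
   before the loop. *)
apply: (runs_for (I := fun j st1 => forall i, (i < m)%N -> if (i < j)%N then post i st1 else
  [/\ nmem st1 6 i = nmem st 6 i, rmem st1 6 i = rmem st 6 i & nmem st1 5 i = nmem st 5 i])
  _ (env_m e)) => //; last first.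
  by move=> st' h i im; have := h i im; rewrite im.
move=> j st1 jm f1 ej Ij; have e1 := env_frame f1 isT e.
have [g1 g2 g3] : [/\ nmem st1 6 j = nmem st 6 j, rmem st1 6 j = rmem st 6 j &
    nmem st1 5 j = nmem st 5 j] by have := Ij j jm; rewrite ltnn.
apply: runs_if; rewrite beval_eq /= ej g1 inQ// => jQ.
  have hkey st' e0 i : frame [:: 20; 12]%N [::] st1 st' -> (i < n)%N -> neval st' e0 = i ->
    reval st' (Dst e0 (V 11)) = d i j.
    move=> f2 im en; have e2 := env_frame f2 isT e1.
    by rewrite (reval_dist loc_lt e2 en (j := j))//= f2.1.
  apply: runs_seq; apply: runs_conseq
    (@runs_argmin _ N 12 0 7 1 (fun z => Dst z (V 11)) st1 (d^~ j) n (env_n e1) isT hkey) _.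
  have -> : [seq z <- iota 0 n | nmem st1 7 z == 1%N] = [seq z <- iota 0 n | z \in o].
    apply: eq_in_filter => z; rewrite mem_iota /= => zn; rewrite f1.1//; exact: ho.
  move=> st2 f2 h20; apply: runs_seq; apply: runs_setN => [bd|]; first exact: bd.
  apply: runs_setN => [_|] /=; first by apply: leq_trans N3.
  rewrite h20 subn1 f2.1// ej => i im; rewrite /post /update /= !f2.1// !f2.2// ej.
  rewrite ltnS leq_eqVlt; case: eqVneq => [->|_] /=; last exact: Ij.
  by rewrite jQ (negPf (disj _ jQ)) orbT g2 f1.1.
apply: runs_if; rewrite beval_eq /= ej g1 intodo// => jt.
  apply: runs_seq; apply: runs_setR; apply: runs_setN => //= i im.
  rewrite /post /update /= ej ltnS leq_eqVlt; case: eqVneq => [->|_] /=; last exact: Ij.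
  by rewrite (negPf jQ) jt servedt// f1.2// hB g3.
apply: runs_skip => i im; rewrite /post /update /= ltnS leq_eqVlt.
case: eqVneq => [->|_] /=; last exact: Ij.
by rewrite g1 g2 g3 (negPf jQ) (negPf jt) orbF other.
Qed.

Hypothesis delta_triangle : forall u v w, delta u w <= delta u v + delta v w.
Hypothesis rel_le_dl : forall i, (i < m)%N -> rel i <= dl i.

Let st_at := state_at n m f delta loc rel dl.
Let serv := services n m f delta loc rel dl.
Let y0 : R * nat * seq nat := (0, 0%N, [::]).

(** Array 5 is meaningful only for served requests, hence the test [x.1 i] in the last clause. The
    fourth clause prevents a new action, whose index is at least [size acts], from appearing to
    serve a request served before. *)
Definition main_rel (x : progress) (acts : seq (R * nat * seq nat)) st :=
  [/\ forall i, (i < m)%N -> nmem st 6 i = x.1 i,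
      forall i, (i < m)%N -> rmem st 6 i = scale n f (x.2 i),
      nmem st 3 0 = size acts,
      forall i, (i < m)%N -> x.1 i -> (nmem st 5 i < size acts)%N
    & forall k, (k < size acts)%N ->
        [/\ rmem st 4 k = (nth y0 acts k).1.1, nmem st 4 k = (nth y0 acts k).1.2 &
            forall i, (i < m)%N -> (i \in (nth y0 acts k).2) = x.1 i && (nmem st 5 i == k)]].

Lemma main_rel_frame wn wr x acts st st' : frame wn wr st st' ->
  [&& 3 \notin wn, 4 \notin wn, 5 \notin wn, 6 \notin wn, 4 \notin wr & 6 \notin wr]%N ->
  main_rel x acts st -> main_rel x acts st'.
Proof.
move=> [fn fr] /and5P[w3 w4 w5 w6 /andP[v4 v6]] [h1 h2 h3 h4 h5].
by split; rewrite ?(fn 3%N)// ?(fn 4%N)// ?(fn 5%N)// ?(fn 6%N)// ?(fr 4%N)// ?(fr 6%N).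
Qed.

Lemma size_services x : (forall i, (base_level n f delta loc i <= x.2 i)%N) ->
  (size (serv x) <= n)%N.
Proof.
move=> bl; rewrite /serv /services; case: argmin => // q; rewrite size_map.
have c0 w : 0 <= reduced_cost n f (scale n f (x.2 q)) w by exact: reduced_cost_ge0.
rewrite -[X in (_ <= X)%N](size_iota 0); apply: uniq_leq_size.
  by rewrite /facilities; apply: opened_uniq c0 delta_ge0 delta_refl deltaC.
move=> v /(opened_lt c0 delta_ge0 delta_refl deltaC).
by rewrite mem_iota.
Qed.

Lemma runs_serve st x acts q : env st -> main_rel x acts st ->
  argmin dl (pending m x) = q.+1 -> nmem st 20 0 = q.+1 ->
  (forall i, (base_level n f delta loc i <= x.2 i)%N) -> (size acts + n <= N)%N ->
  runs N CServe st (main_rel (serve_step n m f delta loc rel dl x) (acts ++ serv x)).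
Proof.
move=> e [h6 hl h3 h5 hk] trig h20 bl szN.
have := argmin_mem (pending_sorted m x) trig; rewrite mem_pending => /andP[qm nq].
have n0 : (0 < n)%N by apply: leq_ltn_trans (loc_lt qm).
set B := scale n f (x.2 q); set E := eligible m rel dl x q.
set c := reduced_cost n f B.
have c0 w : 0 <= c w by exact: reduced_cost_ge0.
set D := deferred n m f delta loc rel dl x q; set Q := taken n m f delta loc rel dl x q.
have subD : {subset D <= E} by apply: deferred_sub.
apply: runs_seq; apply: runs_setN => [bd|].
  by rewrite /= (leq_trans (leq_subr _ _))//; exact: bd.
apply: runs_seq; apply: runs_setR; set st1 := State _ _.
have f1 : frame [:: 21] [:: 11] st st1.
  apply: frame_trans (frame_setN _ _ _ _ _) (frame_setR _ _ _ _ _); by rewrite inE.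
have e1 := env_frame f1 isT e.
have eq1 : nmem st1 21 0 = q by rewrite /st1 /= /update /= h20 subn1.
have hB1 : rmem st1 11 0 = B by rewrite /st1 /= /update /= h20 subn1 /= hl.
have h61 i : (i < m)%N -> nmem st1 6 i = x.1 i by rewrite f1.1//; exact: h6.
have hl1 i : (i < m)%N -> rmem st1 6 i = scale n f (x.2 i) by rewrite f1.2//; exact: hl.
apply: runs_seq; apply: runs_conseq (runs_eligible N3 f_gt0 qm e1 eq1 h61 hl1 hB1) _.
move=> st2 f2 hs2; have e2 := env_frame f2 isT e1.
have hB2 : rmem st2 11 0 = B by rewrite f2.2.
apply: runs_seq; apply: runs_conseq (runs_reduced e2 hB2) _.
move=> st3 f3 h83; have e3 := env_frame f3 isT e2.
have hB3 : rmem st3 11 0 = B by rewrite f3.2.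
have eq3 : nmem st3 21 0 = q by rewrite f3.1// f2.1.
have hs3 : status m rel dl x q st3 E by move=> i im; rewrite f3.1// hs2.
apply: runs_seq; apply: runs_conseq (runs_pick N3 loc_lt qm e3 eq3 h83 hB3 hs3) _.
move=> st4 f4 hs4; have e4 := env_frame f4 isT e3.
have eq4 : nmem st4 21 0 = q by rewrite f4.1.
have h84 v : (v < n)%N -> rmem st4 8 v = c v by rewrite f4.2//; exact: h83.
apply: runs_seq; apply: runs_conseq (runs_radius loc_lt e4 eq4 qm h84) _.
rewrite (filter_status3 hs4) -/Q => st5 f5 h75; have e5 := env_frame f5 isT e4.
have f15 : frame [:: 21; 11; 20; 12; 6; 13; 14; 25] [:: 11; 8; 12; 13; 14; 7] st st5.
  apply: frame_trans (frame_widen _ _ f1) _ => //.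
  apply: frame_trans (frame_widen _ _ f2) _ => //.
  apply: frame_trans (frame_widen _ _ f3) _ => //.
  apply: frame_trans (frame_widen _ _ f4) _ => //.
  exact: frame_widen f5.
have eq5 : nmem st5 21 0 = q by rewrite f5.1.
have h35 : nmem st5 3 0 = size acts by rewrite f15.1.
apply: runs_seq; apply: runs_conseq (runs_open N3 qm e5 eq5 h35 h75 szN) _.
move=> st6 f6 h; have e6 := env_frame f6 isT e5.
have hB6 : rmem st6 11 0 = B by rewrite f6.2// f5.2// f4.2.
have hs6 : status m rel dl x q st6 D by move=> i im; rewrite f6.1// f5.1// hs4.
set o := facilities n m f delta loc rel dl x q.
have {h} : open_rel n dl q (size acts) st5 st6
    ((iter n (open_step delta loc c q Q) (iota 0 n, [::])).1, o) by exact: h.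
move=> [[_ _] /= o_lt h7 [h36 hold] hnew].
have ho v : (v < n)%N -> (nmem st6 7 v == 1%N) = (v \in o).
  move=> vn; rewrite h7//; case vt : (v \in _); last by case: ifP.
  by apply/esym/negP => /o_lt[_]; rewrite vt.
apply: runs_conseq (runs_final e6 hs6 subD ho hB6) _.
rewrite -/Q => st7 f7 hfin.
have sz : size (serv x) = size o by rewrite /serv /services trig size_map.
have assignedE i : (argmin (d^~ i) [seq z <- iota 0 n | z \in o]).-1 =
  assigned n m f delta loc rel dl x q i by [].
have assigned_in i : assigned n m f delta loc rel dl x q i \in o.
  by have [] := closestP loc q Q c0 delta_ge0 delta_refl deltaC i n0.
have ou : uniq o by rewrite /o /facilities; apply: opened_uniq c0 delta_ge0 delta_refl deltaC.
have h8 v : v \in o -> nmem st6 8 v = (size acts + index v o)%N.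
  move=> vo; have io : (index v o < size o)%N by rewrite index_mem.
  by have [_ _] := hnew _ io; rewrite nth_index.
have notx i : i \in Q -> x.1 i = false.
  by rewrite mem_filter => /andP[_]; rewrite mem_eligible => /and4P[_ /negPf].
have h56 i : nmem st6 5 i = nmem st 5 i by rewrite f6.1// f15.1.
rewrite /serve_step trig -/D -/Q; split=> /=.
- by move=> i im; have [->] := hfin i im.
- move=> i im; have [_ -> _] := hfin i im; case: ifP => _; first by rewrite scaleS mulr_natr mulr2n.
  by rewrite f6.2// f15.2// hl.
- by rewrite f7.1// h36 size_cat sz.
- move=> i im; have [_ _ ->] := hfin i im; rewrite size_cat sz; case iQ : (i \in Q) => /=.
    by move=> _; rewrite assignedE h8// ltn_add2l index_mem.
  by rewrite orbF => /(h5 _ im); rewrite h56 => /leq_trans -> //; exact: leq_addr.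
- move=> k; rewrite size_cat sz nth_cat => ks; case: ltnP => ka.
    have [k1 k2 k3] := hk k ka; have [w1 w2] := hold k ka.
    rewrite f7.1// f7.2// w1 w2 f15.1// f15.2// k1 k2; split => // i im.
    rewrite k3//; have [_ _ ->] := hfin i im; case iQ : (i \in Q) => /=; last by rewrite orbF h56.
    rewrite notx //= assignedE h8//; apply/esym/eqP => kk.
    by move: ka; rewrite -kk ltnNge leq_addr.
  have ko : (k - size acts < size o)%N by rewrite ltn_subLR.
  have [w1 w2 w3] := hnew _ ko; rewrite subnKC// in w1 w2 w3.
  rewrite /serv /services trig (nth_map 0%N)//= -/o f7.1// f7.2// w1 w2; split => // i im.
  have [_ _ ->] := hfin i im; rewrite mem_filter -/Q; case iQ : (i \in Q).
    rewrite andbT orbT assignedE h8//=; set a := assigned _ _ _ _ _ _ _ _ _ _.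
    have -> : (size acts + index a o == k)%N = (index a o == k - size acts)%N.
      by rewrite -{1}(subnKC ka) eqn_add2l.
    by apply/eqP/eqP => [->|<-]; [rewrite index_uniq|rewrite nth_index// assigned_in].
  rewrite andbF orbF h56; case xi : (x.1 i) => //=; apply/esym/eqP => kk.
  by have := h5 _ im xi; rewrite kk ltnNge ka.
Qed.

Let acts j := flatten [seq serv (st_at i) | i <- iota 0 j].

Let actsS j : acts j.+1 = acts j ++ serv (st_at j).
Proof. by rewrite /acts -addn1 iotaD map_cat flatten_cat /= cats0. Qed.

Let size_acts j : (j <= m)%N -> (size (acts j) <= j * n)%N.
Proof.
elim: j => // j IH jm; rewrite actsS size_cat mulSnr leq_add ?IH ?(ltnW jm)//.
have n0 : (0 < n)%N by apply: leq_ltn_trans (loc_lt jm).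
by apply: size_services => i; exact: base_level_le.
Qed.

Lemma runs_step st j : (j < m)%N -> env st -> main_rel (st_at j) (acts j) st ->
  runs N CStep st (main_rel (st_at j.+1) (acts j.+1)).
Proof.
move=> jm e h; have n0 : (0 < n)%N by apply: leq_ltn_trans (loc_lt jm).
apply: runs_seq; have hkey st' e0 i : frame [:: 20; 11]%N [::] st st' -> (i < m)%N -> neval st' e0 = i ->
    reval st' (RGet 3 e0) = dl i.
  by move=> f0 im /= ->; have e' := env_frame f0 isT e; rewrite (env_dl e').
apply: runs_conseq (@runs_argmin _ N 11 1 6 0 (RGet 3) st dl m (env_m e) isT hkey) _.
have -> : [seq i <- iota 0 m | nmem st 6 i == 0%N] = pending m (st_at j).
  apply: eq_in_filter => i; rewrite mem_iota /= => im; have [-> // _ _ _ _] := h.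
  by case: ((st_at j).1 i).
move=> st1 f1 h20; have e1 := env_frame f1 isT e; have h1 := main_rel_frame f1 isT h.
rewrite actsS; have -> : st_at j.+1 = serve_step n m f delta loc rel dl (st_at j) by [].
apply: runs_if; rewrite /= h20 => b.
  have [q Eq] : exists q, argmin dl (pending m (st_at j)) = q.+1.
    by case: (argmin _ _) b => // q _; exists q.
  rewrite Eq in h20; apply: (runs_serve e1 h1 Eq h20) => [i|]; first exact: base_level_le.
  apply: leq_trans mnN; apply: leq_trans (_ : j.+1 * n <= _)%N; last by rewrite leq_mul2r jm orbT.
  by rewrite mulSnr leq_add2r size_acts// ltnW.
apply: runs_skip; move: b; rewrite -leqNgt leqn0 => /eqP b.
by rewrite /serve_step /serv /services b cats0.
Qed.

Lemma runs_main st : env st -> main_rel (st_at 0) [::] st ->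
  runs N CMain st (main_rel (st_at m) (schedule n m f delta loc rel dl)).
Proof.
move=> e h; apply: (runs_for (I := fun j => main_rel (st_at j) (acts j)) _ (env_m e)) => //.
move=> j st1 jm f1 ej Ij; have e1 := env_frame f1 isT e.
apply: runs_conseq (runs_step jm e1 Ij) _ => st2 f2 h2.
by apply: main_rel_frame (frame_setN [::] _ _ _ (mem_head 10%N [::])) _ h2.
Qed.

End Main.

(** * Shortest path distances *)

Lemma iotaS_cat j : iota 0 j.+1 = iota 0 j ++ [:: j].
Proof. by rewrite -addn1 iotaD. Qed.

Definition Idx u v := NAdd (NMul (V u) (NGet 0 (NLit 0))) (V v).

(** The total of the weights stands in for infinity: it bounds every distance, so missing edges may
    receive it. *)
Definition CWeight :=
  CSeq (CSetR 10 (NLit 0) (RNat (NLit 0)))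
    (CFor 10 0 (CFor 11 0 (CSetR 10 (NLit 0) (RAdd (W 10) (RGet 1 (Idx 10 11)))))).

Definition CInit :=
  CFor 10 0 (CFor 11 0
    (CIf (BEq (V 10) (V 11)) (CSetR 5 (Idx 10 11) (RNat (NLit 0)))
      (CIf (BLeN (NLit 1) (NGet 1 (Idx 10 11)))
         (CSetR 5 (Idx 10 11) (RGet 1 (Idx 10 11))) (CSetR 5 (Idx 10 11) (W 10))))).

Definition CRelax :=
  CFor 10 0 (CFor 11 0
    (CIf (BLeR (RGet 5 (Idx 10 11)) (RAdd (RGet 5 (Idx 10 12)) (RGet 5 (Idx 12 11))))
       CSkip
       (CSetR 5 (Idx 10 11) (RAdd (RGet 5 (Idx 10 12)) (RGet 5 (Idx 12 11)))))).

Definition CDist := CSeq CWeight (CSeq CInit (CFor 12 0 CRelax)).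

Section Distances.
Variables (R : realType) (N n : nat).
Implicit Types (st : state R) (Q : state R -> Prop) (D : nat -> nat -> R).
Variable delta : nat -> nat -> R.
Hypothesis delta_ge0 : forall u v, 0 <= delta u v.
Hypothesis delta_triangle : forall u v w, delta u w <= delta u v + delta v w.

Lemma idx_inj u v u' v' : (v < n)%N -> (v' < n)%N ->
  (u * n + v == u' * n + v')%N = (u == u') && (v == v').
Proof.
move=> vn vn'; apply/eqP/andP => [e|[/eqP -> /eqP ->]] //.
have n0 : (0 < n)%N by apply: leq_ltn_trans vn.
have eu : u = u'.
  by have := congr1 (divn^~ n) e; rewrite /= !divnMDl// !divn_small// !addn0.
by move: e; rewrite eu => /addnI ->.
Qed.

Definition relax k D u v := Num.min (D u v) (D u k + D k v).

(** Loop invariant of the algorithm of Floyd and Warshall. The last clause replaces the usual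
    minimality among walks through the first [k] vertices. *)
Definition short D0 k D :=
  [/\ forall u v, (u < n)%N -> (v < n)%N -> delta u v <= D u v,
      forall u, (u < n)%N -> D u u = 0,
      forall u v, (u < n)%N -> (v < n)%N -> D u v <= D0 u v
    & forall x u v, (x < k)%N -> (x < n)%N -> (u < n)%N -> (v < n)%N ->
        D u v <= D u x + D x v].

(* Triangle inequalities through [k] and through the vertices below [k] suffice;
   neither refers to the walks behind the distances. *)
Lemma short_relax D0 k D : short D0 k D -> (k < n)%N -> short D0 k.+1 (relax k D).
Proof.
move=> [hd d0 h0 tri] kn; have ge0 u v : (u < n)%N -> (v < n)%N -> 0 <= D u v.
  by move=> un vn; apply: le_trans (delta_ge0 u v) (hd _ _ un vn).
split.
- move=> u v un vn; rewrite /relax le_min hd//=; apply: le_trans (delta_triangle u k v) _.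
  by rewrite lerD ?hd.
- by move=> u un; rewrite /relax d0// (min_idPl _)// addr_ge0// ge0.
- by move=> u v un vn; rewrite /relax ge_min h0.
- move=> x u v; rewrite ltnS leq_eqVlt => /predU1P[->|xk] xn un vn.
    rewrite /relax d0// addr0 add0r !minxx ge_min; apply/orP; by right.
  have t1 := tri x u v xk xn un vn; have t2 := tri x k v xk xn kn vn.
  have t3 := tri x u k xk xn un kn; have g1 := ge0 k x kn xn; have g2 := ge0 x k xn kn.
  rewrite /relax !minEle; case: ifP => [|/negbT]; rewrite -?ltNge => ?;
    case: ifP => [|/negbT]; rewrite -?ltNge => ?; case: ifP => [|/negbT]; rewrite -?ltNge => ?; lra.
Qed.

Definition matrix_of st D := forall u v, (u < n)%N -> (v < n)%N -> rmem st 5 (u * n + v) = D u v.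

Lemma runs_weight st w : nmem st 0 0 = n ->
  (forall u v, (u < n)%N -> (v < n)%N -> rmem st 1 (u * n + v) = w u v) ->
  runs N CWeight st (fun st' => rmem st' 10 0 =
    \sum_(u <- iota 0 n) \sum_(v <- iota 0 n) w u v).
Proof.
move=> en ew; apply: runs_seq; apply: runs_setR; set st0 := State _ _.
have f0 : frame [::] [:: 10] st st0 by exact: frame_setR.
have en0 : nmem st0 0 0 = n by rewrite f0.1.
apply: (runs_for (I := fun j st1 => rmem st1 10 0 =
    \sum_(u <- iota 0 j) \sum_(v <- iota 0 n) w u v) _ en0) => //.
  by rewrite big_nil.
move=> u st1 un f1 eu Iu; have en1 : nmem st1 0 0 = n by rewrite f1.1.
apply: (runs_for (I := fun j st2 => rmem st2 10 0 =
    \sum_(u <- iota 0 u) \sum_(v <- iota 0 n) w u v + \sum_(v <- iota 0 j) w u v) _ en1) => //.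
- by rewrite big_nil addr0.
- move=> v st2 vn f2 ev Iv; apply: runs_setR => /=.
  rewrite iotaS_cat big_cat big_seq1 /= addrA -Iv; congr (_ + _).
  by rewrite ev f2.2// f2.1// eu f2.1// en1 f1.2// f0.2// ew.
- by move=> st2; rewrite iotaS_cat big_cat big_seq1 /= => ->.
Qed.

(** The matrix is updated in place and in row-major order: entries before the current one have their
    new value, the others the old one. *)
Lemma runs_matrix body st D (D' : nat -> nat -> R) : nmem st 0 0 = n ->
  nat_writes body = [::] -> all [in [:: 5]] (real_writes body) ->
  matrix_of st D ->
  (forall st1 u v, (u < n)%N -> (v < n)%N -> frame [:: 10; 11] [:: 5] st st1 ->
     nmem st1 10 0 = u -> nmem st1 11 0 = v ->
     matrix_of st1 (fun u' v' => if (u' < u)%N || (u' == u) && (v' < v)%N then D' u' v' else D u' v') ->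
     runs N body st1 (fun st2 => matrix_of st2 (fun u' v' =>
       if (u' < u)%N || (u' == u) && (v' < v.+1)%N then D' u' v' else D u' v'))) ->
  runs N (CFor 10 0 (CFor 11 0 body)) st (matrix_of ^~ D').
Proof.
move=> en nb rb hD step.
apply: (runs_for (I := fun u st1 => matrix_of st1 (fun u' v' =>
  if (u' < u)%N then D' u' v' else D u' v')) _ en) => //=.
- by rewrite nb.
- move=> u st1 un; rewrite nb => f1 eu Iu; have en1 : nmem st1 0 0 = n by rewrite f1.1.
  have f1' : frame [:: 10; 11] [:: 5] st st1 by apply: frame_widen f1; rewrite //= ?all_cat rb.
  apply: (runs_for (I := fun v st2 => matrix_of st2 (fun u' v' =>
    if (u' < u)%N || (u' == u) && (v' < v)%N then D' u' v' else D u' v')) _ en1) => //=.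
  + by rewrite nb.
  + by move=> u' v' un' vn'; rewrite andbF orbF Iu.
  + move=> v st2 vn; rewrite nb => f2 ev Iv; have f3 : frame [:: 10; 11] [:: 5] st st2.
      by apply: frame_trans f1' _; apply: frame_widen f2; rewrite //= ?all_cat rb.
    have eu2 : nmem st2 10 0 = u by rewrite f2.1.
    by apply: runs_conseq (step st2 u v un vn f3 eu2 ev Iv) _.
  + by move=> st2 h u1 v1 un1 vn1; rewrite h// vn1 andbT ltnS; case: (ltngtP u1 u).
- by move=> st1 h u v un vn; rewrite h// un.
Qed.

Lemma runs_setD st u v (e : rexp) (y : R) D : nmem st 0 0 = n -> nmem st 10 0 = u ->
  nmem st 11 0 = v -> (u < n)%N -> (v < n)%N -> matrix_of st D -> reval st e = y ->
  runs N (CSetR 5 (Idx 10 11) e) st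
    (matrix_of ^~ (fun u' v' => if (u' == u) && (v' == v) then y else D u' v')).
Proof.
move=> en eu ev un vn hD ey; apply: runs_setR => u' v' un' vn'.
by rewrite /= eu ev en /update /= idx_inj// ey; case: ifP => // _; exact: hD.
Qed.

Let mixed (D' D : nat -> nat -> R) u v u' v' :=
  if (u' < u)%N || (u' == u) && (v' < v)%N then D' u' v' else D u' v'.

Let mixedS D' D u v u' v' : (if (u' == u) && (v' == v) then D' u v else mixed D' D u v u' v') =
  mixed D' D u v.+1 u' v'.
Proof.
rewrite /mixed ltnS [(v' <= v)%N]leq_eqVlt; case: (ltngtP u' u) => //= ->.
by case: (ltngtP v' v) => //= ->.
Qed.

Lemma runs_update st u v (e : rexp) D D' : nmem st 0 0 = n -> nmem st 10 0 = u ->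
  nmem st 11 0 = v -> (u < n)%N -> (v < n)%N -> matrix_of st (mixed D' D u v) ->
  reval st e = D' u v ->
  runs N (CSetR 5 (Idx 10 11) e) st (matrix_of ^~ (mixed D' D u v.+1)).
Proof.
move=> en eu ev un vn hD ey.
apply: runs_conseq (runs_setD en eu ev un vn hD ey) _ => st' _ h u' v' un' vn'.
by rewrite h// mixedS.
Qed.

Lemma runs_init st w (adj : nat -> nat -> bool) M : nmem st 0 0 = n ->
  (forall u v, (u < n)%N -> (v < n)%N -> rmem st 1 (u * n + v) = w u v) ->
  (forall u v, (u < n)%N -> (v < n)%N -> nmem st 1 (u * n + v) = adj u v) ->
  rmem st 10 0 = M ->
  runs N CInit st (matrix_of ^~ (fun u v =>
    if u == v then 0 else if adj u v then w u v else M)).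
Proof.
move=> en hw ha hM; set D' := fun u v : nat => _.
apply: (@runs_matrix _ _ (fun u v => rmem st 5 (u * n + v)) D') => //.
move=> st1 u v un vn f1 eu ev hD.
have en1 : nmem st1 0 0 = n by rewrite f1.1.
apply: runs_if; rewrite beval_eq /= eu ev => uv.
  by apply: runs_update => //=; rewrite /D' uv.
apply: runs_if => /=; rewrite eu ev en1 f1.1// ha// => auv.
  apply: runs_update => //=; rewrite /D' (negPf uv) eu ev en1 f1.2// hw//.
  by case: (adj u v) auv.
apply: runs_update => //=; rewrite /D' (negPf uv) f1.2// hM.
by case: (adj u v) auv.
Qed.

(** Working in place is harmless: as [D k k] is 0, the pass through [k] leaves row and column [k]
    unchanged, so it does not matter whether they have been visited. *)
Lemma runs_relax st D k : nmem st 0 0 = n -> nmem st 12 0 = k -> (k < n)%N ->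
  (forall u, (u < n)%N -> D u u = 0) -> matrix_of st D ->
  runs N CRelax st (matrix_of ^~ (relax k D)).
Proof.
move=> en ek kn d0 hD; apply: (@runs_matrix _ _ D (relax k D)) => //.
move=> st1 u v un vn f1 eu ev hM.
have en1 : nmem st1 0 0 = n by rewrite f1.1.
have ek1 : nmem st1 12 0 = k by rewrite f1.1.
have r1 : reval st1 (RGet 5 (Idx 10 11)) = D u v.
  by rewrite /= eu ev en1 hM// ltnn eqxx ltnn.
have thr w : (w < n)%N -> relax k D w k = D w k /\ relax k D k w = D k w.
  by move=> wn; rewrite /relax d0// addr0 add0r !minxx.
have r2 : reval st1 (RGet 5 (Idx 10 12)) = D u k.
  by rewrite /= eu ek1 en1 hM//; case: ifP => // _; case: (thr u un).
have r3 : reval st1 (RGet 5 (Idx 12 11)) = D k v.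
  by rewrite /= ev ek1 en1 hM//; case: ifP => // _; case: (thr v vn).
have hb : beval st1 (BLeR (RGet 5 (Idx 10 11)) (RAdd (RGet 5 (Idx 10 12)) (RGet 5 (Idx 12 11))))
    = (D u v <= D u k + D k v) by rewrite -r1 -r2 -r3.
apply: runs_if; rewrite hb => le.
  apply: runs_skip => u' v' un' vn'; rewrite -/(mixed (relax k D) D u v.+1 u' v').
  rewrite -mixedS hM//; case: (boolP ((u' == u) && (v' == v))) => [/andP[/eqP -> /eqP ->]|//].
  by rewrite ltnn eqxx ltnn /relax (min_idPl le).
apply: runs_update => //; rewrite /relax (min_idPr _); first by rewrite -r2 -r3.
by rewrite ltW// ltNge.
Qed.

Lemma runs_dist st w (adj : nat -> nat -> bool) : nmem st 0 0 = n ->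
  (forall u v, (u < n)%N -> (v < n)%N -> rmem st 1 (u * n + v) = w u v) ->
  (forall u v, (u < n)%N -> (v < n)%N -> nmem st 1 (u * n + v) = adj u v) ->
  let M := \sum_(u <- iota 0 n) \sum_(v <- iota 0 n) w u v in
  let D0 u v := if u == v then 0 else if adj u v then w u v else M in
  (forall u v, (u < n)%N -> (v < n)%N -> delta u v <= D0 u v) ->
  runs N CDist st (fun st' => exists2 D, matrix_of st' D & short D0 n D).
Proof.
move=> en hw ha M D0 hD0.
apply: runs_seq; apply: runs_conseq (runs_weight en hw) _ => st1 f1 hM.
have en1 : nmem st1 0 0 = n by rewrite f1.1.
have hw1 u v : (u < n)%N -> (v < n)%N -> rmem st1 1 (u * n + v) = w u v by rewrite f1.2//; exact: hw.
have ha1 u v : (u < n)%N -> (v < n)%N -> nmem st1 1 (u * n + v) = adj u v by rewrite f1.1//; exact: ha.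
apply: runs_seq; apply: runs_conseq (runs_init en1 hw1 ha1 hM) _ => st2 f2 hD.
have en2 : nmem st2 0 0 = n by rewrite f2.1.
apply: (runs_for (I := fun k st3 => exists2 D, matrix_of st3 D & short D0 k D) _ en2) => //.
  by exists D0 => //; split=> // u un; rewrite /D0 eqxx.
move=> k st3 kn f3 ek [D hD3 sD]; have en3 : nmem st3 0 0 = n by rewrite f3.1.
have [_ d0 _ _] := sD.
apply: runs_conseq (runs_relax en3 ek kn d0 hD3) _ => st4 f4 h.
by exists (relax k D) => //; exact: short_relax.
Qed.

End Distances.

(** * Initial levels *)

Definition CMin :=
  CSeq (CSetR 15 (NLit 0) (RGet 0 (NLit 0)))
    (CFor 10 0 (CIf (BLeR (W 15) (RGet 0 (V 10))) CSkip (CSetR 15 (NLit 0) (RGet 0 (V 10))))).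

Definition CSingle :=
  CSeq (CSetR 13 (NLit 0) (RAdd (RGet 0 (NLit 0)) (Dst (NLit 0) (V 10))))
    (CFor 11 0
      (CSeq (CSetR 14 (NLit 0) (RAdd (RGet 0 (V 11)) (Dst (V 11) (V 10))))
         (CIf (BLeR (W 13) (W 14)) CSkip (CSetR 13 (NLit 0) (W 14))))).

Definition CLevel :=
  CSeq CSingle
    (CSeq (CSetR 11 (NLit 0) (W 15))
      (CSeq (CWhile (BNot (BLeR (W 13) (W 11))) (CSetR 11 (NLit 0) (RAdd (W 11) (W 11))))
        (CSetR 6 (V 10) (W 11)))).

Definition CLevels := CSeq CMin (CFor 10 1 CLevel).

Section Levels.
Variables (R : realType) (N n m : nat).
Implicit Types (st : state R) (Q : state R -> Prop).
Variables (f : nat -> R) (delta : nat -> nat -> R) (loc : nat -> nat) (rel dl : nat -> R).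
Let d v i := delta v (loc i).
Let env := env n m f delta loc rel dl.
Hypothesis loc_lt : forall i, (i < m)%N -> (loc i < n)%N.
Hypothesis f_gt0 : forall v, 0 < f v.

Lemma runs_min st : env st -> (0 < n)%N -> runs N CMin st (fun st' => rmem st' 15 0 = min_cost n f).
Proof.
move=> e n0; apply: runs_seq; apply: runs_setR; set st0 := State _ _.
have f0 : frame [::] [:: 15] st st0 by exact: frame_setR.
have e0 := env_frame f0 isT e.
apply: (runs_for (I := fun j st1 => rmem st1 15 0 =
  foldl Num.min (f 0) [seq f v | v <- iota 0 j]) _ (env_n e0)) => //.
  by rewrite /st0 /update /= (env_f e).
move=> v st1 vn f1 ev Iv; have e1 := env_frame f1 isT e0.
apply: runs_if; rewrite /= ev (env_f e1)// Iv => hle.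
  by apply: runs_skip; cbv beta; rewrite iotaS_cat map_cat cats1 foldl_rcons /= Iv (min_idPl _).
apply: runs_setR; cbv beta; rewrite iotaS_cat map_cat cats1 foldl_rcons /= ev (env_f e1)//.
by rewrite (min_idPr _)// ltW// ltNge.
Qed.

Lemma runs_single st i : env st -> nmem st 10 0 = i -> (i < m)%N ->
  runs N CSingle st (fun st' => rmem st' 13 0 = single_cost n f delta loc i).
Proof.
move=> e ei im; have n0 : (0 < n)%N by apply: leq_ltn_trans (loc_lt im).
apply: runs_seq; apply: runs_setR; set st0 := State _ _.
have f0 : frame [::] [:: 13] st st0 by exact: frame_setR.
have e0 := env_frame f0 isT e.
apply: (runs_for (I := fun j st1 => rmem st1 13 0 =
  foldl Num.min (f 0 + d 0 i) [seq f v + d v i | v <- iota 0 j]) _ (env_n e0)) => //.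
  have h : reval st (Dst (NLit 0) (V 10)) = d 0 i by exact: (reval_dist loc_lt e).
  by rewrite -h -(env_f e n0).
move=> v st1 vn f1 ev Iv; have e1 := env_frame f1 isT e0.
apply: runs_seq; apply: runs_setR; set st2 := State _ _.
have h14 : rmem st2 14 0 = f v + d v i.
  have h : reval st1 (Dst (V 11) (V 10)) = d v i.
    by apply: (reval_dist loc_lt e1) => //=; rewrite f1.1.
  by rewrite -h -(env_f e1 vn) -ev.
have hb : beval st2 (BLeR (W 13) (W 14)) = (rmem st1 13 0 <= f v + d v i) by rewrite -h14.
apply: runs_if; rewrite hb Iv => hle.
  apply: runs_skip; cbv beta; rewrite iotaS_cat map_cat cats1 foldl_rcons (min_idPl _)//.
apply: runs_setR; cbv beta; rewrite iotaS_cat map_cat cats1 foldl_rcons (min_idPr _) ?[LHS]h14//.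
by rewrite ltW// ltNge.
Qed.

(** This is the only loop not controlled by the numbers of vertices and requests: it doubles the
    least facility cost [base_level] times, hence the assumption that this is at most [N]. *)
Lemma runs_level st i : env st -> nmem st 10 0 = i -> (i < m)%N ->
  (base_level n f delta loc i <= N)%N -> rmem st 15 0 = min_cost n f ->
  runs N CLevel st (fun st' => rmem st' 6 i = scale n f (base_level n f delta loc i) /\
    forall j, j != i -> rmem st' 6 j = rmem st 6 j).
Proof.
move=> e ei im bN h15; have n0 : (0 < n)%N by apply: leq_ltn_trans (loc_lt im).
have [b1 b2] := @base_levelP R n f delta loc f_gt0 i.
apply: runs_seq; apply: runs_conseq (runs_single e ei im) _ => st1 f1 h13.
apply: runs_seq; apply: runs_setR; set st2 := State _ _.
have h11 : rmem st2 11 0 = min_cost n f by rewrite -h15 -(f1.2 15%N).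
have f2 : frame [:: 11] [:: 11; 13; 14] st st2.
  apply: frame_trans (frame_widen _ _ f1) _ => //; exact: frame_setR.
have h132 : rmem st2 13 0 = single_cost n f delta loc i by rewrite -h13.
apply: runs_seq; apply: runs_conseq (@runs_while _ _ _ _ st2 (base_level n f delta loc i)
  (fun k st3 => rmem st3 11 0 = scale n f k /\
     rmem st3 13 0 = single_cost n f delta loc i) bN _ _ _) _.
- by rewrite h11 /scale expr0 mulr1.
- move=> k st3 kb f3 [Ik h]; split; first by rewrite /= h Ik; apply/negP => /b2; rewrite leqNgt kb.
  by apply: runs_setR; rewrite /= Ik scaleS mulr_natr mulr2n.
- by move=> st3 [h h']; rewrite /= h h' negbK.
move=> st3 f3 [h _]; apply: runs_setR => /=.
have e10 : nmem st3 10 0 = i by rewrite f3.1// f2.1.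
split; first by rewrite e10 /update /= eqxx.
by move=> j ji; rewrite e10 /update /= (negPf ji) f3.2// f2.2.
Qed.

Lemma runs_levels st : env st ->
  (forall i, (i < m)%N -> (base_level n f delta loc i <= N)%N) ->
  runs N CLevels st (fun st' => forall i, (i < m)%N ->
    rmem st' 6 i = scale n f (base_level n f delta loc i)).
Proof.
move=> e bN; apply: runs_seq.
apply: runs_conseq (_ : runs N CMin st (fun st1 => (0 < n)%N -> rmem st1 15 0 = min_cost n f)) _.
  (* For [n = 0] the claim is vacuous, but the loop must still be shown to run; it makes no
     iteration. *)
  case: (posnP n) => [n0|n0]; last first.
    by apply: runs_conseq (runs_min e n0) _ => ? _ h _.
  apply: runs_seq; apply: runs_setR; set st0 := State _ _.
  have f0 : frame [::] [:: 15] st st0 by exact: frame_setR.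
  by apply: (runs_for (I := fun _ _ => True) _ (env_n (env_frame f0 isT e))) => // j st1; rewrite n0.
move=> st1 f1 h15; have e1 := env_frame f1 isT e.
apply: (runs_for (I := fun j st2 => forall i, (i < j)%N ->
    rmem st2 6 i = scale n f (base_level n f delta loc i)) _ (env_m e1)) => //.
move=> j st2 jm f2 ej Ij; have e2 := env_frame f2 isT e1.
have n0 : (0 < n)%N by apply: leq_ltn_trans (loc_lt jm).
have h15' : rmem st2 15 0 = min_cost n f by rewrite f2.2// h15.
apply: runs_conseq (runs_level e2 ej jm (bN j jm) h15') _ => st3 f3 [h h'] i.
rewrite ltnS leq_eqVlt => /predU1P[->//|ij] /=.
by rewrite h' ?Ij// ltn_eqF.
Qed.

End Levels.

Definition CProgram := CSeq CDist (CSeq CLevels CMain).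

Section RunProgram.
Variables (R : realType) (N n m : nat).
Implicit Types (st : state R) (Q : state R -> Prop).
Variables (f : nat -> R) (delta : nat -> nat -> R) (loc : nat -> nat) (rel dl : nat -> R).
Variables (w : nat -> nat -> R) (adj : nat -> nat -> bool).
Hypothesis N3 : (3 <= N)%N.
Hypothesis mnN : (m * n <= N)%N.
Hypothesis loc_lt : forall i, (i < m)%N -> (loc i < n)%N.
Hypothesis f_gt0 : forall v, 0 < f v.
Hypothesis delta_ge0 : forall u v, 0 <= delta u v.
Hypothesis delta_refl : forall v, delta v v = 0.
Hypothesis deltaC : forall u v, delta u v = delta v u.
Hypothesis delta_triangle : forall u v w, delta u w <= delta u v + delta v w.
Hypothesis rel_le_dl : forall i, (i < m)%N -> rel i <= dl i.
Hypothesis level_le : forall i, (i < m)%N -> (base_level n f delta loc i <= N)%N.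

Let M := \sum_(u <- iota 0 n) \sum_(v <- iota 0 n) w u v.
Let D0 u v := if u == v then 0 else if adj u v then w u v else M.
Hypothesis delta_le : forall u v, (u < n)%N -> (v < n)%N -> delta u v <= D0 u v.
Hypothesis short_eq : forall D, short n delta D0 n D ->
  forall u v, (u < n)%N -> (v < n)%N -> D u v = delta u v.

Lemma runs_program st :
  nmem st 0 0 = n -> nmem st 0 1 = m ->
  (forall u v, (u < n)%N -> (v < n)%N -> nmem st 1 (u * n + v) = adj u v) ->
  (forall i, (i < m)%N -> nmem st 2 i = loc i) ->
  nmem st 3 0 = 0%N -> (forall i, nmem st 6 i = 0%N) ->
  (forall v, (v < n)%N -> rmem st 0 v = f v) ->
  (forall u v, (u < n)%N -> (v < n)%N -> rmem st 1 (u * n + v) = w u v) ->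
  (forall i, (i < m)%N -> rmem st 2 i = rel i) ->
  (forall i, (i < m)%N -> rmem st 3 i = dl i) ->
  runs N CProgram st (main_rel n m f (state_at n m f delta loc rel dl m)
    (schedule n m f delta loc rel dl)).
Proof.
move=> en em ha hloc e3 e6 hf hw hrel hdl.
apply: runs_seq; apply: runs_conseq (runs_dist delta_ge0 delta_triangle en hw ha delta_le) _.
move=> st1 f1 [D hD /short_eq sD].
have e1 : env n m f delta loc rel dl st1.
  split; try by rewrite ?f1.1 ?f1.2.
  by move=> u v un vn; rewrite hD// sD.
apply: runs_seq; apply: runs_conseq (runs_levels loc_lt f_gt0 e1 level_le) _ => st2 f2 h.
have e2 := env_frame f2 isT e1.
apply: runs_main => //; split=> //=.
- by move=> i im; rewrite f2.1// f1.1.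
- by rewrite f2.1// f1.1.
Qed.

End RunProgram.

(** * Reading the input, and correctness of the distances *)

Lemma nth_allpairs_mul (S T U : Type) (g : S -> T -> U) (s : seq S) (t : seq T) x y z i j :
  (i < size s)%N -> (j < size t)%N ->
  nth z [seq g x y | x <- s, y <- t] (i * size t + j) = g (nth x s i) (nth y t j).
Proof.
elim: s i => // a s IH [|i] /= is_lt jt.
  by rewrite add0n nth_cat size_map jt (nth_map y).
by rewrite mulSn -addnA nth_cat size_map ltnNge leq_addr /= addKn IH.
Qed.

Section Input.
Variables (R : realType) (n : nat) (G : network R n.+1) (s : seq (request R n.+1)).
Hypothesis wfG : wf_network G.
Hypothesis wfs : wf_requests s.

Let f := facility_cost G.
Let delta := vertex_dist G.

Definition weight_at (u v : nat) : R :=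
  if edge G (inord u) (inord v) then edge_weight G (inord u) (inord v) else 0.
Definition adjacent (u v : nat) : bool := edge G (inord u) (inord v).
Definition total_weight : R :=
  \sum_(u <- iota 0 n.+1) \sum_(v <- iota 0 n.+1) weight_at u v.

Lemma total_weightE :
  total_weight = \sum_(u < n.+1) \sum_(v < n.+1 | edge G u v) edge_weight G u v.
Proof.
have sumE (F : nat -> R) : \sum_(u <- iota 0 n.+1) F u = \sum_(u < n.+1) F u.
  by rewrite -(big_mkord xpredT) /index_iota subn0.
rewrite /total_weight sumE; apply: eq_bigr => u _; rewrite sumE [RHS]big_mkcond.
by apply: eq_bigr => v _; rewrite /weight_at !inord_val.
Qed.

(** A walk can be shortened so as to enter each vertex at most once. Charging every edge to the
    vertex it enters, with [c v] the total weight of the edges into [v], bounds its weight. *)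
Lemma dist_le_total u v : dist G u v <= total_weight.
Proof.
have [_ _ hw /(_ u v)/connectP[p]] := wfG.
move=> /shortenP[p' up' /= /andP[_ p'u] _] ->.
apply: le_trans (dist_le_walk wfG up') _; rewrite total_weightE (exchange_big_dep xpredT) //=.
pose c (v : 'I_n.+1) := \sum_(u < n.+1 | edge G u v) edge_weight G u v.
apply: le_trans (_ : \sum_(x <- p') c x <= _).
  elim: p' u up' {p'u} => [|x p' IH] u0 /=; first by rewrite big_nil.
  move=> /andP[e0 xp']; rewrite big_cons lerD ?IH//.
  rewrite /c (bigD1 u0)//= lerDl sumr_ge0// => y /andP[/hw[/ltW]].
  by [].
rewrite (big_uniq _ p'u) [leRHS](bigID (mem p')) /= lerDl sumr_ge0// => x _.
by rewrite /c sumr_ge0// => y /hw[/ltW].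
Qed.

Let D0 u v := if u == v then 0 else if adjacent u v then weight_at u v else total_weight.

Lemma vertex_dist_le u v : (u < n.+1)%N -> (v < n.+1)%N -> delta u v <= D0 u v.
Proof.
move=> un vn; rewrite /D0 /adjacent; case: eqP => [->|_]; first by rewrite /delta /vertex_dist dist_refl.
case: ifP => [e|_]; last exact: dist_le_total.
rewrite /weight_at e; have := @dist_le_walk _ _ _ wfG (inord u) [:: inord v].
by rewrite /= e addr0; apply.
Qed.

(** With the triangle inequality available through every vertex, an induction along a walk bounds
    [D] by its weight. Irreflexivity ensures that [D0] is the edge weight on each step. *)
Lemma short_dist D : short n.+1 delta D0 n.+1 D ->
  forall u v, (u < n.+1)%N -> (v < n.+1)%N -> D u v = delta u v.
Proof.
move=> [lo d0 up tri] u v un vn; apply/eqP; rewrite eq_le lo// andbT.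
have [_ [_ irr] _ _] := wfG.
have walk (x : 'I_n.+1) p : path (edge G) x p -> D x (last x p) <= walk_weight G x p.
  elim: p x => [|y p IH] x /=; first by rewrite d0.
  move=> /andP[xy /IH yp]; apply: le_trans (tri y x _ _ _ _ _) _ => //.
  apply: lerD => //; have := up x y (ltn_ord x) (ltn_ord y).
  rewrite /D0 /adjacent /weight_at !inord_val xy; case: eqP => // /val_inj e.
  by move: xy; rewrite e irr.
apply: le_dist => // p pu e; have := walk _ _ pu; rewrite e.
by rewrite !inordK.
Qed.

Lemma input_fac v : (v < n.+1)%N -> rmem (input G s) 0 v = f v.
Proof.
move=> vn; rewrite /= (nth_map ord0) ?size_enum_ord//; congr fac_cost.
by apply: val_inj; rewrite /= nth_enum_ord// inordK.
Qed.

Let nth_inord u : (u < n.+1)%N -> nth ord0 (enum 'I_n.+1) u = inord u.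
Proof. by move=> un; apply: val_inj; rewrite /= nth_enum_ord// inordK. Qed.

Lemma input_adj u v : (u < n.+1)%N -> (v < n.+1)%N ->
  nmem (input G s) 1 (u * n.+1 + v) = adjacent u v.
Proof.
move=> un vn; rewrite /= -[in X in (u * X)%N](size_enum_ord n.+1).
by rewrite (nth_allpairs_mul _ ord0 ord0) ?size_enum_ord// !nth_inord.
Qed.

Lemma input_weight u v : (u < n.+1)%N -> (v < n.+1)%N ->
  rmem (input G s) 1 (u * n.+1 + v) = weight_at u v.
Proof.
move=> un vn; rewrite /= -[in X in (u * X)%N](size_enum_ord n.+1).
by rewrite (nth_allpairs_mul _ ord0 ord0) ?size_enum_ord// !nth_inord.
Qed.

Lemma input_req i : (i < size s)%N ->
  [/\ nmem (input G s) 2 i = req_loc s i, rmem (input G s) 2 i = req_release s i &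
      rmem (input G s) 3 i = req_deadline s i].
Proof. by move=> si; rewrite /= !(nth_map (Request ord0 0 0)). Qed.

End Input.

(** * Polynomial time *)

(** [polynomial_time] bounds every execution, whereas the program logic only provides one. *)
Lemma exec_deterministic (R : realType) c (st st1 st2 : state R) k1 k2 :
  exec c st st1 k1 -> exec c st st2 k2 -> st1 = st2 /\ k1 = k2.
Proof.
move=> h; elim: h st2 k2 => {c st st1 k1}.
- by move=> st st2 k2 h; inversion h.
- by move=> st x i e st2 k2 h; inversion h.
- by move=> st x i e st2 k2 h; inversion h.
- move=> c1 c2 st st1 st2 k1 k2 _ h1 _ h2 st3 k3 h; inversion h; subst.
  match goal with e : exec c1 _ _ _ |- _ => have [e1 ->] := h1 _ _ e end; subst.
  by match goal with e : exec c2 _ _ _ |- _ => have [-> ->] := h2 _ _ e end.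
- move=> b c1 c2 st st1 k _ h1 st2 k2 h; inversion h; subst.
  by match goal with e : exec (if _ then _ else _) _ _ _ |- _ => have [-> ->] := h1 _ _ e end.
- move=> b c st nb st2 k2 h; inversion h; subst => //.
  by match goal with e : is_true (beval ?s0 _), e' : is_true (~~ beval ?s0 _) |- _ =>
    rewrite e in e' end.
- move=> b c st st1 st2 k1 k2 bt _ h1 _ h2 st3 k3 h; inversion h; subst.
    by match goal with e : is_true (beval ?s0 _), e' : is_true (~~ beval ?s0 _) |- _ =>
      rewrite e in e' end.
  match goal with e : exec c _ _ _ |- _ => have [e1 ->] := h1 _ _ e end; subst.
  by match goal with e : exec (CWhile _ _) _ _ _ |- _ => have [-> ->] := h2 _ _ e end.
Qed.

Section Polynomial.

Definition poly_bounded (g : nat -> nat) := exists p : {poly nat}, forall y, (g y <= p.[y])%N.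

Lemma poly_bounded_le g g' : (forall y, g y <= g' y)%N -> poly_bounded g' -> poly_bounded g.
Proof. by move=> h [p hp]; exists p => y; exact: leq_trans (h y) (hp y). Qed.

Lemma poly_bounded_const a : poly_bounded (fun=> a).
Proof. by exists (a%:P) => y; rewrite hornerC. Qed.

Lemma poly_bounded_id : poly_bounded id.
Proof. by exists 'X => y; rewrite hornerX. Qed.

Lemma poly_boundedD g g' : poly_bounded g -> poly_bounded g' ->
  poly_bounded (fun y => g y + g' y)%N.
Proof. by move=> [p hp] [p' hp']; exists (p + p') => y; rewrite hornerD leq_add. Qed.

Lemma poly_boundedM g g' : poly_bounded g -> poly_bounded g' ->
  poly_bounded (fun y => g y * g' y)%N.
Proof. by move=> [p hp] [p' hp']; exists (p * p') => y; rewrite hornerM leq_mul. Qed.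

Lemma poly_boundedS g : poly_bounded g -> poly_bounded (fun y => (g y).+1).
Proof.
move=> h; apply: poly_bounded_le (poly_boundedD h (poly_bounded_const 1)) => y.
by rewrite addn1.
Qed.

Variable h : nat -> nat.
Hypothesis hP : poly_bounded h.

Lemma poly_bounded_cost c : poly_bounded (fun y => cost_bound (h y) c).
Proof.
have nb e : poly_bounded (fun y => nbound (h y) e).
  elim: e => [k|x i _|e1 h1 e2 h2|e1 h1 e2 _|e1 h1 e2 h2] /=.
  - exact: poly_bounded_const.
  - exact: hP.
  - exact: poly_boundedD.
  - exact: h1.
  - exact: poly_boundedM.
have nc e : poly_bounded (fun y => ncost_bound (h y) e).
  elim: e => [k|x i IH|e1 h1 e2 h2|e1 h1 e2 h2|e1 h1 e2 h2] /=.
  - exact: poly_bounded_const.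
  - exact: poly_boundedD (poly_boundedS hP) IH.
  - exact: poly_boundedD (poly_boundedS (nb (NAdd e1 e2))) (poly_boundedD h1 h2).
  - exact: poly_boundedD (poly_boundedS (nb (NSub e1 e2))) (poly_boundedD h1 h2).
  - exact: poly_boundedD (poly_boundedS (nb (NMul e1 e2))) (poly_boundedD h1 h2).
have rc e : poly_bounded (fun y => rcost_bound (h y) e).
  elim: e => [i|x i|e1 h1 e2 h2|e1 h1 e2 h2|e1 h1 i|e1 h1 i] /=; apply: poly_boundedS => //;
  exact: poly_boundedD.
have bc b : poly_bounded (fun y => bcost_bound (h y) b).
  elim: b => [e1 e2|e1 e2|b1 h1|b1 h1 b2 h2] /=; apply: poly_boundedS => //; exact: poly_boundedD.
elim: c => [|x i e|x i e|c1 h1 c2 h2|b c1 h1 c2 h2|b c1 h1] /=.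
- exact: poly_bounded_const.
- exact/poly_boundedS/poly_boundedD.
- exact/poly_boundedS/poly_boundedD.
- exact/poly_boundedS/poly_boundedD.
- exact: poly_boundedS (poly_boundedD (bc b) (poly_boundedD h1 h2)).
- exact: poly_boundedM (poly_boundedS hP) (poly_boundedS (poly_boundedD (bc b) h1)).
Qed.

End Polynomial.

Section Run.
Variable R : realType.

Lemma schedule_facility_lt n (G : network R n.+1) s y : wf_network G ->
  y \in fl_schedule G s -> (y.1.2 < n.+1)%N.
Proof.
move=> wfG /flattenP[_ /mapP[j _ ->]]; rewrite /services; case: argmin => // q /mapP[v vf ->] /=.
have d1 u u' : 0 <= vertex_dist G u u' by exact: dist_ge0.
have d2 u : vertex_dist G u u = 0 by exact: dist_refl.
have d3 u u' : vertex_dist G u u' = vertex_dist G u' u by exact: dist_sym.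
have c0 B w : 0 <= reduced_cost n.+1 (facility_cost G) B w.
  by apply: reduced_cost_ge0 => u; have [+ _ _ _] := wfG; apply.
exact: opened_lt (c0 _) d1 d2 d3 _ vf.
Qed.

Lemma nth_le N (l : seq nat) i : all (fun a => a <= N)%N l -> (nth 0%N l i <= N)%N.
Proof.
move=> /all_nthP h; case: (ltnP i (size l)) => [/h//|il]; by rewrite nth_default.
Qed.

Lemma bounded_input N n (G : network R n) s : (0 < N)%N -> (n <= N)%N -> (size s <= N)%N ->
  bounded N (input G s).
Proof.
move=> N0 nN sN [|[|[|x]]] i /=.
- by case: i => [|[|i]] //=; rewrite nth_nil.
- apply: nth_le; apply/allP => _ /allpairsP[[u v] [_ _ ->]].
  by case: (edge G _ _).
- by apply: nth_le; elim: s {sN} => //= q s ->; rewrite andbT (leq_trans _ nN)// ltnW.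
- by rewrite nth_nil nth_nil.
Qed.

Definition run_spec N n (G : network R n) s := exists st k,
  [/\ exec CProgram (input G s) st k, (k <= cost_bound N CProgram)%N &
      output st (size s) (fl_algorithm G s)].

Lemma run_input N n (G : network R n.+1) s : wf_network G -> wf_requests s ->
  (3 <= N)%N -> (n.+1 <= N)%N -> (size s <= N)%N -> (size s * n.+1 <= N)%N ->
  (forall i, (i < size s)%N ->
     base_level n.+1 (facility_cost G) (vertex_dist G) (req_loc s) i <= N)%N ->
  run_spec N G s.
Proof.
move=> wfG wfs N3 nN sN snN bN.
have f0 v : 0 < facility_cost G v by have [+ _ _ _] := wfG; apply.
have rd i : (i < size s)%N -> req_release s i <= req_deadline s i.
  by have [_ /all_nthP h] := wfs; exact: h.
have delta0 u v : 0 <= vertex_dist G u v by exact: dist_ge0.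
have deltar v : vertex_dist G v v = 0 by exact: dist_refl.
have deltaC u v : vertex_dist G u v = vertex_dist G v u by exact: dist_sym.
have deltat u v w : vertex_dist G u w <= vertex_dist G u v + vertex_dist G v w.
  exact: dist_triangle.
have locl i : (i < size s)%N -> (req_loc s i < n.+1)%N by move=> _; exact: ltn_ord.
have q2 i : (i < size s)%N -> nmem (input G s) 2 i = req_loc s i by move=> /(input_req G)[].
have r2 i : (i < size s)%N -> rmem (input G s) 2 i = req_release s i by move=> /(input_req G)[].
have r3 i : (i < size s)%N -> rmem (input G s) 3 i = req_deadline s i by move=> /(input_req G)[].
have bnd : bounded N (input G s) by apply: bounded_input => //; exact: leq_trans N3.
have zero i : nmem (input G s) 6 i = 0%N by rewrite /= nth_nil.
have [st [k [ex kc _ [h6 _ h3 _ h5]]]] := @runs_program R N n.+1 (size s) (facility_cost G)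
  (vertex_dist G) (req_loc s) (req_release s) (req_deadline s) (weight_at G) (adjacent G)
  N3 snN locl f0 delta0 deltar deltaC deltat rd bN (vertex_dist_le wfG)
  (@short_dist _ _ _ wfG) (input G s) erefl erefl (input_adj G s) q2 erefl zero
  (input_fac G s) (input_weight G s) r2 r3 bnd.
exists st, k; split => //; split; first by rewrite h3 /= size_map.
move=> a; have ks : (a < size (fl_schedule G s))%N by rewrite -(size_map (@to_action R n)); exact: ltn_ord.
rewrite (tnth_nth (to_action n (0, 0%N, [::]))) /= (nth_map (0, 0%N, [::]))//.
have [h4r h4n hin] := h5 a ks; set y := nth _ _ _ in h4r h4n hin *.
have ys : y \in fl_schedule G s by exact: mem_nth.
split => //=; first by rewrite h4n inordK// (schedule_facility_lt wfG ys).
move=> i; rewrite !inE; case: (ltnP i (size s)) => im /=; last first.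
  by apply/negP => /(schedule_window ys)[]; rewrite ltnNge im.
rewrite hin//; have := h6 i im.
(* In the final state every request is served, so the test [x.1 i] of [main_rel] disappears and the
   output condition remains. *)
have : i \notin pending (size s) (state_at n.+1 (size s) (facility_cost G) (vertex_dist G)
    (req_loc s) (req_release s) (req_deadline s) (size s)).
  by rewrite all_served.
by rewrite mem_pending im /= negbK => ->.
Qed.

Lemma network0_requests (s : seq (request R 0)) : s = [::].
Proof. by case: s => // q; case: (loc q). Qed.

Lemma run_input0 N (G : network R 0) s : (3 <= N)%N -> run_spec N G s.
Proof.
move=> N3; rewrite (network0_requests s) /run_spec.
have bnd : bounded N (input G [::]) by apply: bounded_input => //; exact: leq_trans N3.
have zero i : nmem (input G [::]) 6 i = 0%N by rewrite /= nth_nil.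
(* Without vertices and requests any data satisfy the hypotheses; positive constant facility costs
   and zero distances are used. *)
have := @runs_program R N 0 0 (fun=> 1) (fun _ _ => 0) (fun=> 0%N) (fun=> 0) (fun=> 0)
  (fun _ _ => 0) (fun _ _ => false) N3.
move=> /(_ _ _ _ _ _ _ _ _ _ _ _ (input G [::]) erefl erefl _ _ erefl zero _ _ _ _ bnd).
case=> //.
move=> st [k [ex kc _ [_ _ h3 _ _]]]; exists st, k; split => //.
by split => // -[].
Qed.

End Run.

Section RationalData.
Variable R : realType.

Lemma ltn_bitlen a : (a < 2 ^ bitlen a)%N.
Proof. exact: trunc_log_ltn. Qed.

(** Bit lengths add up because [x + c + 1] is at most the product of [x + 1] and [c + 1]. *)
Lemma sum_ltn_pow (I : finType) (P : pred I) (x b : I -> nat) :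
  (forall i, P i -> (x i < 2 ^ b i)%N) -> (\sum_(i | P i) x i < 2 ^ (\sum_(i | P i) b i))%N.
Proof.
move=> xb; elim/big_rec2: _ => // i c a Pi ac; rewrite expnD.
have := leq_mul (xb i Pi) ac; apply: leq_trans; rewrite mulSn mulnS; lia.
Qed.

Lemma ratr_le_numq (x : rat) : 0 < x -> ratr x <= `|numq x|%N%:R :> R.
Proof.
move=> x0; rewrite /ratr ler_pdivrMr; last by rewrite ltr0z denq_gt0.
have -> : (`|numq x|%N%:R : R) = (numq x)%:~R by rewrite natr_absz gtr0_norm ?numq_gt0.
rewrite -intrM ler_int ler_peMr//; last by rewrite -gtz0_ge1 denq_gt0.
by rewrite numq_ge0 ltW.
Qed.

Lemma ratr_ge_denq (x : rat) : 0 < x -> 1 <= ratr x * `|denq x|%N%:R :> R.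
Proof.
move=> x0; have -> : (`|denq x|%N%:R : R) = (denq x)%:~R by rewrite natr_absz normr_denq.
rewrite /ratr mulfVK ?intr_eq0 ?denq_eq0//.
by rewrite -[1]/(1%:~R) ler_int -gtz0_ge1 numq_gt0.
Qed.

Variables (n : nat) (G : network rat n.+1) (s : seq (request rat n.+1)).
Let G' := map_network (ratr : rat -> R) G.
Let s' := map (map_request (ratr : rat -> R) (n := n.+1)) s.
Hypothesis wfG : wf_network G'.

Let weight_size := (\sum_(u < n.+1) \sum_(v < n.+1 | edge G u v) rat_size (edge_weight G u v))%N.

Lemma total_weight_lt : total_weight G' + 1 <= 2 ^+ weight_size.
Proof.
rewrite total_weightE //=.
pose x u v := `|numq (edge_weight G u v)|%N.
apply: le_trans (_ : (\sum_(u < n.+1) \sum_(v < n.+1 | edge G u v) x u v)%N%:R + 1 <= _).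
  rewrite lerD2r natr_sum; apply: ler_sum => u _; rewrite natr_sum; apply: ler_sum => v uv.
  apply: ratr_le_numq; have [_ _ hw _] := wfG; have [+ _] := hw u v uv.
  by rewrite /= ltr0q.
rewrite -natrX natr1 ler_nat; apply: sum_ltn_pow => u _; apply: sum_ltn_pow => v _.
apply: leq_trans (ltn_bitlen _) _; rewrite leq_pexp2l// /rat_size.
exact: leq_addr.
Qed.

(** Let [v] have the least cost. Its denominator has at most [b] bits, so [f v * 2 ^ b] is at least
    1, and every distance is at most [2 ^ weight_size - 1]. Hence serving [i] from [v] costs at most
    [f v * 2 ^ (weight_size + b)]. *)
Lemma base_level_rat i : (i < size s')%N ->
  (base_level n.+1 (facility_cost G') (vertex_dist G') (req_loc s') i <= instance_size G s)%N.
Proof.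
move=> _; set f := facility_cost G'; set delta := vertex_dist G'.
have f0 v : 0 < f v by have [+ _ _ _] := wfG; apply.
have [_] := @base_levelP R n.+1 f delta (req_loc s') f0 i; apply.
have [v vn ev] : exists2 v, (v < n.+1)%N & min_cost n.+1 f = f v.
  rewrite /min_cost; have [->|/mapP[v]] := foldl_min_mem (f 0) [seq f v | v <- iota 0 n.+1].
    by exists 0%N.
  by rewrite mem_iota => vn ->; exists v.
apply: le_trans (single_cost_le _ _ _ _ vn) _; rewrite /scale ev.
have tw := total_weight_lt; have dl := @dist_le_total R n G' wfG (inord v) (inord (req_loc s' i)).
set x := fac_cost G (inord v); set b := rat_size x.
have x0 : 0 < x by have := f0 v; rewrite /f /facility_cost /= ltr0q.
have fb : 1 <= f v * 2 ^+ b.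
  apply: le_trans (ratr_ge_denq x0) _; rewrite ler_pM2l ?f0//.
  rewrite -natrX ler_nat ltnW// (leq_trans (ltn_bitlen _))// leq_pexp2l//.
  exact: leq_addl.
have bS : (weight_size + b <= instance_size G s)%N.
  rewrite /instance_size -/weight_size; set rest := (\sum_(q <- s) _)%N.
  have : (b <= \sum_(v < n.+1) rat_size (fac_cost G v))%N by rewrite (bigD1 (inord v))//= leq_addr.
  lia.
apply: le_trans (_ : f v * 2 ^+ (weight_size + b) <= _); last first.
  by rewrite ler_pM2l ?f0// ler_weXn2l// ler1n.
have b1 : 1 <= 2 ^+ b :> R by rewrite -natrX ler1n expn_gt0.
have w1 : 1 <= 2 ^+ weight_size :> R by rewrite -natrX ler1n expn_gt0.
have fv := f0 v; rewrite exprD.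
rewrite /delta /vertex_dist; move: tw dl fb b1 w1 fv.
set T := total_weight _; set d := dist _ _ _; set A := 2 ^+ weight_size; set C := 2 ^+ b.
move=> h1 h2 h3 h4 h5 h6.
have : (A - 1) * 1 <= (A - 1) * (f v * C) by rewrite ler_wpM2l// subr_ge0.
have : f v * 1 <= f v * C by rewrite ler_wpM2l// ltW.
lra.
Qed.

Lemma size_le_instance : (n.+1 <= instance_size G s)%N /\ (size s <= instance_size G s)%N.
Proof.
split; first by rewrite /instance_size -!addnA leq_addr.
rewrite /instance_size; apply: leq_trans (leq_addl _ _).
rewrite -sum1_size; apply: leq_sum => q _; rewrite /bitlen; lia.
Qed.

End RationalData.

Section Complexity.
Variable R : realType.

Lemma fl_polynomial_time : polynomial_time (@fl_algorithm R).
Proof.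
(* For [y] the instance size, the square of [y + 3] dominates everything required of [N]: 3, the
   numbers of vertices and requests, their product, and the initial levels. *)
have [p hp] : poly_bounded (fun y => cost_bound ((y + 3) * (y + 3)) CProgram).
  apply: (poly_bounded_cost (h := fun y => ((y + 3) * (y + 3))%N)).
  by apply: poly_boundedM; apply: poly_boundedD poly_bounded_id (poly_bounded_const _).
exists CProgram, p; split.
  move=> [|n] G s wfG wfs.
    by have [st [k [ex _ out]]] := run_input0 G s (leqnn 3); exists st, k.
  pose bl i := base_level n.+1 (facility_cost G) (vertex_dist G) (req_loc s) i.
  (* Real data admit no bound on the initial levels in terms of the size, so [N] includes their
     maximum; only termination and output matter here. *)
  pose N := (3 + n.+1 + size s + size s * n.+1 + \max_(i < size s) bl i)%N.
  have bN i : (i < size s)%N -> (bl i <= N)%N.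
    move=> im; have := @leq_bigmax _ (fun i : 'I_(size s) => bl i) (Ordinal im).
    by rewrite /N /=; lia.
  have [||||st [k [ex _ out]]] := @run_input R N n G s wfG wfs _ _ _ _ bN; try by rewrite /N; lia.
  by exists st, k.
move=> [|n] G s G' s' wfG wfs st k ex; apply: leq_trans (hp _);
    set N := ((_ + 3) * (_ + 3))%N.
  have N3 : (3 <= N)%N by rewrite /N; nia.
  have [st' [k' [ex' kN _]]] := run_input0 G' s' N3.
  by have [_ ->] := exec_deterministic ex ex'.
have [nS sS] := size_le_instance G s; have es : size s' = size s by rewrite size_map.
have [||||i im|st' [k' [ex' kN _]]] := @run_input R N n G' s' wfG wfs.
- by rewrite /N; nia.
- by rewrite /N; nia.
- by rewrite es /N; nia.
- by rewrite es /N; nia.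
- by apply: leq_trans (base_level_rat wfG im) _; rewrite /N; nia.
by have [_ ->] := exec_deterministic ex ex'.
Qed.

End Complexity.

Section Final.
Variable R : realType.

Definition ratio (n : nat) : R := (16 + (up_log 2 n)%:R * 4) * 13.

Lemma fl_online : online_algorithm (@fl_algorithm R).
Proof.
split; first by move=> [|n] // G s s' t wfG wfs wfs'; exact: fl_nonanticipating.
move=> [|n] G s wfG wfs; last exact: fl_feasible.
by rewrite (network0_requests s); split=> //= -[].
Qed.

Lemma fl_competitive_ratio : competitive (@fl_algorithm R) ratio.
Proof.
move=> [|n] G s wfG wfs; last by apply: fl_competitive => //; exact: up_logP.
rewrite {1}/cost big_nil mulr_ge0 ?mulr_ge0 ?addr_ge0 ?mulr_ge0//.
apply: lb_le_inf.
  exists (cost G s [::]), [::] => //; rewrite (network0_requests s); by split=> //= -[].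
by move=> _ [[|a S] _ <-]; [rewrite /cost big_nil|case: (facility a)].
Qed.

(** Half of [2 ^ up_log 2 n] is below [n] and 2 is at most [n], so the power is at most the square
    of [n]. *)
Lemma up_log_le_ln n : (1 < n)%N -> (up_log 2 n)%:R * ln 2 <= ln (n%:R : R) *+ 2.
Proof.
move=> n1; have n0 : 0 < n%:R :> R by rewrite ltr0n (ltn_trans _ n1).
have h : (2 ^ up_log 2 n <= n * n)%N.
  have := up_log_gtn (isT : 1 < 2)%N n1; have := up_log_gt0 2 n; rewrite n1 /= => k0.
  by rewrite -[in (2 ^ up_log 2 n)%N](prednK k0) expnS; nia.
rewrite -lnXn// mulr_natl -lnXn// ler_ln ?posrE ?exprn_gt0//.
by rewrite -natrX expr2 -natrM ler_nat.
Qed.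

Lemma ratio_bigO : ratio =O_\oo (fun n : nat => ln (n%:R : R)).
Proof.
apply/eqOP; near=> K; near=> n.
have n1 : (1 < n)%N by near: n; exact: nbhs_infty_gt.
have l2 : 0 < ln 2 :> R by rewrite ln_gt0// ltr1n.
have ln2 : ln 2 <= ln (n%:R : R) by rewrite ler_ln ?posrE ?ltr0n ?ler_nat// (ltn_trans _ n1).
have h := up_log_le_ln n1; have ln0 := lt_le_trans l2 ln2.
rewrite !ger0_norm ?(ltW ln0)//; last by rewrite /ratio !mulr_ge0// addr_ge0// mulr_ge0.
(* [13 * 16 = 208] is absorbed using [ln 2 <= ln n], and [13 * 4] times the logarithm contributes
   [52 * 2 = 104]; the sum is 312. *)
apply: le_trans (_ : 312 / ln 2 * ln n%:R <= _).
  by rewrite mulrAC ler_pdivlMr// /ratio; lra.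
by rewrite ler_wpM2r// ?ltW.
Unshelve. all: end_near. Qed.

End Final.

Theorem theorem3p8 (R : realType) :
  exists (A : algorithm R) (alpha : nat -> R),
    [/\ online_algorithm A,
        competitive A alpha,
        alpha =O_\oo (fun n : nat => ln (n%:R : R))
      & polynomial_time A].
Proof.
exists (@fl_algorithm R), (@ratio R); split.
- exact: fl_online.
- exact: fl_competitive_ratio.
- exact: ratio_bigO.
- exact: fl_polynomial_time.
Qed.
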